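(* Let $\mathbb K\in\{\mathbb R,\mathbb C,\mathbb H\}$, $\kappa=\dim_{\mathbb R}\mathbb K$, and let $n\ge 2$. For each pair of integers $1\le p<q\le n$ let $\lambda_{pq}\in\mathbb C$, and set $$\nu_{pq}:=-\frac12(q-p-1)\kappa+\sum_{k,m:\ p\le k<q,\ q\le m\le n}\lambda_{km}.$$ Then the integral $$\int_{\mathcal Z_n(\mathbb K)}\ \prod_{1\le p<q\le n}s_{pq}(Z)^{-\lambda_{pq}}\,dZ^{\{n\}}$$ converges absolutely if and only if $\operatorname{Re}\nu_{pq}>\frac{\kappa}{2}$ for all $1\le p<q\le n$, and in this case $$\int_{\mathcal Z_n(\mathbb K)}\ \prod_{1\le p<q\le n}s_{pq}(Z)^{-\lambda_{pq}}\,dZ^{\{n\}}=\pi^{\kappa n(n-1)/4}\prod_{1\le p<q\le n}\frac{\Gamma(\nu_{pq}-\kappa/2)}{\Gamma(\nu_{pq})}.$$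
   Context: $\mathbb H$ denotes the quaternions, and $dz$ denotes Lebesgue measure on $\mathbb K\cong\mathbb R^\kappa$ (standard real coordinates). $\mathcal Z_n(\mathbb K)$ is the space of $n\times n$ matrices $Z=\{z_{km}\}$ over $\mathbb K$ with $z_{km}=0$ for $k>m$, $z_{kk}=1$, and arbitrary entries $z_{km}\in\mathbb K$ for $k<m$. The measure $dZ=dZ^{\{n\}}=\prod_{1\le k<m\le n}dz_{km}$ is Lebesgue measure on $\mathcal Z_n(\mathbb K)$; the superscript $\{n\}$ only emphasizes the size of the matrix. For $Z\in\mathcal Z_n(\mathbb K)$, $[Z]_{pq}$ denotes the upper left corner of $Z$ with $p$ rows and $q$ columns, and $s_{pq}(Z):=\det([Z]_{pq}[Z]_{pq}^* )$, where $*$ is the conjugate transpose. These numbers are positive for $p<q$, and $s^{-\lambda}=e^{-\lambda\ln s}$ for $s>0$. For $\mathbb K=\mathbb H$ the determinant of an $m\times m$ quaternionic matrix $A$ is $\det(A):=\sqrt[4]{\det(A_{\mathbb R})}$, where $A_{\mathbb R}$ is the real linear operator on $\mathbb R^{4m}=\mathbb H^m$ determined by $A$ (one has $\det(A_{\mathbb R})\ge0$). *)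

(* Defs.v *)
From HB Require Import structures.
From mathcomp Require Import all_boot all_order all_algebra.
From mathcomp Require Import ring complex.
From mathcomp Require Import all_classical all_reals all_analysis.

Set Implicit Arguments.
Unset Strict Implicit.
Unset Printing Implicit Defensive.

Import Order.TTheory GRing.Theory Num.Theory.
Import numFieldNormedType.Exports.

Local Open Scope classical_set_scope.
Local Open Scope complex_scope.
Local Open Scope ring_scope.

(* [Quat a b c d] is a + b i + c j + d k. *)
Record quaternion (R : Type) := Quat { qre : R; qi : R; qj : R; qk : R }.
Arguments Quat {R}.

Definition prod_of_quat (R : Type) (x : quaternion R) : R * R * R * R :=
  let: Quat a b c d := x in (a, b, c, d).
Definition quat_of_prod (R : Type) (x : R * R * R * R) : quaternion R :=
  let: (a, b, c, d) := x in Quat a b c d.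
Lemma prod_of_quatK (R : Type) : cancel (@prod_of_quat R) (@quat_of_prod R).
Proof. by case. Qed.

HB.instance Definition _ (R : choiceType) :=
  Choice.copy (quaternion R) (can_type (@prod_of_quatK R)).

Section QuaternionRing.
Variable R : comNzRingType.
Implicit Types x y z : quaternion R.

Definition addq x y :=
  Quat (qre x + qre y) (qi x + qi y) (qj x + qj y) (qk x + qk y).
Definition oppq x := Quat (- qre x) (- qi x) (- qj x) (- qk x).
Definition zeroq : quaternion R := Quat 0 0 0 0.
Definition oneq : quaternion R := Quat 1 0 0 0.
Definition mulq x y :=
  let: Quat a b c d := x in
  let: Quat a' b' c' d' := y in
  Quat (a * a' - b * b' - c * c' - d * d')
       (a * b' + b * a' + c * d' - d * c')
       (a * c' - b * d' + c * a' + d * b')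
       (a * d' + b * c' - c * b' + d * a').
Definition conjq x := Quat (qre x) (- qi x) (- qj x) (- qk x).

Lemma addqA : associative addq.
Proof. by move=> [????] [????] [????]; rewrite /addq /= !addrA. Qed.
Lemma addqC : commutative addq.
Proof. by move=> [????] [????]; rewrite /addq /=; congr Quat; rewrite addrC. Qed.
Lemma add0q : left_id zeroq addq.
Proof. by move=> [????]; rewrite /addq /= !add0r. Qed.
Lemma addNq : left_inverse zeroq oppq addq.
Proof. by move=> [????]; rewrite /addq /= !addNr. Qed.

HB.instance Definition _ :=
  GRing.isZmodule.Build (quaternion R) addqA addqC add0q addNq.

Lemma mulqA : associative mulq.
Proof. by move=> [????] [????] [????]; rewrite /mulq; congr Quat; ring. Qed.
Lemma mul1q : left_id oneq mulq.
Proof. by move=> [????]; rewrite /mulq /=; congr Quat; ring. Qed.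
Lemma mulq1 : right_id oneq mulq.
Proof. by move=> [????]; rewrite /mulq /=; congr Quat; ring. Qed.
Lemma mulqDl : left_distributive mulq addq.
Proof.
by move=> [????] [????] [????]; rewrite /mulq /addq /=; congr Quat; ring.
Qed.
Lemma mulqDr : right_distributive mulq addq.
Proof.
by move=> [????] [????] [????]; rewrite /mulq /addq /=; congr Quat; ring.
Qed.
Lemma oneq_neq0 : oneq != zeroq.
Proof. by apply/eqP => -[/eqP]; rewrite oner_eq0. Qed.

HB.instance Definition _ :=
  GRing.Zmodule_isNzRing.Build (quaternion R) mulqA mul1q mulq1 mulqDl mulqDr
    oneq_neq0.

Definition quat_of_coords (f : 'I_4 -> R) : quaternion R :=
  Quat (f 0) (f 1) (f 2%:R) (f 3%:R).
Definition coords_of_quat x (i : 'I_4) : R :=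
  [:: qre x; qi x; qj x; qk x]`_i.

(* The operator v |-> A v of H^m = R^(4m); row i of X holds the four real
   coordinates of v_i. *)
Definition real_operator m (A : 'M[quaternion R]_m) (X : 'M[R]_(m, 4)) :
    'M[R]_(m, 4) :=
  let v := \col_i quat_of_coords (X i) in
  \matrix_(i, j) coords_of_quat ((A *m v) i 0) j.

End QuaternionRing.

(* lin_mx acts on row vectors, so this is the determinant of the transposed
   matrix of the operator, which is the same. *)
Definition det_quat (R : rcfType) m (A : 'M[quaternion R]_m) : R :=
  Num.sqrt (Num.sqrt (\det (lin_mx (real_operator A)))).

Inductive scalars := Reals | Complexes | Quaternions.

Definition rdim (K : scalars) : nat :=
  match K with Reals => 1 | Complexes => 2 | Quaternions => 4 end.

Section Scalars.
Variable R : realType.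

Definition carrier (K : scalars) : nzRingType :=
  match K with
  | Reals => R
  | Complexes => R[i]
  | Quaternions => quaternion R
  end.

Definition of_coords (K : scalars) : ('I_(rdim K) -> R) -> carrier K :=
  match K return ('I_(rdim K) -> R) -> carrier K with
  | Reals => fun f => f 0
  | Complexes => fun f => f 0 +i* f 1
  | Quaternions => fun f => quat_of_coords f
  end.

Definition conjK (K : scalars) : carrier K -> carrier K :=
  match K return carrier K -> carrier K with
  | Reals => fun x => x
  | Complexes => fun x => conjc x
  | Quaternions => fun x => conjq x
  end.

Definition adjointmx (K : scalars) m n (A : 'M[carrier K]_(m, n)) :
    'M[carrier K]_(n, m) :=
  map_mx (@conjK K) A^T.

(* Only used for Hermitian A; over the complex numbers \det A is then real, so
   that taking its real part loses nothing. *)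
Definition real_det (K : scalars) m : 'M[carrier K]_m -> R :=
  match K return 'M[carrier K]_m -> R with
  | Reals => fun A => \det A
  | Complexes => fun A => complex.Re (\det A)
  | Quaternions => fun A => det_quat A
  end.

(* With 0-based p and q, this is the corner with p.+1 rows and q.+1 columns,
   i.e. [Z]_{p+1,q+1} in 1-based notation. *)
Definition corner (K : scalars) n (Z : 'M[carrier K]_n) (p q : 'I_n) :
    'M[carrier K]_(p.+1, q.+1) :=
  mxsub (widen_ord (ltn_ord p)) (widen_ord (ltn_ord q)) Z.

Definition sminor (K : scalars) n (Z : 'M[carrier K]_n) (p q : 'I_n) : R :=
  real_det (corner Z p q *m adjointmx (corner Z p q)).

End Scalars.

Section LebesgueTuple.
Variable R : realType.
Local Notation mR := (measurableTypeR R).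

Definition cons_pair d (x : mR * d.-tuple mR) : d.+1.-tuple mR :=
  [the d.+1.-tuple mR of x.1 :: x.2].

Lemma measurable_cons_pair d :
  measurable_fun [set: mR * d.-tuple mR] (@cons_pair d).
Proof. exact: measurable_cons. Qed.

Section Step.
Variables (d : nat) (mu : {sigma_finite_measure set (d.-tuple mR) -> \bar R}).

Definition lebesgue_step : set (d.+1.-tuple mR) -> \bar R :=
  pushforward (lebesgue_measure \x mu)%E (@cons_pair d).

Let step0 : lebesgue_step set0 = 0%E.
Proof. by rewrite /lebesgue_step /pushforward preimage_set0 measure0. Qed.

Let step_ge0 A : (0 <= lebesgue_step A)%E.
Proof. by rewrite /lebesgue_step /pushforward; exact: measure_ge0. Qed.

Let step_sigma_additive : semi_sigma_additive lebesgue_step.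
Proof.
move=> F mF tF mUF; rewrite /lebesgue_step /pushforward preimage_bigcup.
have mpre A : measurable A -> measurable (@cons_pair d @^-1` A).
  by move=> mA; rewrite -[X in measurable X]setTI; exact: measurable_cons_pair.
apply: measure_semi_sigma_additive.
- by move=> n; exact: mpre.
- apply/trivIsetP => /= i j _ _ ij; rewrite -preimage_setI.
  by move/trivIsetP : tF => /(_ _ _ _ _ ij) ->//; rewrite preimage_set0.
- by rewrite -preimage_bigcup; exact: mpre.
Qed.

HB.instance Definition _ := isMeasure.Build _ _ _ lebesgue_step
  step0 step_ge0 step_sigma_additive.

Let step_sigma_finite : sigma_finite setT lebesgue_step.
Proof.
have [F TF mF] : sigma_finite setT (lebesgue_measure \x mu)%E.
  have /sigma_finiteP[A [TA ndA Aoo]] := sigma_finiteT (@lebesgue_measure R).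
  have /sigma_finiteP[B [TB ndB Boo]] := sigma_finiteT mu.
  exists (fun n => A n `*` B n).
    rewrite -setXTT TA TB predeqE => -[x y]; split.
      move=> [/= [n _ Anx] [k _ Bky]]; exists (maxn n k) => //; split.
      - by move: x Anx; exact/subsetPset/ndA/leq_maxl.
      - by move: y Bky; exact/subsetPset/ndB/leq_maxr.
    by move=> [n _ []/= ? ?]; split; exists n.
  move=> k; have [? ?] := Aoo k; have [? ?] := Boo k.
  split; first exact: measurableX.
  by rewrite product_measure1E// lte_mul_pinfty// ge0_fin_numE.
pose uncons (t : d.+1.-tuple mR) : mR * d.-tuple mR :=
  (thead t, [tuple of behead t]).
have consK : cancel (@cons_pair d) uncons.
  by case=> a t; congr pair; apply: val_inj.
exists (fun n => uncons @^-1` F n).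
  by rewrite -preimage_bigcup -TF preimage_setT.
move=> n; have [mFn Fnoo] := mF n; split.
  have muncons : measurable_fun setT uncons.
    apply/measurable_fun_pairP; split; first exact: measurable_tnth.
    exact: measurable_behead.
  by rewrite -[X in measurable X]setTI; exact: muncons.
rewrite /lebesgue_step /pushforward.
rewrite (_ : _ @^-1` _ = F n)//.
by apply/seteqP; split => x /=; rewrite consK.
Qed.

HB.instance Definition _ := Measure_isSigmaFinite.Build _ _ _ lebesgue_step
  step_sigma_finite.

End Step.

Fixpoint lebesgue_tuple d : {sigma_finite_measure set (d.-tuple mR) -> \bar R} :=
  match d with
  | 0 => dirac ([tuple] : 0.-tuple mR)
  | d'.+1 => lebesgue_step (lebesgue_tuple d')
  end.

Lemma lebesgue_tuple_box d (A : 'I_d -> set mR) :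
  (forall i, measurable (A i)) ->
  lebesgue_tuple d [set t | forall i, A i (tnth t i)] =
  (\prod_(i < d) lebesgue_measure (A i))%E.
Proof.
elim: d A => [|d IH] A mA.
  rewrite big_ord0 /= diracE mem_set//= => -[].
  by [].
rewrite big_ord_recl -IH; last by move=> i.
rewrite /= /lebesgue_step /pushforward -product_measure1E//; last first.
  rewrite [X in measurable X](_ : _ = \bigcap_(i in [set: 'I_d])
     (fun t : d.-tuple mR => tnth t i) @^-1` A (lift ord0 i)); last first.
    by apply/seteqP; split => t /=; [move=> h i _|move=> h i]; exact: h.
  apply: fin_bigcap_measurable; first exact: finite_finset.
  move=> i _; rewrite -[X in measurable X]setTI.
  exact: measurable_tnth.
congr ((_ \x _)%E _); apply/seteqP; split => -[a t] /=.
  move=> h; split; first exact: (h ord0).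
  by move=> i; have := h (lift ord0 i); rewrite tnthS.
by case=> h0 h i; case: (unliftP ord0 i) => [j|] ->; rewrite ?tnthS//; exact: h.
Qed.

End LebesgueTuple.

Section Complex.
Variable R : realType.

Definition cexp (z : R[i]) : R[i] :=
  (expR (complex.Re z) * cos (complex.Im z)) +i*
  (expR (complex.Re z) * sin (complex.Im z)).

(* s^z for s > 0. *)
Definition cpow (s : R) (z : R[i]) : R[i] := cexp (z * (ln s)%:C).

Section Integral.
Context d (T : measurableType d) (mu : {measure set T -> \bar R}).

Definition abs_integrable (D : set T) (f : T -> R[i]) : Prop :=
  [/\ measurable_fun D (fun x => complex.Re (f x)),
      measurable_fun D (fun x => complex.Im (f x)) &
      (\int[mu]_(x in D) (Normc.normc (f x))%:E < +oo)%E].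

Definition cintegral (D : set T) (f : T -> R[i]) : R[i] :=
  (\int[mu]_(x in D) complex.Re (f x)) +i* (\int[mu]_(x in D) complex.Im (f x)).

End Integral.

(* Euler's integral: this is the Gamma function on the half-plane Re z > 0. *)
Definition cGamma (z : R[i]) : R[i] :=
  cintegral (@lebesgue_measure R) `]0, +oo[%classic
    (fun t : measurableTypeR R => cpow t (z - 1) * (expR (- t))%:C).

End Complex.

(* Positions (k, m) above the diagonal of an n x n matrix. *)
Definition above n := {km : 'I_n * 'I_n | (km.1 < km.2)%N}.

Section Unitriangular.
Variables (R : realType) (K : scalars) (n : nat).

Definition ucoord : finType := (above n * 'I_(rdim K))%type.

Definition uspace := #|ucoord|.-tuple (measurableTypeR R).

(* The measure dZ, transported to the real coordinates of the entries. *)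
Definition lebesgue_unitri := lebesgue_tuple R #|ucoord|.

Definition unitri (x : uspace) : 'M[carrier R K]_n :=
  \matrix_(k, m)
    if insub (k, m) is Some km then
      of_coords (fun c => tnth x (enum_rank ((km, c) : ucoord)))
    else (k == m)%:R.

Implicit Types lambda : 'I_n -> 'I_n -> R[i].

(* Only the entries of lambda above the diagonal occur below. *)
Definition integrand lambda (x : uspace) : R[i] :=
  \prod_(p < n) \prod_(q < n | (p < q)%N)
    cpow (sminor (unitri x) p q) (- lambda p q).

Definition nu lambda (p q : 'I_n) : R[i] :=
  - ((q - p - 1)%N%:R * (rdim K)%:R / 2)
  + \sum_(k < n | (p <= k < q)%N) \sum_(m < n | (q <= m)%N) lambda k m.

End Unitriangular.

(* Main.v *)
From HB Require Import structures.
Require Import Defs.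
From mathcomp Require Import all_boot all_order all_algebra.
From mathcomp Require Import ring lra complex.
From mathcomp Require Import all_classical all_reals all_analysis.
From mathcomp Require Import measurable_realfun.

(** Let S_(p,q) be the determinant of the Gram matrix of the first p rows of Z,
    cut to their first q columns; S_(0,q) = S_(p,p) = 1. The theorem follows
    from an explicit change of variables in which the integrand is a product of
    functions of one real variable.

    As a function of the entry z in row p and column q (counted from 1), the
    number S_(p,q) satisfies

      S_(p,q) S_(p-1,q-1) = |S_(p-1,q-1) z + r|^2 + S_(p,q-1) S_(p-1,q),

    where r and the other determinants do not involve z ([gram_block],
    [cornergram_cross]). This is Gram-Schmidt orthogonalization, and holds over
    the three scalar rings alike, because the determinant of a Hermitian matrix
    is invariant under unipotent congruence. It follows that all S_(p,q) with
    p <= q are positive, and that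

      rho_(p,q) = S_(p,q) S_(p-1,q-1) / (S_(p,q-1) S_(p-1,q)) = 1 + |u|^2,

    with u affine in z. Taking the kappa real coordinates of z one after the
    other, rho_(p,q) is further split as a product of factors 1 + w_c^2, where
    w_c is affine in the c-th coordinate of z ([logwE]). In the lexicographic
    order of the coordinates, the coefficients of each w_c depend on earlier
    coordinates only. Hence dw = J dZ, where J is the product of the slopes
    ([ge0_integral_affine_tuple], [ge0_integral_wcoord]).

    Taking logarithms, S_(p,q) telescopes to the product of rho_(k,m) over
    k <= p < m <= q ([corner_log_sum]), and J too is a product of powers of the
    factors 1 + w_c^2 ([sum_ln_bcoef], [sum_jacobian]). Collecting exponents,
    the integrand is the product over all coordinates of (1 + w_c^2)^(-mu_c),
    times J, with mu_c = nu_(k,m) - (kappa - 1 - c)/2 for 0 <= c < kappa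
    ([integrand_wcoord]). The integral is therefore a product of the integrals
    of (1 + x^2)^(-mu_c) over the line. The one with exponent mu converges
    absolutely if and only if Re mu > 1/2, and then it is equal to
    sqrt(pi) Gamma(mu - 1/2) / Gamma(mu). The condition for c = 0 implies the
    others and reads Re nu > kappa/2; the product over c telescopes to
    pi^(kappa/2) Gamma(nu - kappa/2) / Gamma(nu).

    The one-variable integrals come from exchanging the order of integration in
    a double integral of exponentials ([mellin_tonelli], [mellin_fubini]). The
    division by Gamma(mu) requires that Gamma has no zero with positive real
    part ([cGamma_neq0]): zeros propagate under z -> z + 1, and far to the right
    the integrand of Gamma(x + iy) is concentrated near t = x, where its phase
    is almost constant. *)

Set Implicit Arguments.
Unset Strict Implicit.
Unset Printing Implicit Defensive.

Import Order.TTheory GRing.Theory Num.Theory.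
Import numFieldNormedType.Exports.

Local Open Scope classical_set_scope.
Local Open Scope complex_scope.
Local Open Scope ring_scope.

(** * Complex powers and complex-valued integrals *)

Section ComplexNumbers.
Variable R : realType.
Implicit Types z w : R[i].
Local Notation Re := (@complex.Re R).
Local Notation Im := (@complex.Im R).

Lemma complex_eqP z w : Re z = Re w -> Im z = Im w -> z = w.
Proof. by case: z => ? ?; case: w => ? ? /= -> ->. Qed.

Lemma complex_ReN z : Re (- z) = - Re z. Proof. by case: z. Qed.

Lemma complex_ReM z w : Re (z * w) = Re z * Re w - Im z * Im w.
Proof. by case: z; case: w. Qed.

Lemma complex_ImM z w : Im (z * w) = Re z * Im w + Im z * Re w.
Proof. by case: z; case: w. Qed.

Lemma normc_sqr z : Normc.normc z ^+ 2 = Re z ^+ 2 + Im z ^+ 2.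
Proof. by case: z => a b /=; rewrite sqr_sqrtr// addr_ge0// sqr_ge0. Qed.

Lemma normc_ge0 z : 0 <= Normc.normc z.
Proof. by case: z => a b /=; rewrite sqrtr_ge0. Qed.

Lemma normc_real (x : R) : Normc.normc x%:C = `|x|.
Proof. by rewrite /= expr0n/= addr0 sqrtr_sqr. Qed.

Lemma le_Re_normc z : `|Re z| <= Normc.normc z.
Proof.
by rewrite -[leLHS]sqrtr_sqr; case: z => a b /=; apply: ler_wsqrtr; rewrite lerDl sqr_ge0.
Qed.

Lemma le_Im_normc z : `|Im z| <= Normc.normc z.
Proof.
by rewrite -[leLHS]sqrtr_sqr; case: z => a b /=; apply: ler_wsqrtr; rewrite lerDr sqr_ge0.
Qed.

Lemma le_normc_ReIm z : Normc.normc z <= `|Re z| + `|Im z|.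
Proof.
rewrite -[leRHS]ger0_norm ?addr_ge0// -sqrtr_sqr.
case: z => a b /=; apply: ler_wsqrtr.
rewrite -(real_normK (num_real a)) -(real_normK (num_real b)).
by have := normr_ge0 a; have := normr_ge0 b; nra.
Qed.

Lemma cexpD z w : cexp (z + w) = cexp z * cexp w.
Proof.
by case: z => a b; case: w => c d; apply: complex_eqP;
  rewrite /cexp ?complex_ReM ?complex_ImM/= expRD ?sinD ?cosD; ring.
Qed.

Lemma cexp0 : cexp (0 : R[i]) = 1.
Proof. by apply: complex_eqP; rewrite /= ?expR0 ?cos0 ?sin0 ?mulr1 ?mulr0. Qed.

Lemma cexp_sum (I : Type) (r : seq I) (P : pred I) (F : I -> R[i]) :
  cexp (\sum_(i <- r | P i) F i) = \prod_(i <- r | P i) cexp (F i).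
Proof. exact: (big_morph _ cexpD cexp0). Qed.

Lemma normc_cexp z : Normc.normc (cexp z) = expR (Re z).
Proof.
have e0 := expR_ge0 (Re z).
apply/eqP; rewrite -(eqrXn2 (n := 2))// ?normc_ge0//; apply/eqP.
rewrite normc_sqr /= !exprMn -mulrDr.
by rewrite [X in _ * X](_ : _ = 1) ?mulr1//; have := cos2Dsin2 (Im z).
Qed.

Lemma cexp_real (x : R) : cexp x%:C = (expR x)%:C.
Proof. by apply: complex_eqP; rewrite /= ?cos0 ?sin0 ?mulr1 ?mulr0. Qed.

Lemma cpowD (s : R) z w : cpow s (z + w) = cpow s z * cpow s w.
Proof. by rewrite /cpow mulrDl cexpD. Qed.

Lemma cpow0 (s : R) : cpow s 0 = 1.
Proof. by rewrite /cpow mul0r cexp0. Qed.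

Lemma cpowM (s t : R) z : 0 < s -> 0 < t ->
  cpow (s * t) z = cpow s z * cpow t z.
Proof. by move=> s0 t0; rewrite /cpow lnM ?posrE// rmorphD mulrDr cexpD. Qed.

Lemma cpow_real (s a : R) : 0 < s -> cpow s a%:C = (s `^ a)%:C.
Proof. by move=> s0; rewrite /cpow -rmorphM/= cexp_real /powR gt_eqF. Qed.

Lemma normc_cpow (s : R) z : 0 < s -> Normc.normc (cpow s z) = s `^ Re z.
Proof. by move=> s0; rewrite normc_cexp complex_ReM /= mulr0 subr0 /powR gt_eqF. Qed.

Lemma cpow_Re (s : R) z : Re (cpow s z) = expR (Re z * ln s) * cos (Im z * ln s).
Proof. by case: z => a b; rewrite /cpow /= !mulr0 subr0 add0r. Qed.

Lemma cpow_Im (s : R) z : Im (cpow s z) = expR (Re z * ln s) * sin (Im z * ln s).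
Proof. by case: z => a b; rewrite /cpow /= !mulr0 subr0 add0r. Qed.

End ComplexNumbers.

Section ComplexIntegral.
Context d (T : measurableType d) (R : realType).
Implicit Types (D : set T) (f g : T -> R[i]).
Local Notation Re := (@complex.Re R).
Local Notation Im := (@complex.Im R).

Definition cmeasurable D f :=
  measurable_fun D (fun x => Re (f x)) /\ measurable_fun D (fun x => Im (f x)).

Lemma cmeasurable_real D (f : T -> R) :
  measurable_fun D f -> cmeasurable D (fun x => (f x)%:C).
Proof. by move=> mf; split => //=; exact: measurable_cst. Qed.

Lemma cmeasurable_cst D (c : R[i]) : cmeasurable D (fun=> c).
Proof. by split; exact: measurable_cst. Qed.

Lemma cmeasurableD D f g : cmeasurable D f -> cmeasurable D g ->
  cmeasurable D (fun x => f x + g x).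
Proof.
move=> [rf jf] [rg jg]; split.
- rewrite (_ : (fun x => _) = (fun x => Re (f x) + Re (g x))).
    exact: measurable_funD.
  by apply/funext => x; case: (f x) (g x) => ? ? [].
- rewrite (_ : (fun x => _) = (fun x => Im (f x) + Im (g x))).
    exact: measurable_funD.
  by apply/funext => x; case: (f x) (g x) => ? ? [].
Qed.

Lemma cmeasurableM D f g : cmeasurable D f -> cmeasurable D g ->
  cmeasurable D (fun x => f x * g x).
Proof.
move=> [rf jf] [rg jg]; split.
- under eq_fun => x do rewrite complex_ReM.
  by apply: measurable_funB; exact: measurable_funM.
- under eq_fun => x do rewrite complex_ImM.
  by apply: measurable_funD; exact: measurable_funM.
Qed.

Lemma cmeasurable_sum D (I : Type) (r : seq I) (P : pred I) (F : I -> T -> R[i]) :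
  (forall i, P i -> cmeasurable D (F i)) ->
  cmeasurable D (fun x => \sum_(i <- r | P i) F i x).
Proof.
move=> mF; elim: r => [|i r IH].
  rewrite (_ : (fun x => _) = fun=> 0); first exact: cmeasurable_cst.
  by apply/funext => x; rewrite big_nil.
rewrite (_ : (fun x => _) = (fun x =>
    (if P i then F i x else 0) + \sum_(j <- r | P j) F j x)); last first.
  by apply/funext => x; rewrite big_cons; case: ifP; rewrite ?add0r ?mul1r.
apply: cmeasurableD => //; case: (boolP (P i)) => [Pi|_]; first exact: mF.
exact: cmeasurable_cst.
Qed.

Lemma cmeasurable_prod D (I : Type) (r : seq I) (P : pred I) (F : I -> T -> R[i]) :
  (forall i, P i -> cmeasurable D (F i)) ->
  cmeasurable D (fun x => \prod_(i <- r | P i) F i x).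
Proof.
move=> mF; elim: r => [|i r IH].
  rewrite (_ : (fun x => _) = fun=> 1); first exact: cmeasurable_cst.
  by apply/funext => x; rewrite big_nil.
rewrite (_ : (fun x => _) = (fun x =>
    (if P i then F i x else 1) * \prod_(j <- r | P j) F j x)); last first.
  by apply/funext => x; rewrite big_cons; case: ifP; rewrite ?add0r ?mul1r.
apply: cmeasurableM => //; case: (boolP (P i)) => [Pi|_]; first exact: mF.
exact: cmeasurable_cst.
Qed.

Lemma measurable_cexp D f : cmeasurable D f -> cmeasurable D (fun x => cexp (f x)).
Proof.
have mc : measurable_fun setT (cos : R -> R).
  by apply: continuous_measurable_fun; exact: continuous_cos.
have ms : measurable_fun setT (sin : R -> R).
  by apply: continuous_measurable_fun; exact: continuous_sin.
move=> [rf jf]; split => /=; apply: measurable_funM.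
- by apply: (measurableT_comp (@measurable_expR R)).
- by apply: (measurableT_comp mc).
- by apply: (measurableT_comp (@measurable_expR R)).
- by apply: (measurableT_comp ms).
Qed.

Lemma measurable_cpow D (s : T -> R) (z : R[i]) :
  measurable_fun D s -> cmeasurable D (fun x => cpow (s x) z).
Proof.
move=> ms; apply: measurable_cexp; apply: cmeasurableM.
  exact: cmeasurable_cst.
apply: cmeasurable_real.
exact: (measurableT_comp (@measurable_ln R)).
Qed.

Lemma measurable_normc D f : cmeasurable D f ->
  measurable_fun D (fun x => Normc.normc (f x)).
Proof.
move=> [rf jf].
rewrite (_ : (fun x => _) = (fun x => Num.sqrt (Re (f x) ^+ 2 + Im (f x) ^+ 2))).
  apply: (measurableT_comp (continuous_measurable_fun (@sqrt_continuous R))).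
  by apply: measurable_funD; exact: measurable_funX.
by apply/funext => x; case: (f x).
Qed.

Variable mu : {measure set T -> \bar R}.

Lemma abs_integrableP D f : measurable D ->
  abs_integrable mu D f <->
  mu.-integrable D (EFin \o (Re \o f)) /\ mu.-integrable D (EFin \o (Im \o f)).
Proof.
move=> mD; split => [[mr mi foo]|[rf jf]].
  have mn : measurable_fun D (fun x => Normc.normc (f x)) by exact: measurable_normc.
  have nf : mu.-integrable D (fun x => (Normc.normc (f x))%:E).
    apply/integrableP; split; first exact/measurable_EFinP.
    apply: le_lt_trans foo; apply: ge0_le_integral => //=.
    - by apply/measurable_EFinP; exact: (measurableT_comp (@normr_measurable R setT)).
    - exact/measurable_EFinP.
    - by move=> x Dx; rewrite lee_fin ger0_norm// normc_ge0.
  split; apply: (le_integrable mD _ _ nf) => //=; try exact/measurable_EFinP.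
  - by move=> x Dx; rewrite lee_fin (ger0_norm (normc_ge0 _)) le_Re_normc.
  - by move=> x Dx; rewrite lee_fin (ger0_norm (normc_ge0 _)) le_Im_normc.
have mr : measurable_fun D (Re \o f) by apply/measurable_EFinP; case/integrableP: rf.
have mi : measurable_fun D (Im \o f) by apply/measurable_EFinP; case/integrableP: jf.
split => //.
have [_ rfoo] := integrableP _ _ _ rf; have [_ ifoo] := integrableP _ _ _ jf.
have : (\int[mu]_(x in D) (`|(EFin \o (Re \o f)) x| + `|(EFin \o (Im \o f)) x|) < +oo)%E.
  rewrite ge0_integralD//; first exact: lte_add_pinfty.
  - by apply: measurableT_comp => //; case/integrableP: rf.
  - by apply: measurableT_comp => //; case/integrableP: jf.
apply: le_lt_trans; apply: ge0_le_integral => //=.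
- by move=> x _; rewrite lee_fin normc_ge0.
- by apply/measurable_EFinP; exact: measurable_normc.
- apply/measurable_EFinP; apply: measurable_funD.
    exact: (measurableT_comp (@normr_measurable R setT)).
  exact: (measurableT_comp (@normr_measurable R setT)).
- by move=> x _; rewrite -EFinD lee_fin le_normc_ReIm.
Qed.

Lemma abs_integrable_real D (f : T -> R) : measurable D ->
  mu.-integrable D (EFin \o f) -> abs_integrable mu D (fun x => (f x)%:C).
Proof.
move=> mD fi; apply/abs_integrableP => //; split => //=.
exact: integrable0.
Qed.

Lemma abs_integrableZ D (c : R[i]) f : measurable D ->
  abs_integrable mu D f -> abs_integrable mu D (fun x => c * f x).
Proof.
move=> mD [mr mi foo].
have [mr' mi'] := cmeasurableM (cmeasurable_cst D c) (conj mr mi).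
split => //; under eq_integral do rewrite Normc.normcM EFinM.
have mn : measurable_fun D (fun x => Normc.normc (f x)) by exact: measurable_normc.
rewrite ge0_integralZl//.
- by rewrite lte_mul_pinfty ?lee_fin ?normc_ge0.
- exact/measurable_EFinP.
- by move=> x _; rewrite lee_fin normc_ge0.
- by rewrite lee_fin normc_ge0.
Qed.

Lemma cintegralZ D (c : R[i]) f : measurable D ->
  abs_integrable mu D f ->
  cintegral mu D (fun x => c * f x) = c * cintegral mu D f.
Proof.
move=> mD /(abs_integrableP _ mD)[rf jf].
have Zi (k : R) (g : T -> R) : mu.-integrable D (EFin \o g) ->
    mu.-integrable D (EFin \o (fun x => k * g x)).
  move=> gi; have := integrableZl mD k gi.
  by apply: eq_integrable.
apply: complex_eqP => /=.
- under eq_Rintegral do rewrite complex_ReM.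
  by rewrite RintegralB ?RintegralZl ?complex_ReM//=; exact: Zi.
- under eq_Rintegral do rewrite complex_ImM.
  by rewrite RintegralD ?RintegralZl ?complex_ImM//=; exact: Zi.
Qed.

Lemma cintegralD D f g : measurable D ->
  abs_integrable mu D f -> abs_integrable mu D g ->
  cintegral mu D (fun x => f x + g x) = cintegral mu D f + cintegral mu D g.
Proof.
move=> mD /(abs_integrableP _ mD)[rf jf] /(abs_integrableP _ mD)[rg jg].
apply: complex_eqP => /=.
- rewrite -RintegralD//; apply: eq_Rintegral => x _.
  by case: (f x) (g x) => ? ? [].
- rewrite -RintegralD//; apply: eq_Rintegral => x _.
  by case: (f x) (g x) => ? ? [].
Qed.

Lemma abs_integrable_indic (E : set T) f : measurable E ->
  abs_integrable mu setT f -> abs_integrable mu setT (fun x => (\1_E x)%:C * f x).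
Proof.
move=> mE [mr mi foo].
have mI : cmeasurable setT (fun x => (\1_E x)%:C).
  by apply: cmeasurable_real; exact: measurable_indic.
have [mr' mi'] := cmeasurableM mI (conj mr mi).
split => //; apply: le_lt_trans foo; apply: ge0_le_integral => //.
- by move=> x _; rewrite lee_fin normc_ge0.
- by apply/measurable_EFinP; exact: measurable_normc.
- by apply/measurable_EFinP; exact: measurable_normc.
- move=> x _; rewrite lee_fin Normc.normcM normc_real ger0_norm//.
  by rewrite indicE; case: (x \in E); rewrite ?mul1r// mul0r normc_ge0.
Qed.

Lemma abs_integrable0 D : abs_integrable mu D (fun=> 0).
Proof.
split => /=; [exact: measurable_cst|exact: measurable_cst|].
by under eq_integral do rewrite expr0n/= addr0 sqrtr0; rewrite integral0.
Qed.

Lemma cintegral0 D : cintegral mu D (fun=> 0) = 0.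
Proof. by apply: complex_eqP; rewrite /= /Rintegral integral0. Qed.

Lemma cintegral_real D (f : T -> R) :
  cintegral mu D (fun x => (f x)%:C) = (\int[mu]_(x in D) f x)%:C.
Proof. by apply: complex_eqP => //=; rewrite /Rintegral integral0. Qed.

Lemma eq_cintegral D f g : {in D, f =1 g} -> cintegral mu D f = cintegral mu D g.
Proof.
move=> fg; apply: complex_eqP => /=; apply: eq_Rintegral => x Dx; by rewrite fg.
Qed.

End ComplexIntegral.

Section ComplexFubini.
Context d1 d2 (T1 : measurableType d1) (T2 : measurableType d2) (R : realType).
Variables (m1 : {sigma_finite_measure set T1 -> \bar R}).
Variables (m2 : {sigma_finite_measure set T2 -> \bar R}).
Local Notation Re := (@complex.Re R).
Local Notation Im := (@complex.Im R).

(** Integrability of every section, and not of almost every one, makes the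
    inner integral finite at each point, so that taking real values commutes
    with the outer integral. *)
Let integral_fine (f : T1 * T2 -> R) :
  (m1 \x m2)%E.-integrable setT (EFin \o f) ->
  (forall x, m2.-integrable setT (fun y => (f (x, y))%:E)) ->
  \int[m1]_x \int[m2]_y f (x, y) = \int[(m1 \x m2)%E]_z f z.
Proof.
move=> fi f2; rewrite /Rintegral -(integral12_prod_meas1 fi); congr fine.
apply: eq_integral => x _; rewrite fineK//.
exact: integrable_fin_num.
Qed.

Let integral_fine2 (f : T1 * T2 -> R) :
  (m1 \x m2)%E.-integrable setT (EFin \o f) ->
  (forall y, m1.-integrable setT (fun x => (f (x, y))%:E)) ->
  \int[m2]_y \int[m1]_x f (x, y) = \int[(m1 \x m2)%E]_z f z.
Proof.
move=> fi f2; rewrite /Rintegral -(integral21_prod_meas1 fi); congr fine.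
apply: eq_integral => x _; rewrite fineK//.
exact: integrable_fin_num.
Qed.

Lemma cintegral_prod12 (F : T1 * T2 -> R[i]) :
  abs_integrable (m1 \x m2)%E setT F ->
  (forall x, abs_integrable m2 setT (fun y => F (x, y))) ->
  cintegral m1 setT (fun x => cintegral m2 setT (fun y => F (x, y))) =
  cintegral (m1 \x m2)%E setT F.
Proof.
move=> /(abs_integrableP _ _ measurableT)[rF jF] F2.
apply: complex_eqP => /=.
- apply: (integral_fine rF) => x.
  by have /(abs_integrableP _ _ measurableT)[] := F2 x.
- apply: (integral_fine jF) => x.
  by have /(abs_integrableP _ _ measurableT)[] := F2 x.
Qed.

Lemma cintegral_prod21 (F : T1 * T2 -> R[i]) :
  abs_integrable (m1 \x m2)%E setT F ->
  (forall y, abs_integrable m1 setT (fun x => F (x, y))) ->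
  cintegral m2 setT (fun y => cintegral m1 setT (fun x => F (x, y))) =
  cintegral (m1 \x m2)%E setT F.
Proof.
move=> /(abs_integrableP _ _ measurableT)[rF jF] F2.
apply: complex_eqP => /=.
- apply: (integral_fine2 rF) => x.
  by have /(abs_integrableP _ _ measurableT)[] := F2 x.
- apply: (integral_fine2 jF) => x.
  by have /(abs_integrableP _ _ measurableT)[] := F2 x.
Qed.

Lemma cmeasurable_prodM (f : T1 -> R[i]) (g : T2 -> R[i]) :
  cmeasurable setT f -> cmeasurable setT g ->
  cmeasurable setT (fun z : T1 * T2 => f z.1 * g z.2).
Proof.
move=> [rf jf] [rg jg]; apply: cmeasurableM; split.
- exact: (measurableT_comp rf measurable_fst).
- exact: (measurableT_comp jf measurable_fst).
- exact: (measurableT_comp rg measurable_snd).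
- exact: (measurableT_comp jg measurable_snd).
Qed.

Lemma ge0_integral_prodM (f : T1 -> R) (g : T2 -> R) :
  measurable_fun setT f -> measurable_fun setT g ->
  (forall x, 0 <= f x) -> (forall y, 0 <= g y) ->
  (\int[(m1 \x m2)%E]_z (f z.1 * g z.2)%:E =
   \int[m1]_x (f x)%:E * \int[m2]_y (g y)%:E)%E.
Proof.
move=> mf mg f0 g0; rewrite fubini_tonelli1//=.
- rewrite (_ : fubini_F _ _ = fun x => ((f x)%:E * \int[m2]_y (g y)%:E)%E).
    rewrite ge0_integralZr//; first exact/measurable_EFinP.
      by move=> x _; rewrite lee_fin.
    by apply: integral_ge0 => y _; rewrite lee_fin.
  apply/funext => x; rewrite /fubini_F /=.
  rewrite -ge0_integralZl//; first exact/measurable_EFinP.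
    by move=> y _; rewrite lee_fin.
  by rewrite lee_fin.
- apply/measurable_EFinP; apply: measurable_funM.
  + exact: (measurableT_comp mf measurable_fst).
  + exact: (measurableT_comp mg measurable_snd).
- by move=> z; rewrite lee_fin mulr_ge0.
Qed.

Lemma abs_integrable_prodM (f : T1 -> R[i]) (g : T2 -> R[i]) :
  abs_integrable m1 setT f -> abs_integrable m2 setT g ->
  abs_integrable (m1 \x m2)%E setT (fun z => f z.1 * g z.2).
Proof.
move=> [rf jf foo] [rg jg goo].
have [mr mi] := cmeasurable_prodM (conj rf jf) (conj rg jg).
split => //; under eq_integral do rewrite Normc.normcM.
rewrite (@ge0_integral_prodM (fun x => Normc.normc (f x)) (fun y => Normc.normc (g y))).
- apply: lte_mul_pinfty => //.
    by apply: integral_ge0 => x _; rewrite lee_fin normc_ge0.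
  rewrite ge0_fin_numE//.
  by apply: integral_ge0 => x _; rewrite lee_fin normc_ge0.
- exact: measurable_normc.
- exact: measurable_normc.
- by move=> x; exact: normc_ge0.
- by move=> x; exact: normc_ge0.
Qed.

Lemma cintegral_prodM (f : T1 -> R[i]) (g : T2 -> R[i]) :
  abs_integrable m1 setT f -> abs_integrable m2 setT g ->
  cintegral (m1 \x m2)%E setT (fun z => f z.1 * g z.2) =
  cintegral m1 setT f * cintegral m2 setT g.
Proof.
move=> fi gi; rewrite -cintegral_prod12//=.
- under eq_cintegral => x _ do rewrite cintegralZ// mulrC.
  by rewrite cintegralZ// mulrC.
- exact: abs_integrable_prodM.
- by move=> x; exact: abs_integrableZ.
Qed.

End ComplexFubini.

Section Transfer.
Context d1 d2 (T1 : measurableType d1) (T2 : measurableType d2) (R : realType).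
Variables (m1 : {measure set T1 -> \bar R}) (m2 : {measure set T2 -> \bar R}).
Variables (phi : T1 -> T2) (J : T1 -> R).
Hypothesis J0 : forall x, 0 <= J x.
Hypothesis mphi : measurable_fun setT phi.
Hypothesis mJ : measurable_fun setT J.
Hypothesis subst_ge0 : forall h : T2 -> \bar R, measurable_fun setT h ->
  (forall y, 0 <= h y)%E -> (\int[m2]_y h y = \int[m1]_x (h (phi x) * (J x)%:E))%E.

(** A change of variables known for nonnegative functions extends to signed
    functions through positive and negative parts, and from there to complex
    functions through real and imaginary parts. *)
Lemma Rintegral_transfer (f : T2 -> R) : measurable_fun setT f ->
  \int[m2]_y f y = \int[m1]_x (f (phi x) * J x).
Proof.
move=> mf; rewrite /Rintegral; congr fine; rewrite integralE [RHS]integralE.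
have mEf : measurable_fun setT (EFin \o f) by exact/measurable_EFinP.
congr (_ - _)%E.
- rewrite subst_ge0//; last exact: measurable_funepos.
  apply: eq_integral => x _; rewrite !funeposE -!EFin_max -EFinM.
  by rewrite maxr_pMl ?mul0r.
- rewrite subst_ge0//; last exact: measurable_funeneg.
  apply: eq_integral => x _; rewrite !funenegE -!EFinN -!EFin_max -EFinM.
  by rewrite maxr_pMl ?mul0r ?mulNr.
Qed.

Lemma cintegral_transfer (f : T2 -> R[i]) : cmeasurable setT f ->
  cintegral m2 setT f = cintegral m1 setT (fun x => f (phi x) * (J x)%:C).
Proof.
move=> [mr mi]; apply: complex_eqP => /=; rewrite Rintegral_transfer//;
  apply: eq_Rintegral => x _; by rewrite ?complex_ReM ?complex_ImM /= mulr0 ?subr0 ?add0r.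
Qed.

Lemma abs_integrable_transfer (f : T2 -> R[i]) : cmeasurable setT f ->
  abs_integrable m2 setT f <->
  abs_integrable m1 setT (fun x => f (phi x) * (J x)%:C).
Proof.
move=> [mr mi].
have [mr' mi'] : cmeasurable setT (fun x => f (phi x) * (J x)%:C).
  apply: cmeasurableM; last exact: cmeasurable_real.
  by split; [exact: (measurableT_comp mr mphi)|exact: (measurableT_comp mi mphi)].
have E : (\int[m2]_x (Normc.normc (f x))%:E =
    \int[m1]_x (Normc.normc (f (phi x) * (J x)%:C))%:E)%E.
  rewrite subst_ge0.
  - by apply: eq_integral => x _; rewrite Normc.normcM normc_real ger0_norm.
  - by apply/measurable_EFinP; exact: measurable_normc.
  - by move=> y; rewrite lee_fin normc_ge0.
by split => -[_ _ foo]; split => //; rewrite ?E// -E.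
Qed.

End Transfer.

(** * Affine substitution and Mellin integrals *)

Section Affine.
Variable R : realType.
Local Notation leb := (@lebesgue_measure R).

Lemma measurable_affine (a b : R) :
  measurable_fun setT (fun x : measurableTypeR R => (a + b * x : measurableTypeR R)).
Proof. by apply: measurable_funD => //; exact: measurable_funM. Qed.

(** The map multiplies the length of every interval by [b], and a measure on
    the line is determined by its values on intervals. *)
Lemma ge0_integral_affine (a b : R) (h : measurableTypeR R -> \bar R) : 0 < b ->
  measurable_fun setT h -> (forall x, 0 <= h x)%E ->
  (\int[leb]_x h x = \int[leb]_x (h (a + b * x)%R * b%:E))%E.
Proof.
move=> b0 mh h0.
pose phi (x : measurableTypeR R) : measurableTypeR R := a + b * x.
have mphi : measurable_fun setT phi by exact: measurable_affine.
pose nu := mscale (NngNum (ltW b0)) (pushforward leb phi).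
have E A : measurable A -> leb A = nu mphi A.
  apply: lebesgue_measure_unique => _ [[x y] _ <-] /=.
  rewrite /nu /mscale /= [pushforward _ _ _](_ : _ = leb (phi @^-1` `]x, y]))//.
  rewrite (_ : phi @^-1` _ = `](x - a) / b, (y - a) / b]%classic); last first.
    apply/seteqP; split => t /=; rewrite !in_itv/= /phi.
      by rewrite ltr_pdivrMr// ler_pdivlMr// ltrBlDl lerBrDl (mulrC t).
    by rewrite ltr_pdivrMr// ler_pdivlMr// ltrBlDl lerBrDl (mulrC t).
  rewrite !lebesgue_measure_itv/= !lte_fin ltr_pM2r ?invr_gt0// ltrD2r.
  case: ifP => _; last by rewrite mule0.
  by rewrite -!EFinB -EFinM; congr EFin; field; rewrite gt_eqF.
rewrite (eq_measure_integral (nu mphi)); last by move=> A mA _; exact: E.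
rewrite ge0_integral_mscale//=.
rewrite ge0_integral_pushforward//= preimage_setT.
rewrite ge0_integralZr//.
- by rewrite muleC.
- exact: (measurableT_comp mh mphi).
- by rewrite lee_fin ltW.
Qed.

Lemma cintegral_affine (a b : R) (f : measurableTypeR R -> R[i]) : 0 < b ->
  cmeasurable setT f ->
  cintegral leb setT f = cintegral leb setT (fun x => f (a + b * x) * b%:C).
Proof.
move=> b0 mf; apply: (@cintegral_transfer _ _ _ _ _ leb leb (fun x => a + b * x) (fun=> b)) => //.
- by move=> _; exact: ltW.
- by move=> h mh h0; exact: ge0_integral_affine.
Qed.

End Affine.

Section Gamma.
Variable R : realType.
Local Notation leb := (@lebesgue_measure R).
Local Notation Re := (@complex.Re R).
Local Notation Im := (@complex.Im R).
Local Notation pos := (`]0, +oo[%classic : set (measurableTypeR R)).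
Implicit Types (s t : R) (z : R[i]).

Lemma indic_pos t : (\1_pos t : R) = if 0 < t then 1 else 0.
Proof. by rewrite indicE mem_setE in_itv/= andbT; case: ltP. Qed.

(** Euler's integral with values in [0, +oo], so that it can be manipulated
    before its finiteness is known. *)
Definition gammaE s : \bar R := \int[leb]_t (\1_pos t * (t `^ (s - 1) * expR (- t)))%:E.

Lemma measurable_indic_pos : measurable_fun setT (\1_pos : R -> R).
Proof. exact: measurable_indic. Qed.

Lemma measurable_mellin s c : measurable_fun setT
  (fun t : measurableTypeR R => \1_pos t * (t `^ (s - 1) * expR (- (c * t)))).
Proof.
apply: measurable_funM; first exact: measurable_indic_pos.
apply: measurable_funM; first exact: measurable_powR.
apply: (measurableT_comp (@measurable_expR R)).
by apply: (measurableT_comp (@oppr_measurable R setT)); exact: measurable_funM.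
Qed.

Lemma mellin_ge0 s c t : 0 <= \1_pos t * (t `^ (s - 1) * expR (- (c * t))).
Proof. by rewrite indic_pos; case: ifP => _; rewrite ?mul0r// mul1r mulr_ge0 ?powR_ge0
  ?expR_ge0. Qed.

(** The substitution of [a * t] for [t]. It writes a negative power of [a] as
    a mixture of the exponentials [expR (- (a * t))], which is how all the
    integrals of powers below are computed. *)
Lemma mellin_expR s (a : R) : 0 < a ->
  (\int[leb]_t (\1_pos t * (t `^ (s - 1) * expR (- (a * t))))%:E =
   (a `^ (- s))%:E * gammaE s)%E.
Proof.
move=> a0; rewrite /gammaE [X in _ = (_ * X)%E](@ge0_integral_affine R 0 a)//; last 2 first.
- apply/measurable_EFinP; by have := @measurable_mellin s 1; under eq_fun => t do rewrite mul1r.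
- by move=> t; rewrite lee_fin -[X in expR (- X)]mul1r mellin_ge0.
rewrite -ge0_integralZl//; last 3 first.
- apply/measurable_EFinP; apply: measurable_funM => //.
  rewrite (_ : (fun x => _) = (fun t => \1_pos (t : R) * (t `^ (s - 1) * expR (- (a * t)))
    * a `^ (s - 1))).
    by apply: measurable_funM => //; exact: measurable_mellin.
  apply/funext => t; rewrite add0r !indic_pos pmulr_rgt0//.
  case: ltP => t0; last by rewrite !mul0r.
  by rewrite powRM ?ltW//; ring.
- by move=> t _; rewrite -EFinM lee_fin mulr_ge0 ?(ltW a0)// -[X in expR (- X)]mul1r mellin_ge0.
- by rewrite lee_fin powR_ge0.
apply: eq_integral => t _; rewrite -!EFinM; congr EFin.
rewrite add0r !indic_pos pmulr_rgt0//.
case: ltP => t0; last by rewrite !mul0r mulr0.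
rewrite powRM ?ltW//.
have -> : a `^ (s - 1) = a `^ s / a.
  by rewrite powRB ?powRr1 ?ltW//; apply/implyP => _; rewrite gt_eqF.
rewrite powRN; have as0 : a `^ s != 0 by rewrite gt_eqF// powR_gt0.
by field; rewrite as0 gt_eqF.
Qed.

Lemma gammaE_ge0 s : (0 <= gammaE s)%E.
Proof.
by apply: integral_ge0 => t _; rewrite lee_fin -[X in expR (- X)]mul1r mellin_ge0.
Qed.

Lemma cintegral_pos (f : measurableTypeR R -> R[i]) :
  cintegral leb pos f = cintegral leb setT (fun t => (\1_pos t)%:C * f t).
Proof.
apply: complex_eqP => /=; rewrite Rintegral_mkcond; apply: eq_Rintegral => t _;
  by rewrite patchE indicE; case: ifP => _; rewrite ?complex_ReM ?complex_ImM /=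
    ?mul1r ?mul0r ?subr0 ?addr0.
Qed.

Lemma cpowB1 z (a : R) : 0 < a -> cpow a (z - 1) * a%:C = cpow a z.
Proof.
move=> a0; rewrite -{2}(powRr1 (ltW a0)) -cpow_real// -cpowD.
by congr cpow; rewrite subrK.
Qed.

Definition cmellin z c t : R[i] :=
  (\1_pos t)%:C * (cpow t (z - 1) * (expR (- (c * t)))%:C).

Lemma cmeasurable_mellin z c : cmeasurable setT (cmellin z c : measurableTypeR R -> _).
Proof.
apply: cmeasurableM; first exact: (cmeasurable_real measurable_indic_pos).
apply: cmeasurableM; first by apply: measurable_cpow.
apply: cmeasurable_real; apply: (measurableT_comp (@measurable_expR R)).
by apply: (measurableT_comp (@oppr_measurable R setT)); exact: measurable_funM.
Qed.

Lemma normc_mellin z c t :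
  Normc.normc (cmellin z c t) = \1_pos t * (t `^ (Re z - 1) * expR (- (c * t))).
Proof.
rewrite /cmellin !Normc.normcM !normc_real (ger0_norm (expR_ge0 _)) indic_pos.
case: ltP => t0; last by rewrite normr0 !mul0r.
by rewrite normr1 normc_cpow//; case: z => x y.
Qed.

Lemma abs_integrable_mellin z c : 0 < c -> (gammaE (Re z) < +oo)%E ->
  abs_integrable leb setT (cmellin z c).
Proof.
move=> c0 goo; have [mr mi] := cmeasurable_mellin z c; split => //.
under eq_integral do rewrite normc_mellin.
rewrite mellin_expR//; apply: lte_mul_pinfty => //.
by rewrite lee_fin powR_ge0.
Qed.

Lemma cGammaE z : cGamma z = cintegral leb setT (cmellin z 1).
Proof.
rewrite /cGamma cintegral_pos; apply: eq_cintegral => t _.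
by rewrite /cmellin mul1r.
Qed.

Lemma cmellin_expR z (a : R) : 0 < a -> (gammaE (Re z) < +oo)%E ->
  cintegral leb setT (cmellin z a) = cpow a (- z) * cGamma z.
Proof.
move=> a0 goo; rewrite cGammaE (@cintegral_affine R 0 a (cmellin z 1))//;
  last exact: cmeasurable_mellin.
rewrite -cintegralZ//; last first.
  rewrite (_ : (fun x => _) = (fun x => cpow a z * cmellin z a x)).
    by apply: abs_integrableZ => //; exact: abs_integrable_mellin.
  apply/funext => t; rewrite /cmellin !indic_pos add0r mul1r pmulr_rgt0//.
  case: ltP => t0; last by rewrite !mul0r mulr0.
  by rewrite !mul1r cpowM// -(cpowB1 z a0); ring.
apply: eq_cintegral => t _.
rewrite /cmellin !indic_pos add0r mul1r pmulr_rgt0//.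
case: ltP => t0; last by rewrite !mul0r mulr0.
have E : cpow a (- z) * (cpow a (z - 1) * a%:C) = 1.
  by rewrite cpowB1// -cpowD addNr cpow0.
rewrite mul1r cpowM//.
transitivity (cpow a (- z) * (cpow a (z - 1) * a%:C) *
  (1%:C * (cpow t (z - 1) * (expR (- (a * t)))%:C))); first by rewrite E !mul1r.
ring.
Qed.

Section Kernel.
Variables w a : measurableTypeR R -> R.
Hypotheses (mw : measurable_fun setT w) (ma : measurable_fun setT a).
Hypotheses (w0 : forall x, 0 <= w x) (a0 : forall x, 0 < w x -> 0 < a x).

Let F s (u : measurableTypeR R * measurableTypeR R) : R :=
  w u.1 * (\1_pos u.2 * (u.2 `^ (s - 1) * expR (- (a u.1 * u.2)))).

Let mF s : measurable_fun setT (F s).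
Proof.
apply: measurable_funM; first exact: (measurableT_comp mw measurable_fst).
apply: measurable_funM; first exact: (measurableT_comp measurable_indic_pos measurable_snd).
apply: measurable_funM.
  exact: (measurableT_comp (@measurable_powR R _) measurable_snd).
apply: (measurableT_comp (@measurable_expR R)).
apply: (measurableT_comp (@oppr_measurable R setT)).
apply: measurable_funM; last exact: measurable_snd.
exact: (measurableT_comp ma measurable_fst).
Qed.

Let F0 s u : 0 <= F s u.
Proof. by rewrite mulr_ge0// mellin_ge0. Qed.

Let F_section s x : (\int[leb]_t (F s (x, t))%:E = (w x * a x `^ (- s))%:E * gammaE s)%E.
Proof.
rewrite /F/=; under eq_integral do rewrite EFinM.
rewrite ge0_integralZl; last 4 first.
- exact: measurableT.
- by apply/measurable_EFinP; exact: measurable_mellin.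
- by move=> t _; rewrite lee_fin mellin_ge0.
- by rewrite lee_fin.
have [w00|wn0] := eqVneq (w x) 0; first by rewrite w00 !mul0r !mul0e.
by rewrite mellin_expR ?a0 ?lt0r ?w0 ?wn0// muleA -EFinM.
Qed.

Let m_wa s : measurable_fun setT (fun x => w x * a x `^ (- s)).
Proof.
apply: measurable_funM => //.
exact: (measurableT_comp (@measurable_powR R (- s)) ma).
Qed.

Let integral_F s : (\int[(leb \x leb)%E]_u (F s u)%:E =
  \int[leb]_x (w x * a x `^ (- s))%:E * gammaE s)%E.
Proof.
rewrite fubini_tonelli1//=.
- rewrite -ge0_integralZr//.
  + by apply: eq_integral => x _; rewrite /fubini_F F_section.
  + exact/measurable_EFinP.
  + by move=> x _; rewrite lee_fin mulr_ge0// powR_ge0.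
  + exact: gammaE_ge0.
- exact/measurable_EFinP.
- by move=> u; rewrite lee_fin F0.
Qed.

(** Replacing [a x `^ (- s)] by its Mellin integral and exchanging the order of
    integration, only the integral [k t] of an exponential remains to be
    known. As an identity in [0, +oo] it also serves to prove finiteness. *)
Lemma mellin_tonelli s (k : R -> R) :
  (forall t, 0 < t -> (\int[leb]_x (w x * expR (- (a x * t)))%:E = (k t)%:E)%E) ->
  (\int[leb]_x (w x * a x `^ (- s))%:E * gammaE s =
   \int[leb]_t (\1_pos t * (t `^ (s - 1) * k t))%:E)%E.
Proof.
move=> kE; rewrite -integral_F fubini_tonelli2//=.
- apply: eq_integral => t _; rewrite /fubini_G /F /= indic_pos.
  case: ltP => t0; last first.
    by under eq_integral do rewrite mul0r mulr0; rewrite integral0 mul0r.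
  under eq_integral do rewrite mul1r mulrCA EFinM.
  rewrite ge0_integralZl//; first by rewrite kE// -EFinM mul1r.
  + apply/measurable_EFinP; apply: measurable_funM => //.
    apply: (measurableT_comp (@measurable_expR R)).
    apply: (measurableT_comp (@oppr_measurable R setT)).
    exact: measurable_funM.
  + by move=> x _; rewrite lee_fin mulr_ge0// expR_ge0.
  + by rewrite lee_fin powR_ge0.
- exact/measurable_EFinP.
- by move=> u; rewrite lee_fin F0.
Qed.

Let G z (u : measurableTypeR R * measurableTypeR R) : R[i] :=
  (w u.1)%:C * cmellin z (a u.1) u.2.

Let normG z u : Normc.normc (G z u) = F (Re z) u.
Proof. by rewrite /G /F Normc.normcM normc_real (ger0_norm (w0 _)) normc_mellin. Qed.

Let mG z : cmeasurable setT (G z).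
Proof.
apply: cmeasurableM.
  by apply: cmeasurable_real; exact: (measurableT_comp mw measurable_fst).
apply: cmeasurableM.
  by apply: cmeasurable_real; exact: (measurableT_comp measurable_indic_pos measurable_snd).
apply: cmeasurableM; first by apply: measurable_cpow; exact: measurable_snd.
apply: cmeasurable_real.
apply: (measurableT_comp (@measurable_expR R)).
apply: (measurableT_comp (@oppr_measurable R setT)).
apply: measurable_funM; last exact: measurable_snd.
exact: (measurableT_comp ma measurable_fst).
Qed.

(** The same exchange for a complex exponent: the modulus of the double
    integrand is the one of the real case at [Re z]. *)
Lemma mellin_fubini z (k : R -> R) :
  (gammaE (Re z) < +oo)%E ->
  (\int[leb]_x (w x * a x `^ (- Re z))%:E < +oo)%E ->
  (forall t, 0 < t -> (\int[leb]_x (w x * expR (- (a x * t)))%:E = (k t)%:E)%E) ->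
  cintegral leb setT (fun x => (w x)%:C * cpow (a x) (- z)) * cGamma z =
  cintegral leb pos (fun t => cpow t (z - 1) * (k t)%:C).
Proof.
move=> goo woo kE.
have Gi : abs_integrable (leb \x leb)%E setT (G z).
  have [mr mi] := mG z; split => //.
  under eq_integral do rewrite normG.
  rewrite integral_F; apply: lte_mul_pinfty => //.
    by apply: integral_ge0 => x _; rewrite lee_fin mulr_ge0// powR_ge0.
  rewrite ge0_fin_numE//.
  by apply: integral_ge0 => x _; rewrite lee_fin mulr_ge0// powR_ge0.
have G1 x : abs_integrable leb setT (fun t => G z (x, t)).
  have [mr mi] := cmeasurableM (cmeasurable_cst setT (w x)%:C) (cmeasurable_mellin z (a x)).
  split => //; under eq_integral do rewrite normG.
  rewrite F_section; apply: lte_mul_pinfty => //.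
  by rewrite lee_fin mulr_ge0// powR_ge0.
have wE t : 0 < t -> abs_integrable leb setT (fun x => (w x * expR (- (a x * t)))%:C).
  move=> t0; apply: abs_integrable_real => //.
  have mwe : measurable_fun setT (fun x => w x * expR (- (a x * t))).
    apply: measurable_funM => //.
    apply: (measurableT_comp (@measurable_expR R)).
    apply: (measurableT_comp (@oppr_measurable R setT)).
    exact: measurable_funM.
  apply/integrableP; split; first exact/measurable_EFinP.
  under eq_integral do rewrite /= ger0_norm ?mulr_ge0 ?expR_ge0//.
  by rewrite kE// ltry.
have G2E t : 0 < t ->
    (fun x => G z (x, t)) = (fun x => cpow t (z - 1) * (w x * expR (- (a x * t)))%:C).
  move=> t0; apply/funext => x; rewrite /G /cmellin /= indic_pos t0 mul1r rmorphM/=.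
  by rewrite mulrCA.
have G2 t : abs_integrable leb setT (fun x => G z (x, t)).
  have [t0|t0] := ltP 0 t.
    by rewrite G2E//; apply: abs_integrableZ => //; exact: wE.
  rewrite (_ : (fun x => _) = fun=> 0); first exact: abs_integrable0.
  by apply/funext => x; rewrite /G /cmellin /= indic_pos ltNge t0 /= mul0r mulr0.
transitivity (cintegral leb setT (fun x => cintegral leb setT (fun t => G z (x, t)))).
  rewrite mulrC -cintegralZ//; last first.
    have [mr mi] : cmeasurable setT (fun x => (w x)%:C * cpow (a x) (- z)).
      by apply: cmeasurableM; [exact: cmeasurable_real|exact: measurable_cpow].
    split => //; apply: le_lt_trans woo.
    under eq_integral => x _.
      rewrite Normc.normcM normc_real (ger0_norm (w0 x)).
      rewrite (_ : _ * _ = w x * a x `^ (- Re z)); last first.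
        have [->|wn0] := eqVneq (w x) 0; first by rewrite !mul0r.
        by rewrite normc_cpow ?complex_ReN// a0// lt0r wn0 w0.
      over.
    by [].
  apply: eq_cintegral => x _.
  have [wx0|wn0] := eqVneq (w x) 0.
    rewrite (_ : (fun t => _) = fun=> 0).
      by rewrite cintegral0 wx0 !mul0r mulr0.
    by apply/funext => t; rewrite /G /= wx0 mul0r.
  have ax0 : 0 < a x by rewrite a0// lt0r wn0 w0.
  rewrite /G /= cintegralZ//; last exact: abs_integrable_mellin.
  by rewrite cmellin_expR// mulrC mulrA.
rewrite (cintegral_prod12 Gi G1) -(cintegral_prod21 Gi G2) cintegral_pos.
apply: eq_cintegral => t _; rewrite indic_pos.
have [t0|t0] := ltP 0 t.
  rewrite mul1r G2E// cintegralZ//; last exact: wE.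
  by rewrite cintegral_real /Rintegral kE.
rewrite mul0r (_ : (fun x => _) = fun=> 0) ?cintegral0//.
by apply/funext => x; rewrite /G /cmellin /= indic_pos ltNge t0 /= mul0r mulr0.
Qed.

End Kernel.
End Gamma.

(** * Euler's Gamma and Beta integrals *)

Section GammaValues.
Variable R : realType.
Local Notation leb := (@lebesgue_measure R).
Local Notation Re := (@complex.Re R).
Local Notation Im := (@complex.Im R).
Local Notation pos := (`]0, +oo[%classic : set (measurableTypeR R)).
Implicit Types (s t x : R) (z : R[i]).

(** With [a x = 1 + x ^+ 2] the remaining integral is a rescaled Gaussian one;
    through the Mellin kernel lemmas it yields the Beta integral. *)
Lemma gauss_kernel t : 0 < t ->
  (\int[leb]_x (1 * expR (- ((1 + x ^+ 2) * t)))%:E =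
   (Num.sqrt pi * (t `^ (- 2^-1) * expR (- t)))%:E)%E.
Proof.
move=> t0; have st0 : 0 < Num.sqrt t by rewrite sqrtr_gt0.
rewrite powRN powR12_sqrt ?ltW// EFinM -integralT_gauss.
rewrite [X in _ = (X * _)%E](@ge0_integral_affine R 0 (Num.sqrt t))//; last 2 first.
- by apply/measurable_EFinP; exact: measurable_gauss_fun.
- by move=> x; rewrite lee_fin gauss_fun_ge0.
rewrite -ge0_integralZr//; last 2 first.
- apply/measurable_EFinP; apply: measurable_funM => //.
  apply: (measurableT_comp (@measurable_gauss_fun R)).
  exact: measurable_affine.
- by move=> x _; rewrite -EFinM lee_fin mulr_ge0// ?gauss_fun_ge0.
apply: eq_integral => x _; rewrite -!EFinM; congr EFin.
rewrite /gauss_fun add0r exprMn sqr_sqrtr ?ltW// mulrDl opprD expRD !mul1r.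
rewrite (mulrC t); field; exact: lt0r_neq0.
Qed.

Local Notation ge1 := (`[1, +oo[%classic : set (measurableTypeR R)).

Lemma indic_ge1 x : (\1_ge1 x : R) = if 1 <= x then 1 else 0.
Proof. by rewrite indicE mem_setE in_itv/= andbT; case: ifP. Qed.

Lemma integral_ge1 (f : measurableTypeR R -> R) :
  (\int[leb]_x (\1_ge1 x * f x)%:E = \int[leb]_(x in ge1) (f x)%:E)%E.
Proof.
rewrite [RHS]integral_mkcond; apply: eq_integral => x _.
by rewrite patchE indicE; case: ifP => _; rewrite ?mul1r ?mul0r.
Qed.

(** With [a] the identity and [w] the indicator of [1, +oo[, the Mellin kernel
    lemmas become the functional equation relating Gamma at [s] and
    [s + 1]. *)
Lemma expR_kernel t : 0 < t ->
  (\int[leb]_x (\1_ge1 x * expR (- (x * t)))%:E = (t^-1 * expR (- t))%:E)%E.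
Proof.
move=> t0.
have mf : measurable_fun setT (fun x : measurableTypeR R => \1_ge1 x * expR (- (x * t))).
  apply: measurable_funM; first exact: measurable_indic.
  apply: (measurableT_comp (@measurable_expR R)).
  by apply: (measurableT_comp (@oppr_measurable R setT)); exact: measurable_funM.
rewrite (@ge0_integral_affine R 1 1)//; last exact/measurable_EFinP.
rewrite -[RHS]mule1 -[X in _ = (_ * X)%E](integral_exponential_pdf t0) -ge0_integralZl//;
  last 3 first.
- by apply/measurable_EFinP; exact: measurable_exponential_pdf.
- by move=> x _; rewrite lee_fin exponential_pdf_ge0// ltW.
- by rewrite lee_fin mulr_ge0 ?expR_ge0// invr_ge0 ltW.
apply: eq_integral => x _; rewrite -!EFinM; congr EFin.
rewrite mulr1 mul1r indic_ge1 lerDl; case: ltP => x0; last first.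
  rewrite exponential_pdfE// mul1r mulrDl mul1r opprD expRD mulNr (mulrC t x).
  by field; exact: lt0r_neq0.
by rewrite mul0r lt0_exponential_pdf// mulr0.
Qed.

Lemma powR_kernel s : 0 < s ->
  (\int[leb]_x (\1_ge1 x * x `^ (- (s + 1)))%:E = (s^-1)%:E)%E.
Proof.
move=> s0; rewrite integral_ge1.
pose F (x : R) : R := (- s^-1) * x `^ (- s).
have dF (x : R) : 0 < x -> is_derive x 1 F (x `^ (- (s + 1))).
  move=> x0; have := is_derive1_powR (- s) x0; rewrite /F => dp.
  apply: is_derive_eq.
  by rewrite opprD -[LHS]/(_ * _) mulrA mulrNN mulVf ?mul1r// lt0r_neq0.
have cont (a x : R) : 0 < x -> {for x, continuous ((@powR R) ^~ a)}.
  move=> x0; apply: differentiable_continuous; apply/derivable1_diffP.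
  exact: (@ex_derive _ _ _ _ _ _ _ (is_derive1_powR a x0)).
rewrite (@ge0_continuous_FTC2y R (fun x => x `^ (- (s + 1))) F 1 0).
- by rewrite /F powR1 mulr1 -EFinB sub0r opprK.
- by move=> x _; exact: powR_ge0.
- apply/continuous_within_itvcyP; split.
    move=> x; rewrite in_itv/= andbT => x1; apply: cont; lra.
  by apply: cvg_at_right_filter; apply: cont.
- rewrite -(mulr0 (- s^-1)); apply: cvgMr.
  apply: (@cvg_trans _ ((expR (- (s * ln x))) @[x --> +oo])).
    apply: near_eq_cvg; near=> x.
    by rewrite /powR gt_eqF ?mulNr.
  apply/cvgr0Pnorm_lt => e e0; near=> x.
  have x0 : 0 < x by near: x; apply: nbhs_pinfty_gt.
  have ee0 : 0 < e^-1 by rewrite invr_gt0.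
  rewrite ger0_norm ?expR_ge0// -mulNr -[ltLHS]/(expR (- s * ln x)).
  rewrite (_ : expR _ = x `^ (- s)); last by rewrite /powR gt_eqF.
  rewrite powRN invf_plt ?posrE ?powR_gt0//.
  have -> : e^-1 = (e^-1 `^ s^-1) `^ s.
    by rewrite -powRrM mulVf ?powRr1 ?ltW// lt0r_neq0.
  rewrite gt0_ltr_powR ?nnegrE ?powR_ge0 ?(ltW x0)//.
- by move=> x x1; apply: (@ex_derive _ _ _ _ _ _ _ (dF x _)); lra.
- apply: cvg_at_right_filter; apply: differentiable_continuous; apply/derivable1_diffP.
  by apply: (@ex_derive _ _ _ _ _ _ _ (dF 1 _)); lra.
- move=> x; rewrite in_itv/= andbT => x1; rewrite derive1E.
  by apply: (@derive_val _ _ _ _ _ _ _ (dF x _)); lra.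
Unshelve. all: end_near. Qed.

(** By scale invariance the integral I of the inverse is the same over
    [1, +oo[ and over [1/2, +oo[. As the inverse is at least 1 on [1/2, 1[,
    this gives 1/2 + I <= I, which no finite nonnegative I satisfies. *)
Lemma inv_integral_oo : (\int[leb]_x (\1_ge1 x * x^-1)%:E = +oo)%E.
Proof.
set I := (X in X = _).
have mI (a : R) : measurable_fun setT (fun x : measurableTypeR R => (\1_`[a,
  +oo[ x : R) * x `^ (-1)).
  by apply: measurable_funM; [exact: measurable_indic|exact: measurable_powR].
have IE (a : R) : 0 < a -> (\int[leb]_x ((\1_`[a, +oo[ x : R) * x `^ (-1))%:E = I)%E.
  move=> a0; rewrite (@ge0_integral_affine R 0 a)//; last 2 first.
  - exact/measurable_EFinP.
  - by move=> x; rewrite lee_fin mulr_ge0// powR_ge0.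
  apply: eq_integral => x _; rewrite -EFinM !indicE !mem_setE !in_itv/= !andbT add0r.
  rewrite ler_pMr//; case: leP => x1; last by rewrite !mul0r.
  have x0 : 0 < x by lra.
  rewrite powR_inv1 ?mulr_ge0 ?ltW// !mul1r; congr EFin.
  by field; rewrite !lt0r_neq0.
have I2 : ((2^-1)%:E + I <= I)%E.
  rewrite -{2}(IE 2^-1)// -(IE 1)//.
  have -> : ((2^-1)%:E = \int[leb]_x (\1_`[(2^-1 : R), 1[ x)%:E)%E.
    rewrite integral_indic// setIT [RHS](_ : _ = leb `[2^-1,
      1[%classic)// (@lebesgue_measure_itv R `[2^-1, 1[)/= lte_fin.
    by rewrite ifT; [rewrite -EFinB; congr EFin|]; lra.
  rewrite -ge0_integralD; last 5 first.
  - exact: measurableT.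
  - by move=> x _; rewrite lee_fin.
  - by apply/measurable_EFinP; exact: measurable_indic.
  - by move=> x _; rewrite lee_fin mulr_ge0// powR_ge0.
  - exact/measurable_EFinP.
  apply: ge0_le_integral => //.
  - by move=> x _; rewrite -EFinD lee_fin addr_ge0// mulr_ge0// powR_ge0.
  - by apply: emeasurable_funD; apply/measurable_EFinP => //; exact: measurable_indic.
  - exact/measurable_EFinP.
  - move=> x _; rewrite -EFinD lee_fin !indicE !mem_setE !in_itv/= !andbT.
    have [x2|x2] := leP 2^-1 x; have [x1|x1] := leP 1 x => /=;
      rewrite ?mul1r ?mul0r ?add0r ?addr0//; last by lra.
    by rewrite powR_inv1 ?invf_ge1; lra.
have : (0 <= I)%E by apply: integral_ge0 => x _; rewrite lee_fin indic_ge1;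
  have [x1|x1] := leP 1 x; rewrite ?mul0r// mul1r invr_ge0; lra.
by move: I2; case: (I) => [r| |]//; rewrite -EFinD lee_fin => h _; exfalso;
  move: (h : 2^-1 + (r : R) <= r); lra.
Qed.

Lemma gammaE1 : gammaE (1 : R) = 1%E.
Proof.
rewrite -(@integral_exponential_pdf R 1 ltr01) /gammaE.
transitivity (\int[leb]_(t in pos) (expR (- t))%:E)%E.
  rewrite [RHS]integral_mkcond; apply: eq_integral => t _.
  rewrite patchE indicE subrr powRr0 mul1r.
  by case: ifP => _; rewrite ?mul1r ?mul0r.
rewrite integral_itv_obnd_cbnd; last first.
  apply/measurable_EFinP/measurable_funTS.
  exact: (measurableT_comp (@measurable_expR R) (@oppr_measurable R setT)).
rewrite integral_mkcond; apply: eq_integral => t _.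
rewrite /exponential_pdf !patchE; case: ifP => //=.
by rewrite mul1r mulN1r.
Qed.

Lemma gammaE_step s : 0 < s -> gammaE s = ((s^-1)%:E * gammaE (s + 1))%E.
Proof.
move=> s0; rewrite -(powR_kernel s0).
rewrite (@mellin_tonelli R (\1_ge1) idfun _ _ _ _ (s + 1) (fun t => t^-1 * expR (- t)))//=.
- rewrite /gammaE; apply: eq_integral => t _; congr EFin; rewrite indic_pos.
  case: ltP => t0; last by rewrite !mul0r.
  rewrite addrK mulrA powRB ?powRr1 ?ltW//; first by rewrite !mulrA.
  by apply/implyP => _; rewrite gt_eqF.
- exact: measurable_id.
- by move=> x; rewrite indic_ge1; have [x1|x1] := leP 1 x; rewrite ?ltxx//; lra.
- exact: expR_kernel.
Qed.

Lemma gammaES s : 0 < s -> gammaE (s + 1) = (s%:E * gammaE s)%E.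
Proof.
by move=> s0; rewrite (gammaE_step s0) muleA -EFinM divff ?mul1e// lt0r_neq0.
Qed.

Lemma measurable_mellin1 s : measurable_fun setT
  (fun t : measurableTypeR R => \1_pos t * (t `^ (s - 1) * expR (- t))).
Proof. by have := @measurable_mellin R s 1; under eq_fun => t do rewrite mul1r. Qed.

Lemma mellin1_ge0 s t : 0 <= \1_pos t * (t `^ (s - 1) * expR (- t)) :> R.
Proof. by rewrite -[X in expR (- X)]mul1r mellin_ge0. Qed.

(** For 1 <= x < n + 1 one has t^(x-1) <= 1 + t^n, so Gamma at x is at most
    Gamma(1) + Gamma(n+1); the functional equation brings smaller arguments
    to this case. *)
Lemma gammaE_lty s : 0 < s -> (gammaE s < +oo)%E.
Proof.
have gn (n : nat) : (gammaE (n.+1%:R : R) < +oo)%E.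
  elim: n => [|n IH]; first by rewrite gammaE1 ltry.
  by rewrite -natr1 gammaES ?ltr0n// lte_mul_pinfty ?lee_fin.
have g1 x : 1 <= x -> (gammaE x < +oo)%E.
  move=> x1; pose n := Num.truncn x.
  have nx : x < n.+1%:R by apply: truncnS_gt.
  apply: (@le_lt_trans _ _ (gammaE (1 : R) + gammaE (n.+1%:R : R))%E); last first.
    by apply: lte_add_pinfty => //; rewrite gammaE1 ltry.
  rewrite /gammaE -ge0_integralD//; last 4 first.
  - by move=> t _; rewrite lee_fin mellin1_ge0.
  - by apply/measurable_EFinP; exact: measurable_mellin1.
  - by move=> t _; rewrite lee_fin mellin1_ge0.
  - by apply/measurable_EFinP; exact: measurable_mellin1.
  apply: ge0_le_integral => //.
  - by move=> t _; rewrite lee_fin mellin1_ge0.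
  - by apply/measurable_EFinP; exact: measurable_mellin1.
  - by apply: emeasurable_funD; apply/measurable_EFinP; exact: measurable_mellin1.
  - move=> t _; rewrite -EFinD lee_fin indic_pos; case: ltP => t0; last by rewrite !mul0r addr0.
    rewrite !mul1r -mulrDl ler_wpM2r ?expR_ge0// subrr powRr0.
    have [t1|t1] := leP t 1.
      rewrite -[leLHS]addr0 lerD ?powR_ge0// -[leRHS](powRr0 t) ger_powR ?t0//; lra.
    rewrite -[leLHS]add0r lerD// ler_powR ?(ltW t1)//; lra.
move=> s0; rewrite gammaE_step//; apply: lte_mul_pinfty => //.
  by rewrite lee_fin invr_ge0 ltW.
by apply: g1; lra.
Qed.

Lemma gammaE_gt0 s : 0 < s -> (0 < gammaE s)%E.
Proof.
have g1 x : 1 <= x -> (0 < gammaE x)%E.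
  move=> x1; apply: (@lt_le_trans _ _ (\int[leb]_t (\1_ge1 t * expR (- (t * 1)))%:E)%E).
    by rewrite expR_kernel// lte_fin mulr_gt0// expR_gt0.
  apply: ge0_le_integral => //.
  - apply/measurable_EFinP; apply: measurable_funM; first exact: measurable_indic.
    apply: (measurableT_comp (@measurable_expR R)).
    by apply: (measurableT_comp (@oppr_measurable R setT)); exact: measurable_funM.
  - by apply/measurable_EFinP; exact: measurable_mellin1.
  - move=> t _; rewrite lee_fin mulr1 indic_ge1.
    have [t1|t1] := leP 1 t; last by rewrite mul0r mellin1_ge0.
    rewrite indic_pos (lt_le_trans ltr01 t1) !mul1r ler_peMl ?expR_ge0//.
    by rewrite -[leLHS](powRr0 t) ler_powR//; lra.
move=> s0; rewrite gammaE_step//; apply: mule_gt0; first by rewrite lte_fin invr_gt0.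
by apply: g1; lra.
Qed.

Definition betaE s : \bar R := \int[leb]_x ((1 + x ^+ 2) `^ (- s))%:E.

Lemma measurable_1Dsqr : measurable_fun setT (fun x : measurableTypeR R => 1 + x ^+ 2 : R).
Proof. by apply: measurable_funD => //; exact: measurable_funX. Qed.

Lemma gt0_1Dsqr x : 0 < 1 + x ^+ 2.
Proof. by rewrite ltr_wpDr// sqr_ge0. Qed.

(** The shift by 1/2 is the factor t^(-1/2) of the Gaussian integral. *)
Lemma betaE_gammaE s : (betaE s * gammaE s = (Num.sqrt pi)%:E * gammaE (s - 2^-1))%E.
Proof.
rewrite /betaE; under eq_integral do rewrite -[X in X%:E]mul1r.
rewrite (@mellin_tonelli R (fun=> 1) (fun x => 1 + x ^+ 2) _ _ _ _ s (fun t => Num.sqrt pi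
  * (t `^ (- 2^-1) * expR (- t))))//=.
- rewrite -ge0_integralZl//; last 2 first.
  + by apply/measurable_EFinP; exact: measurable_mellin1.
  + by move=> t _; rewrite lee_fin mellin1_ge0.
  apply: eq_integral => t _; rewrite -EFinM; congr EFin; rewrite indic_pos.
  case: ltP => t0; last by rewrite !mul0r mulr0.
  rewrite !mul1r mulrCA; congr (_ * _); rewrite mulrA -powRD.
    by congr (_ `^ _ * _); ring.
  by apply/implyP => _; rewrite gt_eqF.
- exact: measurable_1Dsqr.
- by move=> x _; exact: gt0_1Dsqr.
- exact: gauss_kernel.
Qed.

Lemma betaE_lty s : 2^-1 < s -> (betaE s < +oo)%E.
Proof.
move=> s2; have s0 : 0 < s by lra.
have := betaE_gammaE s.
have : (0 < gammaE s)%E by exact: gammaE_gt0.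
have : (gammaE s < +oo)%E by exact: gammaE_lty.
have : (gammaE (s - 2^-1) < +oo)%E by apply: gammaE_lty; lra.
have : (0 <= gammaE (s - 2^-1))%E by exact: gammaE_ge0.
have : (0 <= betaE s)%E by apply: integral_ge0 => x _; rewrite lee_fin powR_ge0.
case: (betaE s) => [b| |]; rewrite ?ltry//.
case: (gammaE s) => [g| |]//; case: (gammaE _) => [g'| |]//.
by move=> _ _ _ _; rewrite lte_fin => g0; rewrite gt0_mulye ?lte_fin.
Qed.

(** For [x >= 1] the integrand is at least [(1 + x ^+ 2) `^ (- 2^-1)], hence at
    least 1 / (2 x), whose integral diverges. *)
Lemma betaE_eqy s : s <= 2^-1 -> betaE s = +oo%E.
Proof.
move=> s2; apply/eqP; rewrite -leye_eq.
apply: (@le_trans _ _ ((2^-1)%:E * \int[leb]_x (\1_ge1 x * x^-1)%:E)%E).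
  by rewrite inv_integral_oo gt0_muley// lte_fin.
have mI : measurable_fun setT (fun x : measurableTypeR R => (\1_ge1 x : R) * x^-1).
  rewrite (_ : (fun x => _) = (fun x => (\1_ge1 x : R) * x `^ (-1))).
    by apply: measurable_funM; [exact: measurable_indic|exact: measurable_powR].
  apply/funext => x; rewrite indic_ge1; have [x1|x1] := leP 1 x; rewrite ?mul0r//.
  by rewrite powR_inv1//; lra.
rewrite -ge0_integralZl//; last 2 first.
- exact/measurable_EFinP.
- by move=> x _; rewrite lee_fin indic_ge1; have [x1|x1] := leP 1 x;
    rewrite ?mul0r// mul1r invr_ge0; lra.
apply: ge0_le_integral => //.
- by move=> x _; rewrite -EFinM lee_fin indic_ge1; have [x1|x1] := leP 1 x;
    rewrite ?mul0r ?mulr0// mul1r mulr_ge0// invr_ge0; lra.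
- by apply/measurable_EFinP; apply: measurable_funM.
- apply/measurable_EFinP.
  exact: (measurableT_comp (@measurable_powR R (- s)) measurable_1Dsqr).
- move=> x _; rewrite -EFinM lee_fin indic_ge1.
  have [x1|x1] := leP 1 x; last by rewrite mul0r mulr0 powR_ge0.
  apply: (@le_trans _ _ ((1 + x ^+ 2) `^ (- 2^-1))); last first.
    by rewrite ler_powR ?lerN2// lerDl sqr_ge0.
  rewrite powRN powR12_sqrt ?(ltW (gt0_1Dsqr x))// mul1r -invfM lef_pV2 ?posrE ?sqrtr_gt0
    ?gt0_1Dsqr//; last by lra.
  rewrite -(ger0_norm (_ : 0 <= 2 * x)); last by lra.
  by rewrite -sqrtr_sqr ler_wsqrtr//; nra.
Qed.

Lemma betaE_gt0 s : (0 < betaE s)%E.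
Proof.
have [s2|s2] := leP s 2^-1; first by rewrite betaE_eqy.
have s0 : 0 < s by lra.
have : (0 < betaE s * gammaE s)%E.
  rewrite betaE_gammaE; apply: mule_gt0; last by apply: gammaE_gt0; lra.
  by rewrite lte_fin sqrtr_gt0 pi_gt0.
apply: contraTT; rewrite -!leNgt => b0.
by rewrite mule_le0_ge0// gammaE_ge0.
Qed.

(** Stated as a product, since dividing by [cGamma z] requires its
    non-vanishing, which is [cGamma_neq0] below. *)
Lemma cbeta z : 2^-1 < Re z ->
  cintegral leb setT (fun x => cpow (1 + x ^+ 2) (- z)) * cGamma z =
  (Num.sqrt pi)%:C * cGamma (z - (2^-1)%:C).
Proof.
move=> z2.
have := @mellin_fubini R (fun=> 1) (fun x => 1 + x ^+ 2) _ _ _ _ z (fun t => Num.sqrt pi *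
  (t `^ (- 2^-1) * expR (- t))).
have -> : (fun x : measurableTypeR R => (1 : R)%:C * cpow (1 + x ^+ 2) (- z)) =
  (fun x => cpow (1 + x ^+ 2) (- z)).
  by apply/funext => x; rewrite mul1r.
move=> ->//.
- rewrite cintegral_pos cGammaE -cintegralZ//; last first.
    apply: abs_integrable_mellin => //; apply: gammaE_lty.
    by case: z z2 => a b /=; lra.
  apply: eq_cintegral => t _; rewrite /cmellin indic_pos mul1r.
  case: ltP => t0; last by rewrite !mul0r mulr0.
  have -> : cpow t (z - (2^-1)%:C - 1) = cpow t (z - 1) * (t `^ (- 2^-1))%:C.
    by rewrite -cpow_real// -cpowD; congr cpow; rewrite rmorphN; ring.
  by rewrite !rmorphM/=; ring.
- exact: measurable_1Dsqr.
- by move=> x _; exact: gt0_1Dsqr.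
- by apply: gammaE_lty; lra.
- under eq_integral do rewrite mul1r; exact: betaE_lty.
- exact: gauss_kernel.
Qed.

End GammaValues.

(** * The Gamma function has no zeros in the right half-plane *)

Section GammaNonzero.
Variable R : realType.
Local Notation leb := (@lebesgue_measure R).
Local Notation Re := (@complex.Re R).
Local Notation Im := (@complex.Im R).
Local Notation pos := (`]0, +oo[%classic : set (measurableTypeR R)).
Implicit Types (s t x y : R) (z : R[i]).

Lemma norm_sin_le x : `|sin x| <= `|x|.
Proof.
wlog x0 : x / 0 <= x.
  move=> H; have [/H//|x0] := leP 0 x.
  by rewrite -normrN -sinN -[leRHS]normrN; apply: H; lra.
have [->|xn0] := eqVneq x 0; first by rewrite sin0.
have xgt : 0 < x by rewrite lt0r xn0.
have [c _] : exists2 c, c \in `]0, x[%R & sin x - sin 0 = cos c * (x - 0).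
  apply: (@MVT R sin cos) => //.
  by apply: continuous_subspaceT; exact: continuous_sin.
rewrite sin0 !subr0 => ->.
by rewrite normrM ler_piMl// cos_max.
Qed.

Lemma cos_ge x : 1 - x ^+ 2 / 2 <= cos x.
Proof.
have -> : x = (x / 2) *+ 2 by rewrite mulr2n -splitr.
rewrite cos_mulr2n.
have := norm_sin_le (x / 2); have := sin2cos2 (x / 2).
rewrite -ler_sqr ?nnegrE// !real_normK ?num_real//.
have -> : (x / 2 *+ 2) ^+ 2 / 2 = 2 * (x / 2) ^+ 2 by field.
by lra.
Qed.

(** For [2^-1 <= t] this combines [cos_ge] with |ln t| <= 2 |t - 1|; for
    smaller [t] the left-hand side is below -1. A bound quadratic in [t - 1]
    integrates exactly against the Gamma density. *)
Lemma cos_ln_ge y t : 0 < t ->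
  1 - (8 + 2 * y ^+ 2) * (t - 1) ^+ 2 <= cos (y * ln t).
Proof.
move=> t0; have [t2|t2] := leP 2^-1 t; last first.
  apply: le_trans (cos_geN1 _); have y2 := sqr_ge0 y.
  have : 4^-1 <= (t - 1) ^+ 2 by nra.
  by nra.
apply: le_trans (cos_ge _).
have lt2 : `|ln t| <= 2 * `|t - 1|.
  have [t1|t1] := leP 1 t.
    have := @le_ln1Dx R (t - 1); rewrite addrCA subrr addr0 => h.
    rewrite ger0_norm ?ln_ge0// ger0_norm ?subr_ge0//.
    apply: (le_trans (h _)); lra.
  have ti : 0 < t^-1 by rewrite invr_gt0.
  have := @le_ln1Dx R (t^-1 - 1); rewrite addrCA subrr addr0 lnV ?posrE// => h.
  rewrite ltr0_norm; last by rewrite ln_lt0// t0.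
  rewrite ltr0_norm ?subr_lt0//.
  apply: (le_trans (h _)); first by lra.
  have -> : t^-1 - 1 = (1 - t) * t^-1 by field; exact: lt0r_neq0.
  have : t^-1 <= 2 by rewrite invf_ple ?posrE//; lra.
  by nra.
have : ln t ^+ 2 <= 4 * (t - 1) ^+ 2.
  rewrite -(real_normK (num_real (ln t))) -(real_normK (num_real (t - 1))).
  have := normr_ge0 (ln t); have := normr_ge0 (t - 1); nra.
have := sqr_ge0 y; have := sqr_ge0 (t - 1); have := sqr_ge0 (ln t).
rewrite exprMn; nra.
Qed.

Definition rgamma s := fine (gammaE s : \bar R).

Lemma rgammaE s : 0 < s -> gammaE s = (rgamma s)%:E :> \bar R.
Proof.
move=> s0; rewrite fineK// ge0_fin_numE ?gammaE_lty//; exact: gammaE_ge0.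
Qed.

Lemma rgamma_gt0 s : 0 < s -> 0 < rgamma s.
Proof. by move=> s0; rewrite -lte_fin -rgammaE// gammaE_gt0. Qed.

Lemma rgammaS s : 0 < s -> rgamma (s + 1) = s * rgamma s.
Proof.
by move=> s0; apply: EFin_inj; rewrite EFinM -!rgammaE ?gammaES// ?addr_gt0.
Qed.

Let g s t : R := \1_pos t * (t `^ (s - 1) * expR (- t)).

Let g_int s : 0 < s -> leb.-integrable setT (EFin \o g s).
Proof.
move=> s0; apply/integrableP; split.
  by apply/measurable_EFinP; exact: measurable_mellin1.
under eq_integral do rewrite /= ger0_norm ?mellin1_ge0//.
exact: gammaE_lty.
Qed.

Let Rint_g s : \int[leb]_t g s t = rgamma s. Proof. by []. Qed.

(** After multiplication by the unimodular number x^(-iy), the integrand at [t]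
    is the Gamma density of parameter [x] times a phase with real part
    cos(y ln(t / x)). That density has mean and variance [x], so by
    [cos_ln_ge] the average of the cosine is at least 1 - c / x, which is
    positive. *)
Lemma cGamma_neq0_large x y : 8 + 2 * y ^+ 2 < x -> cGamma (x +i* y) != 0.
Proof.
set c := 8 + _ => cx; have c8 : 8 <= c by rewrite lerDl mulr_ge0 ?sqr_ge0.
have x0 : 0 < x by lra.
apply/eqP => G0.
have goo : (gammaE x < +oo)%E by exact: gammaE_lty.
have := abs_integrable_mellin (z := x +i* y) ltr01 goo.
move=> ai; have : Re (cpow x (0 +i* - y) * cGamma (x +i* y)) = 0.
  by rewrite G0 mulr0.
rewrite cGammaE -cintegralZ// => E0.
have E : \int[leb]_t Re (cpow x (0 +i* - y) * cmellin (x +i* y) 1 t) = 0 by exact: E0.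
have Zi k s : 0 < s -> leb.-integrable setT (EFin \o (fun t => k * g s t)).
  move=> s0; have := integrableZl measurableT k (g_int s0).
  by apply: eq_integrable.
have Di f1 f2 : leb.-integrable setT (EFin \o f1) -> leb.-integrable setT (EFin \o f2) ->
    leb.-integrable setT (EFin \o (fun t : measurableTypeR R => f1 t + f2 t : R)).
  by move=> i1 i2; have := integrableD measurableT i1 i2; apply: eq_integrable.
have x1 : 0 < x + 1 by lra.
have x2 : 0 < x + 1 + 1 by lra.
(* The Gamma density times 1 - c (t / x - 1)^2, expanded into the densities
   of parameters x, x + 1 and x + 2. *)
pose lower t := (1 - c) * g x t +
      ((2 * c / x) * g (x + 1) t + (- (c / x ^+ 2)) * g (x + 1 + 1) t).
have : rgamma x * (1 - c / x) <= 0.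
  rewrite -[leRHS]E.
  have -> : rgamma x * (1 - c / x) = \int[leb]_t lower t.
    rewrite /lower RintegralD ?Di ?Zi// RintegralD ?Zi// !RintegralZl ?g_int//.
    rewrite !Rint_g !rgammaS//; field; exact: lt0r_neq0.
  have [aiZ _] : _ /\ _ := (abs_integrableP _ _ measurableT).1 (abs_integrableZ (cpow x (0
    +i* - y)) measurableT ai).
  apply: le_Rintegral => //; first by apply: (Di); [exact: Zi|apply: (Di); exact: Zi].
  move=> t _; rewrite /lower /g /cmellin indic_pos.
  have [t0|t0] := ltP 0 t; last by rewrite !mul0r !mulr0 /= !addr0.
  have tE : t `^ (x + 1 - 1) = t `^ (x - 1) * t.
    rewrite -[X in _ = _ * X](powRr1 (ltW t0)) -powRD; last by apply/implyP => _; rewrite gt_eqF.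
    by congr (_ `^ _); ring.
  have tE2 : t `^ (x + 1 + 1 - 1) = t `^ (x - 1) * t ^+ 2.
    rewrite -[in RHS](powR_mulrn 2 (ltW t0)) -powRD; last by apply/implyP => _; rewrite gt_eqF.
    by congr (_ `^ _); ring.
  rewrite tE tE2 !mul1r.
  have -> : Re (cpow x (0 +i* - y) * (cpow t (x +i* y - 1) * (expR (- t))%:C)) =
      t `^ (x - 1) * expR (- t) * cos (y * ln (t / x)).
    rewrite [in RHS]ln_div ?posrE// [in RHS]mulrBr [in RHS]cosB.
    rewrite !complex_ReM !complex_ImM !cpow_Re !cpow_Im /=.
    rewrite /powR gt_eqF// mul0r expR0 mulNr cosN sinN subr0; ring.
  apply: le_trans (ler_wpM2l _ (cos_ln_ge y (divr_gt0 t0 x0))); last first.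
    by rewrite mulr_ge0 ?powR_ge0 ?expR_ge0.
  rewrite -/c le_eqVlt; apply/orP; left; apply/eqP; field; exact: lt0r_neq0.
rewrite leNgt mulr_gt0 ?rgamma_gt0//.
by rewrite subr_gt0 ltr_pdivrMr// mul1r.
Qed.

Local Notation ge1 := (`[1, +oo[%classic : set (measurableTypeR R)).

(** The constant of the functional equation, equal to 1 / z. Its non-vanishing
    is obtained from this integral form. *)
Let C z : R[i] := cintegral leb setT (fun x => (\1_ge1 x)%:C * cpow x (- (z + 1))).

Let cGamma_step z : 0 < Re z -> C z * cGamma (z + 1) = cGamma z.
Proof.
move=> z0; rewrite /C.
rewrite (@mellin_fubini R (\1_ge1) idfun _ _ _ _ (z + 1) (fun t => t^-1 * expR (- t)))//=.
- rewrite /cGamma !cintegral_pos; apply: eq_cintegral => t _; rewrite indic_pos.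
  case: ltP => t0; last by rewrite !mul0r.
  rewrite addrK -(cpowB1 z t0) !mul1r rmorphM/= -mulrA; congr (_ * _).
  by rewrite mulrA -rmorphM/= divff ?mul1r// lt0r_neq0.
- exact: measurable_id.
- by move=> x; rewrite indic_ge1; have [x1|x1] := leP 1 x; rewrite ?ltxx//; lra.
- by apply: gammaE_lty; case: z z0 => a b /=; lra.
- by case: z z0 => a b /= a0; rewrite powR_kernel// ltry.
- exact: expR_kernel.
Qed.

(** Rescaling by [h > 1] multiplies the integral over [1, +oo[ by a constant, so
    if it vanishes then so does the integral over [h, +oo[, hence the one over
    [1, h[. When [h] is close to 1 the phase hardly moves on [1, h[ and the
    real part of the integrand is positive there. *)
Let C_neq0 z : 0 < Re z -> C z != 0.
Proof.
move=> z0; apply/eqP; rewrite /C; set f1 := (fun x => _) => C0.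
(* On [1, h[ the phase is at most |y| / (1 + |y|) in absolute value, so that
   its cosine is at least 1/2. *)
pose y := Im z; pose h := expR (1 + `|y|)^-1.
have h1 : 1 < h by rewrite -(expR0 R) ltr_expR invr_gt0 ltr_wpDr.
have h0 : 0 < h by lra.
pose geh : set (measurableTypeR R) := `[h, +oo[%classic.
pose bd : set (measurableTypeR R) := `[1, h[%classic.
have mgeh : measurable geh by exact: measurable_itv.
have mbd : measurable bd by exact: measurable_itv.
have ai1 : abs_integrable leb setT f1.
  have [mr mi] : cmeasurable setT f1.
    apply: cmeasurableM; last exact: measurable_cpow.
    by apply: cmeasurable_real; exact: measurable_indic.
  split => //.
  have <- : (\int[leb]_x (\1_ge1 x * x `^ (- (Re z + 1)))%:E =
      \int[leb]_x (Normc.normc (f1 x))%:E)%E.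
    apply: eq_integral => x _; rewrite /f1 Normc.normcM normc_real indic_ge1.
    have [x1|x1] := leP 1 x; last by rewrite normr0 !mul0r.
    rewrite normr1 normc_cpow; last by lra.
    by rewrite complex_ReN; case: (z).
  by rewrite powR_kernel// ltry.
have f1D : f1 = (fun x => (\1_geh x)%:C * f1 x + (\1_bd x)%:C * f1 x).
  apply/funext => x; rewrite -mulrDl -rmorphD/= !indicE !mem_setE !in_itv/= !andbT.
  have [x1|x1] := leP 1 x; have [xh|xh] := leP h x; rewrite ?addr0 ?add0r ?mul1r//=.
  by rewrite mul0r /f1 indic_ge1 leNgt x1/= mul0r.
have geh0 : cintegral leb setT (fun x => (\1_geh x)%:C * f1 x) = 0.
  rewrite (@cintegral_affine R 0 h)//; last first.
    by have [? ? _] := abs_integrable_indic mgeh ai1.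
  rewrite -[RHS](mulr0 (cpow h (- z))) -C0 -cintegralZ//.
  apply: eq_cintegral => x _; rewrite /f1 add0r !indicE !mem_setE !in_itv/= !andbT.
  rewrite ler_pMr//; have [x1|x1] := leP 1 x; last by rewrite !mul0r mulr0.
  rewrite (le_trans x1)/=; last by rewrite ler_peMl; lra.
  rewrite !mul1r cpowM//; last by lra.
  have -> : cpow h (- z) = cpow h (- (z + 1)) * h%:C.
    by rewrite -(cpowB1 (- z) h0) opprD.
  ring.
have bd0 : cintegral leb setT (fun x => (\1_bd x)%:C * f1 x) = 0.
  rewrite -[LHS]add0r -[X in X + _]geh0 -cintegralD//; try exact: abs_integrable_indic.
  by rewrite -f1D.
have : 0 < \int[leb]_x Re ((\1_bd x)%:C * f1 x).
  pose c := h `^ (- (Re z + 1)) / 2.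
  have c0 : 0 < c by rewrite mulr_gt0// powR_gt0.
  have cle x : bd x -> c <= Re (f1 x).
    rewrite /bd /= in_itv/= => /andP[x1 xh].
    rewrite -[leRHS]/(Re (f1 x)) /f1 indic_ge1 x1 mul1r cpow_Re.
    rewrite /c ler_pM ?powR_ge0 ?invr_ge0//.
      rewrite /powR gt_eqF// ler_expR complex_ReN.
      have -> : Re (z + 1) = Re z + 1 by case: (z).
      rewrite !mulNr lerN2 ler_wpM2l ?ler_ln ?posrE// ?ltW//; lra.
    apply: le_trans (cos_ge _).
    have : `|Im (- (z + 1)) * ln x| <= 1.
      have -> : Im (- (z + 1)) = - y by rewrite /y; case: (z) => a b /=; rewrite addr0.
      rewrite normrM normrN (ger0_norm (ln_ge0 x1)).
      have lx : ln x <= (1 + `|y|)^-1.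
        by rewrite -[leRHS]expRK ler_ln ?posrE ?expR_gt0//; [exact: ltW|lra].
      apply: (@le_trans _ _ (`|y| * (1 + `|y|)^-1)); first by rewrite ler_wpM2l.
      by rewrite ler_pdivrMr ?mul1r ?ltr_wpDr// lerDr.
    rewrite -(@ler_pXn2r _ 2)// ?nnegrE// real_normK ?num_real// expr1n; lra.
  rewrite /Rintegral; apply: fine_gt0; apply/andP; split; last first.
    have /(abs_integrableP _ _ measurableT)[ri _] := abs_integrable_indic mbd ai1.
    by have := integrable_fin_num measurableT ri; rewrite fin_numE ltey => /andP[].
  apply: (@lt_le_trans _ _ (\int[leb]_x (c * \1_bd x)%:E)%E).
    under eq_integral do rewrite EFinM.
    rewrite ge0_integralZl//; last 2 first.
    - by apply/measurable_EFinP; exact: measurable_indic.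
    - by rewrite lee_fin ltW.
    rewrite integral_indic// setIT mule_gt0 ?lte_fin//.
    rewrite [X in (_ < X)%E](_ : _ = leb `[1, h[%classic)// (@lebesgue_measure_itv R `[1,
      h[)/= lte_fin.
    by rewrite h1 -EFinB lte_fin subr_gt0.
  apply: ge0_le_integral => //.
  - by move=> x _; rewrite lee_fin mulr_ge0// ltW.
  - by apply/measurable_EFinP; apply: measurable_funM => //; exact: measurable_indic.
  - by have [? _ _] := abs_integrable_indic mbd ai1; apply/measurable_EFinP.
  - move=> x _; rewrite lee_fin indicE; have [xbd|xbd] := boolP (x \in bd).
      by rewrite mulr1 mul1r; apply: cle; rewrite inE in xbd.
    by rewrite mulr0 mul0r.
have -> : \int[leb]_x Re ((\1_bd x)%:C * f1 x) = 0 by have := congr1 Re bd0.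
by rewrite ltxx.
Qed.

(** By the functional equation a zero at [z] would propagate to all the points
    z + n, against [cGamma_neq0_large]. *)
Lemma cGamma_neq0 z : 0 < Re z -> cGamma z != 0.
Proof.
case: z => x y /= x0; apply/eqP => G0.
have step (n : nat) : cGamma ((x + n%:R) +i* y) = 0.
  elim: n => [|n IH]; first by rewrite addr0.
  have xn : 0 < Re ((x + n%:R) +i* y) by rewrite /= ltr_wpDr.
  have := cGamma_step xn; rewrite IH => /eqP; rewrite mulf_eq0 (negPf (C_neq0 xn))/= => /eqP.
  by move=> <-; congr cGamma; apply: complex_eqP; rewrite /= ?addr0// -addrA natr1.
pose n := (Num.truncn (8 + 2 * y ^+ 2)).+1.
have : cGamma ((x + n%:R) +i* y) != 0.
  apply: cGamma_neq0_large; apply: (lt_le_trans (truncnS_gt _)).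
  by rewrite lerDr ltW.
by rewrite step eqxx.
Qed.

End GammaNonzero.

(** * Triangular substitutions and products of integrals on tuples *)

Section LebesgueTupleIntegral.
Variable R : realType.
Local Notation mR := (measurableTypeR R).
Local Notation leb := (@lebesgue_measure R).
Local Notation lebt := (lebesgue_tuple R).
Local Open Scope ereal_scope.

Lemma measurable_consl d (x : mR) :
  measurable_fun setT (fun t : d.-tuple mR => cons_pair (x, t)).
Proof.
exact: (measurableT_comp (@measurable_cons_pair R d) (@pair1_measurable _ _ _ _ x)).
Qed.

Lemma ge0_integral_tupleS d (h : d.+1.-tuple mR -> \bar R) :
  measurable_fun setT h -> (forall t, 0 <= h t) ->
  \int[lebt d.+1]_t h t = \int[leb \x lebt d]_z h (cons_pair z).
Proof.
move=> mh h0.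
have mc := @measurable_cons_pair R d.
have h0' : {in setT, forall t, 0 <= h t} by [].
have := ge0_integral_pushforward mc (leb \x lebt d) measurableT mh h0'.
by rewrite preimage_setT => <-; apply: eq_measure_integral.
Qed.

Lemma ge0_integral_tuple_iter d (h : d.+1.-tuple mR -> \bar R) :
  measurable_fun setT h -> (forall t, 0 <= h t) ->
  \int[lebt d.+1]_t h t = \int[leb]_x \int[lebt d]_t h (cons_pair (x, t)).
Proof.
move=> mh h0; rewrite ge0_integral_tupleS// fubini_tonelli1//.
exact: (measurableT_comp mh (@measurable_cons_pair R d)).
Qed.

Lemma tnth_cons_pair0 d x (t : d.-tuple mR) : tnth (cons_pair (x, t)) ord0 = x.
Proof. by []. Qed.

Lemma tnth_cons_pairS d x (t : d.-tuple mR) i :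
  tnth (cons_pair (x, t)) (lift ord0 i) = tnth t i.
Proof. by rewrite tnthS. Qed.

Definition affine_tuple d (a b : 'I_d -> d.-tuple mR -> R) (t : d.-tuple mR) :
    d.-tuple mR :=
  [tuple (a i t + b i t * tnth t i)%R | i < d].

Lemma measurable_affine_tuple d (a b : 'I_d -> d.-tuple mR -> R) :
  (forall i, measurable_fun setT (a i)) ->
  (forall i, measurable_fun setT (b i)) ->
  measurable_fun setT (affine_tuple a b).
Proof.
move=> ma mb; apply/measurable_fun_tnthP => i.
rewrite (_ : _ \o _ = fun t => (a i t + b i t * tnth t i)%R); last first.
  by apply/funext => t /=; rewrite tnth_mktuple.
apply: measurable_funD => //; apply: measurable_funM => //.
exact: measurable_tnth.
Qed.

(** The substitution has a triangular Jacobian matrix with diagonal [b], and it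
    is carried out one coordinate at a time: for a fixed first coordinate the
    others are substituted by induction, and the first coordinate is then
    subject to an affine map with constant coefficients. Each step starts from
    the target of the map, so its inverse never appears. *)
Lemma ge0_integral_affine_tuple d (a b : 'I_d -> d.-tuple mR -> R)
    (h : d.-tuple mR -> \bar R) :
  (forall i, measurable_fun setT (a i)) ->
  (forall i, measurable_fun setT (b i)) ->
  (forall i t, (0 < b i t)%R) ->
  (forall (i : 'I_d) (s t : d.-tuple mR), (forall j : 'I_d, (j < i)%N -> tnth s j =
    tnth t j) -> a i s = a i t) ->
  (forall (i : 'I_d) (s t : d.-tuple mR), (forall j : 'I_d, (j < i)%N -> tnth s j =
    tnth t j) -> b i s = b i t) ->
  measurable_fun setT h -> (forall t, 0 <= h t) ->
  \int[lebt d]_t h t =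
  \int[lebt d]_t (h (affine_tuple a b t) * (\prod_(i < d) b i t)%:E).
Proof.
elim: d a b h => [|d IH] a b h ma mb b0 da db mh h0.
  apply: eq_integral => t _; rewrite big_ord0 mule1.
  by rewrite (tuple0 t) [in RHS](tuple0 (affine_tuple _ _ _)).
have mprod d' (b' : 'I_d' -> d'.-tuple mR -> R) : (forall i, measurable_fun setT (b' i)) ->
    measurable_fun setT (fun t => (\prod_(i < d') b' i t)%R).
  by move=> mb'; apply: measurable_prod => i _.
have mrhs d' (a' b' : 'I_d' -> d'.-tuple mR -> R) h' : (forall i, measurable_fun setT (a' i)) ->
    (forall i, measurable_fun setT (b' i)) -> measurable_fun setT h' ->
    measurable_fun setT (fun t => h' (affine_tuple a' b' t) * (\prod_(i < d') b' i t)%:E).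
  move=> ma' mb' mh'; apply: emeasurable_funM.
    exact: (measurableT_comp mh' (measurable_affine_tuple ma' mb')).
  by apply/measurable_EFinP; exact: mprod.
have rhs0 d' (a' b' : 'I_d' -> d'.-tuple mR -> R) h' : (forall i t, (0 < b' i t)%R) ->
    (forall t, 0 <= h' t) ->
    forall t, 0 <= h' (affine_tuple a' b' t) * (\prod_(i < d') b' i t)%:E.
  move=> b'0 h'0 t; apply: mule_ge0 => //; rewrite lee_fin.
  by apply: prodr_ge0 => i _; exact: ltW.
rewrite [LHS]ge0_integral_tuple_iter; [|exact: mh|exact: h0].
rewrite [RHS]ge0_integral_tuple_iter; [|by apply: mrhs|exact: rhs0].
(* The coefficients of the first coordinate are constants; any tuple computes
   them. *)
pose t0 : d.+1.-tuple mR := [tuple 0%R | i < d.+1].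
pose a0 := a ord0 t0; pose b0' := b ord0 t0.
have a0E t : a ord0 t = a0 by apply: da => j.
have b0E t : b ord0 t = b0' by apply: db => j.
have b0'0 : (0 < b0')%R by exact: b0.
pose H x := \int[lebt d]_t h (cons_pair (x, t)).
have mH : measurable_fun setT H.
  apply: (@measurable_fun_fubini_tonelli_F _ _ _ _ _ _ (fun z => h (cons_pair z))) => //.
  exact: (measurableT_comp mh (@measurable_cons_pair R d)).
rewrite -[LHS]/(\int[leb]_x H x).
rewrite (@ge0_integral_affine R a0 b0')//; last first.
  by move=> x; apply: integral_ge0.
apply: eq_integral => x _; rewrite /H.
pose a' i t := a (lift ord0 i) (cons_pair (x, t)).
pose b' i t := b (lift ord0 i) (cons_pair (x, t)).
have mh' : measurable_fun setT (fun t => h (cons_pair ((a0 + b0' * x)%R, t))).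
  exact: (measurableT_comp mh (@measurable_consl d _)).
have ma' i : measurable_fun setT (a' i).
  exact: (measurableT_comp (ma _) (@measurable_consl d _)).
have mb' i : measurable_fun setT (b' i).
  exact: (measurableT_comp (mb _) (@measurable_consl d _)).
have dep (i : 'I_d) (s t : d.-tuple mR) :
    (forall j : 'I_d, (j < i)%N -> tnth s j = tnth t j) ->
    forall j : 'I_d.+1, (j < lift ord0 i)%N ->
    tnth (cons_pair (x, s)) j = tnth (cons_pair (x, t)) j.
  move=> st j; case: (unliftP ord0 j) => [k|] ->; last by [].
  by rewrite !tnth_cons_pairS => ki; apply: st.
rewrite (IH a' b')//.
- rewrite -ge0_integralZr//; last 3 first.
  + exact: (mrhs _ _ _ (fun t => h (cons_pair ((a0 + b0' * x)%R, t)))).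
  + move=> t _; apply: (rhs0 _ _ _ (fun t => h (cons_pair ((a0 + b0' * x)%R, t)))) => //.
    by move=> i s; exact: b0.
  + by rewrite lee_fin ltW.
  apply: eq_integral => t _.
  rewrite big_ord_recl b0E EFinM -muleA [X in _ = _ * X]muleC; congr (_ * _).
  congr (h _); apply: eq_from_tnth => j; rewrite tnth_mktuple.
  case: (unliftP ord0 j) => [k|] ->.
    by rewrite !tnth_cons_pairS tnth_mktuple.
  by rewrite !tnth_cons_pair0 a0E b0E.
- by move=> i t; exact: b0.
- by move=> i s t st; apply: da; exact: dep.
- by move=> i s t st; apply: db; exact: dep.
Qed.

Lemma ge0_integral_tuple_prod d (g : 'I_d -> mR -> R) :
  (forall i, measurable_fun setT (g i)) -> (forall i x, (0 <= g i x)%R) ->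
  \int[lebt d]_t (\prod_(i < d) g i (tnth t i))%:E =
  \prod_(i < d) \int[leb]_x (g i x)%:E.
Proof.
elim: d g => [|d IH] g mg g0.
  under eq_integral do rewrite big_ord0.
  by rewrite integral_dirac// big_ord0 diracT mul1e.
have mp d' (g' : 'I_d' -> mR -> R) : (forall i, measurable_fun setT (g' i)) ->
    measurable_fun setT (fun t : d'.-tuple mR => (\prod_(i < d') g' i (tnth t i))%R).
  move=> mg'; apply: measurable_prod => i _.
  exact: (measurableT_comp (mg' i) (@measurable_tnth _ _ _ i)).
rewrite ge0_integral_tupleS; last 2 first.
- by apply/measurable_EFinP; exact: mp.
- by move=> t; rewrite lee_fin prodr_ge0.
rewrite big_ord_recl -IH//.
rewrite -(@ge0_integral_prodM _ _ _ _ R leb (lebt d) (g ord0) (fun t => \prod_(i < d) g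
  (lift ord0 i) (tnth t i))%R)//.
- apply: eq_integral => -[x t] _; rewrite big_ord_recl.
  by under [in LHS]eq_bigr do rewrite tnth_cons_pairS.
- exact: (mp _ (fun i => g (lift ord0 i))).
- by move=> t; apply: prodr_ge0.
Qed.

Lemma cintegral_tuple_prod d (g : 'I_d -> mR -> R[i]) :
  (forall i, abs_integrable leb setT (g i)) ->
  abs_integrable (lebt d) setT (fun t => \prod_(i < d) g i (tnth t i))%R /\
  cintegral (lebt d) setT (fun t => \prod_(i < d) g i (tnth t i))%R =
  (\prod_(i < d) cintegral leb setT (g i))%R.
Proof.
elim: d g => [|d IH] g gi.
  have E : (fun t : 0.-tuple mR => \prod_(i < 0) g i (tnth t i))%R = (fun=> (1 : R)%:C%R).
    by apply/funext => t; rewrite big_ord0.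
  have i1 : (lebt 0).-integrable setT (EFin \o (fun=> 1%R)).
    apply/integrableP; split; first exact: measurable_cst.
    by rewrite integral_dirac// diracT mul1e /= normr1 ltry.
  rewrite E; split; first exact: abs_integrable_real.
  rewrite cintegral_real big_ord0 /Rintegral integral_dirac//.
  by rewrite diracT mul1e.
have [ai ci] := IH (fun i => g (lift ord0 i)) (fun i => gi (lift ord0 i)).
pose G := (fun z : mR * d.-tuple mR => g ord0 z.1 * \prod_(i < d) g (lift ord0 i) (tnth z.2 i))%R.
have E : (fun z => (\prod_(i < d.+1) g i (tnth (cons_pair z) i)) * (1 : R)%:C)%R = G.
  apply/funext => -[x t]; rewrite mulr1 big_ord_recl /G.
  by under eq_bigr do rewrite tnth_cons_pairS.
have subst (h : d.+1.-tuple mR -> \bar R) : measurable_fun setT h -> (forall y, 0 <= h y) ->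
    \int[lebt d.+1]_t h t = \int[leb \x lebt d]_z (h (cons_pair z) * 1%:E).
  move=> mh h0; rewrite ge0_integral_tupleS//.
  by apply: eq_integral => z _; rewrite mule1.
have mg : cmeasurable setT (fun t : d.+1.-tuple mR => \prod_(i < d.+1) g i (tnth t i))%R.
  apply: cmeasurable_prod => i _; have [mr mi _] := gi i.
  split; [exact: (measurableT_comp mr (@measurable_tnth _ _ _ i))|].
  exact: (measurableT_comp mi (@measurable_tnth _ _ _ i)).
have mc := @measurable_cons_pair R d.
have J0 (z : mR * d.-tuple mR) : (0 <= 1 :> R)%R by [].
split.
  apply/(@abs_integrable_transfer _ _ _ _ _ (leb \x lebt d) (lebt d.+1) _ (fun=> 1%R) J0
    mc) => //.
  rewrite E /G.
  exact: (@abs_integrable_prodM _ _ _ _ R leb (lebt d) (g ord0)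
    (fun t => \prod_(i < d) g (lift ord0 i) (tnth t i))%R (gi ord0) ai).
rewrite (@cintegral_transfer _ _ _ _ _ (leb \x lebt d) (lebt d.+1) (@cons_pair R d) (fun=>
  1%R) J0)//.
rewrite E big_ord_recl -ci /G.
exact: (@cintegral_prodM _ _ _ _ R leb (lebt d) (g ord0)
  (fun t => \prod_(i < d) g (lift ord0 i) (tnth t i))%R (gi ord0) ai).
Qed.

End LebesgueTupleIntegral.

(** * Gram determinants over the reals, complex numbers and quaternions *)

Lemma addq_Quat (R : comNzRingType) (a b c d a' b' c' d' : R) :
  Quat a b c d + Quat a' b' c' d' = Quat (a + a') (b + b') (c + c') (d + d').
Proof. by []. Qed.

Lemma mulq_Quat (R : comNzRingType) (a b c d a' b' c' d' : R) :
  Quat a b c d * Quat a' b' c' d' =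
  Quat (a * a' - b * b' - c * c' - d * d') (a * b' + b * a' + c * d' - d * c')
       (a * c' - b * d' + c * a' + d * b') (a * d' + b * c' - c * b' + d * a').
Proof. by []. Qed.

Section ScalarAlgebra.
Variables (R : realType) (K : scalars).
Local Notation S := (carrier R K).
Implicit Types (x y : S) (a b : R).

Definition coordK : S -> 'I_(rdim K) -> R :=
  match K return carrier R K -> 'I_(rdim K) -> R with
  | Reals => fun u _ => u
  | Complexes => fun u i => if val i == 0%N then complex.Re u else complex.Im u
  | Quaternions => fun u i => coords_of_quat u i
  end.

Definition ofR : R -> S :=
  match K return R -> carrier R K with
  | Reals => fun r => r
  | Complexes => fun r => r%:C
  | Quaternions => fun r => Quat r 0 0 0
  end.

Definition normsq x : R := \sum_i coordK x i ^+ 2.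

Lemma conjKD x y : conjK (x + y) = conjK x + conjK y.
Proof.
move: x y; rewrite /conjK; case: K => //= x y; first exact: rmorphD.
by case: x y => [????] [????]; rewrite /GRing.add /= /addq /conjq /= !opprD.
Qed.

Lemma conjKM x y : conjK (x * y) = conjK y * conjK x.
Proof.
move: x y; rewrite /conjK; case: K => //= x y; first exact: mulrC.
  by rewrite rmorphM mulrC.
by case: x y => [????] [????]; rewrite /GRing.mul /= /conjq /=; congr Quat; ring.
Qed.

Lemma conjKK x : conjK (conjK x) = x.
Proof.
move: x; rewrite /conjK; case: K => //= x; first exact: conjcK.
by case: x => ????; rewrite /conjq /= !opprK.
Qed.

Lemma conjK0 : conjK (0 : S) = 0.
Proof. by apply: (addrI (conjK 0)); rewrite -conjKD !addr0. Qed.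

Lemma conjK_sum (I : Type) (r : seq I) (P : pred I) (F : I -> S) :
  conjK (\sum_(i <- r | P i) F i) = \sum_(i <- r | P i) conjK (F i).
Proof. exact: (big_morph _ conjKD conjK0). Qed.

Lemma ofRD a b : ofR (a + b) = ofR a + ofR b.
Proof.
rewrite /ofR; case: K => //=; first by rewrite rmorphD.
by rewrite addq_Quat !addr0.
Qed.

Lemma ofRM a b : ofR (a * b) = ofR a * ofR b.
Proof.
rewrite /ofR; case: K => //=; first by rewrite rmorphM.
by rewrite mulq_Quat; congr Quat; ring.
Qed.

Lemma ofR_inj : injective ofR.
Proof. by rewrite /ofR; case: K => a b //= => -[]. Qed.

Lemma ofR1 : ofR 1 = 1. Proof. by rewrite /ofR; case: K. Qed.
Lemma ofR0 : ofR 0 = 0. Proof. by rewrite /ofR; case: K. Qed.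

Lemma ofR_comm a x : ofR a * x = x * ofR a.
Proof.
move: x; rewrite /ofR; case: K => //= x; [exact: mulrC|exact: mulrC|].
by case: x => ????; rewrite !mulq_Quat; congr Quat; ring.
Qed.

Lemma conj_ofR a : conjK (ofR a) = ofR a.
Proof.
rewrite /conjK /ofR; case: K => //=; first by rewrite oppr0.
by rewrite /conjq /= oppr0.
Qed.

Lemma mul_conjK x : x * conjK x = ofR (normsq x).
Proof.
move: x; rewrite /normsq /conjK /ofR /coordK; case: K => /= x.
- by rewrite big_ord1 expr2.
- rewrite !big_ord_recl big_ord0 addr0 /=; case: x => a b.
  by apply/eqP; rewrite eq_complex /=; apply/andP; split; apply/eqP; ring.
- rewrite !big_ord_recl big_ord0 addr0 /=; case: x => a b c d.
  by rewrite mulq_Quat; congr Quat; rewrite /coords_of_quat /=; ring.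
Qed.

Lemma coordKD x y i : coordK (x + y) i = coordK x i + coordK y i.
Proof.
move: x y i; rewrite /coordK; case: K => //= x y i.
  by case: x y => ?? [] ??; case: ifP.
by case: x y i => [????] [????] [[|[|[|[|]]]] ?].
Qed.

Lemma coordKZ a x i : coordK (ofR a * x) i = a * coordK x i.
Proof.
move: x i; rewrite /coordK /ofR; case: K => //= x i.
  by case: x => ??; case: ifP => _ /=; ring.
by case: x i => [????] [[|[|[|[|]]]] ?] //=; rewrite mulq_Quat /coords_of_quat /=; ring.
Qed.

Lemma of_coordsK (f : 'I_(rdim K) -> R) i : coordK (of_coords f) i = f i.
Proof.
move: f i; rewrite /coordK /of_coords; case: K => /= f i.
- by rewrite (ord1 i).
- by case: i => [[|[|]] ?] //=; congr f; exact: val_inj.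
- by case: i => [[|[|[|[|]]]] ?] //=; rewrite /coords_of_quat /=; congr f; exact: val_inj.
Qed.

Lemma coordKK x : of_coords (coordK x) = x.
Proof.
move: x; rewrite /coordK /of_coords; case: K => //= x; first by case: x.
by case: x.
Qed.

Lemma normsq_ge0 x : 0 <= normsq x.
Proof. by apply: sumr_ge0 => i _; exact: sqr_ge0. Qed.

Lemma normsqZ a x : normsq (ofR a * x) = a ^+ 2 * normsq x.
Proof.
by rewrite /normsq mulr_sumr; apply: eq_bigr => i _; rewrite coordKZ exprMn.
Qed.

Lemma normsq_eq0 x : normsq x = 0 -> x = 0.
Proof.
move=> /eqP; rewrite psumr_eq0; last by move=> i _; exact: sqr_ge0.
move=> /allP h; rewrite -(coordKK x) -(coordKK 0); congr of_coords.
apply/funext => i; have := h i; rewrite mem_index_enum => /(_ isT) /=.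
rewrite sqrf_eq0 => /eqP ->.
by rewrite -(mulr0 (ofR 0)) coordKZ mul0r.
Qed.

Local Notation adj := (@adjointmx R K _ _).

Lemma adjE m n (A : 'M[S]_(m, n)) i j : adj A i j = conjK (A j i).
Proof. by rewrite !mxE. Qed.

Lemma adjK m n (A : 'M[S]_(m, n)) : adj (adj A) = A.
Proof. by apply/matrixP => i j; rewrite !adjE conjKK. Qed.

Lemma adjD m n (A B : 'M[S]_(m, n)) : adj (A + B) = adj A + adj B.
Proof. by apply/matrixP => i j; rewrite !mxE conjKD. Qed.

Lemma adj0 m n : adj (0 : 'M[S]_(m, n)) = 0.
Proof. by apply/matrixP => i j; rewrite !mxE conjK0. Qed.

Lemma adjN m n (A : 'M[S]_(m, n)) : adj (- A) = - adj A.
Proof. by apply: (addrI (adj A)); rewrite -adjD !subrr adj0. Qed.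

Lemma adjB m n (A B : 'M[S]_(m, n)) : adj (A - B) = adj A - adj B.
Proof. by rewrite adjD adjN. Qed.

Lemma adjM m n p (A : 'M[S]_(m, n)) (B : 'M[S]_(n, p)) :
  adj (A *m B) = adj B *m adj A.
Proof.
apply/matrixP => i j; rewrite !mxE conjK_sum; apply: eq_bigr => k _.
by rewrite !adjE conjKM.
Qed.

Lemma adj_scalar n a : adj ((ofR a)%:M : 'M[S]_n) = (ofR a)%:M.
Proof.
apply/matrixP => i j; rewrite !mxE eq_sym; case: eqP => _.
  by rewrite !mulr1n conj_ofR.
by rewrite !mulr0n conjK0.
Qed.

Lemma adj1 n : adj (1%:M : 'M[S]_n) = 1%:M.
Proof. by rewrite -ofR1 adj_scalar. Qed.

Lemma adj_col_mx m1 m2 n (A : 'M[S]_(m1, n)) (B : 'M[S]_(m2, n)) :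
  adj (col_mx A B) = row_mx (adj A) (adj B).
Proof. by rewrite /adjointmx tr_col_mx map_row_mx. Qed.

Lemma mul_adj_col_mx k m1 m2 n (v : 'M[S]_(k, n)) (A : 'M[S]_(m1, n)) (B : 'M[S]_(m2, n)) :
  v *m adj (col_mx A B) = row_mx (v *m adj A) (v *m adj B).
Proof. by rewrite adj_col_mx mul_mx_row. Qed.

Lemma adj_row_mx m n1 n2 (A : 'M[S]_(m, n1)) (B : 'M[S]_(m, n2)) :
  adj (row_mx A B) = col_mx (adj A) (adj B).
Proof. by rewrite /adjointmx tr_row_mx map_col_mx. Qed.

Lemma adj_block_mx m1 m2 n1 n2 (A : 'M[S]_(m1, n1)) (B : 'M[S]_(m1, n2))
    (C : 'M[S]_(m2, n1)) (D : 'M[S]_(m2, n2)) :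
  adj (block_mx A B C D) = block_mx (adj A) (adj C) (adj B) (adj D).
Proof. by rewrite /adjointmx tr_block_mx map_block_mx. Qed.

Definition row_normsq n (v : 'rV[S]_n) : R := \sum_j normsq (v 0 j).

Lemma row_normsqE n (v : 'rV[S]_n) : v *m adj v = (ofR (row_normsq v))%:M.
Proof.
apply/matrixP => i j; rewrite !ord1 !mxE eqxx mulr1n /row_normsq.
rewrite (big_morph _ ofRD ofR0); apply: eq_bigr => k _.
by rewrite adjE mul_conjK.
Qed.

Lemma row_normsq_eq0 n (v : 'rV[S]_n) : row_normsq v = 0 -> v = 0.
Proof.
move=> /eqP; rewrite psumr_eq0; last by move=> i _; exact: normsq_ge0.
move=> /allP h; apply/rowP => j; rewrite mxE.
by have := h j; rewrite mem_index_enum => /(_ isT) /eqP /normsq_eq0.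
Qed.

(** Gram-Schmidt, with coefficients acting on the left. When the first row of
    [M] lies in the span of the others, its residual [y] is 0, and so is
    the inverse of its squared length, so that no case distinction on the
    independence of the rows is made. *)
Lemma row_projection p q (M : 'M[S]_(p, q)) (v : 'rV[S]_q) :
  exists c : 'rV[S]_p, (v - c *m M) *m adj M = 0.
Proof.
elim: p M v => [|p IH] M v.
  by exists 0; apply/matrixP => i [].
rewrite -[M](@vsubmxK _ 1 p); set w := usubmx _; set M0 := dsubmx _.
have [c0 c0P] := IH M0 w; have [c1 c1P] := IH M0 v.
pose y := w - c0 *m M0; pose v1 := v - c1 *m M0.
pose al := v1 *m adj y *m (ofR (row_normsq y)^-1)%:M.
pose v2 := v1 - al *m y.
have v2y : v2 *m adj y = 0.
  rewrite mulmxBl -mulmxA row_normsqE -mulmxA -scalar_mxM -ofRM.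
  have [/eqP|y0] := eqVneq (row_normsq y) 0.
    by move=> /eqP /row_normsq_eq0 ->; rewrite adj0 !mulmx0 mul0mx subrr.
  by rewrite mulVf// ofR1 mulmx1 subrr.
have v2M : v2 *m adj M0 = 0 by rewrite mulmxBl c1P -mulmxA c0P mulmx0 subrr.
exists (row_mx al (c1 - al *m c0)).
have -> : v - row_mx al (c1 - al *m c0) *m col_mx w M0 = v2.
  rewrite mul_row_col mulmxBl /v2 /v1 /y mulmxBr -!mulmxA !opprD !opprK.
  by rewrite !addrA; congr (_ + _); rewrite addrAC.
rewrite (_ : v2 *m _ = row_mx (v2 *m adj w) (v2 *m adj M0)); last first.
  exact: mul_adj_col_mx.
rewrite v2M.
have -> : w = y + c0 *m M0 by rewrite subrK.
by rewrite adjD adjM mulmxDr v2y mulmxA v2M mul0mx addr0 row_mx0.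
Qed.

End ScalarAlgebra.

Arguments ofR : simpl never.

Section QuaternionDeterminant.
Variable R : realType.
Local Notation H := (quaternion R).

Let qcol m (X : 'M[R]_(m, 4)) : 'cV[H]_m := \col_i quat_of_coords (X i).

Lemma quat_of_coordsK (x : H) : quat_of_coords (coords_of_quat x) = x.
Proof. by case: x. Qed.

Lemma real_operator_qcol m (A : 'M[H]_m) (X : 'M[R]_(m, 4)) :
  qcol (real_operator A X) = A *m qcol X.
Proof.
apply/matrixP => i j; rewrite (ord1 j) !mxE -[RHS]quat_of_coordsK.
by congr quat_of_coords; apply/funext => c; rewrite !mxE.
Qed.

Lemma qcol_inj m : injective (@qcol m).
Proof.
move=> X Y /matrixP XY; apply/matrixP => i j.
have := XY i 0; rewrite !mxE /quat_of_coords => -[h0 h1 h2 h3].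
case: j => [[|[|[|[|]]]] lj] //.
- by rewrite (_ : Ordinal lj = 0)//; exact: val_inj.
- by rewrite (_ : Ordinal lj = 1)//; exact: val_inj.
- by rewrite (_ : Ordinal lj = 2%:R)//; exact: val_inj.
- by rewrite (_ : Ordinal lj = 3%:R)//; exact: val_inj.
Qed.

Lemma qcol_linear m (a : R) (X Y : 'M[R]_(m, 4)) :
  qcol (a *: X + Y) = (@ofR R Quaternions a)%:M *m qcol X + qcol Y.
Proof.
rewrite mul_scalar_mx; apply/matrixP => i j; rewrite !mxE /quat_of_coords mulq_Quat.
by rewrite addq_Quat !mxE; congr Quat; ring.
Qed.

Lemma real_operator_is_linear m (A : 'M[H]_m) : linear (real_operator A).
Proof.
move=> a X Y; apply: qcol_inj; rewrite qcol_linear !real_operator_qcol qcol_linear.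
rewrite mulmxDr !mulmxA; congr (_ *m _ + _).
apply/matrixP => i j; rewrite mul_scalar_mx !mxE (bigD1 j)//= big1 => [|k kj].
  by rewrite !mxE eqxx mulr1n addr0; exact: esym (@ofR_comm R Quaternions a (A i j)).
by rewrite mxE (negPf kj) mulr0n mulr0.
Qed.

HB.instance Definition _ m (A : 'M[H]_m) :=
  GRing.isLinear.Build R 'M[R]_(m, 4) 'M[R]_(m, 4) _ (real_operator A)
    (@real_operator_is_linear m A).

Definition rdetq m (A : 'M[H]_m) : R := \det (lin_mx (real_operator A)).

Lemma rdetqM m (A B : 'M[H]_m) : rdetq (A *m B) = rdetq A * rdetq B.
Proof.
(* [lin_mx] acts on row vectors, which reverses the order of the factors. *)
rewrite /rdetq mulrC -det_mulmx; congr (\det _).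
apply/row_matrixP => i; rewrite !rowE mulmxA -[delta_mx _ _]vec_mxK !mul_vec_lin.
congr mxvec; apply: qcol_inj.
by rewrite !real_operator_qcol mulmxA.
Qed.

Lemma rdetq1 m : rdetq (1%:M : 'M[H]_m) = 1.
Proof.
rewrite /rdetq -[RHS](det1 _ (m * 4)); congr (\det _).
apply/row_matrixP => i; rewrite !rowE -[delta_mx _ _]vec_mxK mul_vec_lin mulmx1.
by congr mxvec; apply: qcol_inj; rewrite real_operator_qcol mul1mx.
Qed.

(** [A] is conjugate to its own square, so the nonzero number [rdetq A] is equal
    to its square. This computes the determinant of a unipotent matrix from
    multiplicativity alone. *)
Lemma rdetq_sqr_conj m (A A' D D' : 'M[H]_m) :
  A *m A' = 1%:M -> D *m D' = 1%:M -> A *m A = D *m A *m D' -> rdetq A = 1.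
Proof.
move=> AA DD E; have An0 : rdetq A != 0.
  by apply/eqP => A0; have := rdetq1 m; rewrite -AA rdetqM A0 mul0r => /eqP;
    rewrite eq_sym oner_eq0.
apply: (mulfI An0); rewrite mulr1 -rdetqM E !rdetqM mulrAC -rdetqM DD rdetq1.
by rewrite mul1r.
Qed.

(** Conjugating by diag(1, 2) doubles the corner [c], and so does squaring. *)
Lemma rdetq_lower m n (c : 'M[H]_(n, m)) : rdetq (block_mx 1%:M 0 c 1%:M) = 1.
Proof.
pose h : R := 2^-1.
have h2 : h *+ 2 = 1 by rewrite -[h *+ 2]mulr_natr mulVf.
apply: (@rdetq_sqr_conj _ _ (block_mx 1%:M 0 (- c) 1%:M)
  (block_mx 1%:M 0 0 (2%:R)%:M)
  (block_mx 1%:M 0 0 ((@ofR R Quaternions h)%:M))).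
- rewrite mulmx_block !mulmx1 !mul1mx !mul0mx !mulmx0 !addr0 !add0r subrr.
  by rewrite -scalar_mx_block.
- rewrite mulmx_block !mulmx1 !mul1mx !mul0mx !mulmx0 !addr0 !add0r.
  rewrite -scalar_mxM (_ : 2%:R * _ = 1) -?scalar_mx_block//.
  by rewrite mulr_natl -[RHS](@ofR1 R Quaternions) -h2 mulr2n [in RHS]mulr2n ofRD.
- rewrite !mulmx_block !mulmx1 !mul1mx !mul0mx !mulmx0 !addr0 !add0r.
  congr block_mx; rewrite ?mul0mx//; first by rewrite mul_scalar_mx scaler_nat mulr2n.
  rewrite -scalar_mxM (_ : 2%:R * _ = 1)//.
  by rewrite mulr_natl -[RHS](@ofR1 R Quaternions) -h2 mulr2n [in RHS]mulr2n ofRD.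
Qed.

Lemma rdetq_upper m n (c : 'M[H]_(m, n)) : rdetq (block_mx 1%:M c 0 1%:M) = 1.
Proof.
pose h : R := 2^-1.
have h2 : h *+ 2 = 1 by rewrite -[h *+ 2]mulr_natr mulVf.
have hh : 2%:R * @ofR R Quaternions h = 1.
  by rewrite mulr_natl -[RHS](@ofR1 R Quaternions) -h2 mulr2n [in RHS]mulr2n ofRD.
apply: (@rdetq_sqr_conj _ _ (block_mx 1%:M (- c) 0 1%:M)
  (block_mx (2%:R)%:M 0 0 1%:M)
  (block_mx ((@ofR R Quaternions h)%:M) 0 0 1%:M)).
- rewrite mulmx_block !mulmx1 !mul1mx !mul0mx !mulmx0 !addr0 !add0r addNr.
  by rewrite -scalar_mx_block.
- rewrite mulmx_block !mulmx1 !mul1mx !mul0mx !mulmx0 !addr0 !add0r.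
  by rewrite -scalar_mxM hh -scalar_mx_block.
- rewrite !mulmx_block !mulmx1 !mul1mx !mul0mx !mulmx0 !addr0 !add0r.
  congr block_mx; rewrite ?mul0mx//; first by rewrite -scalar_mxM hh.
  by rewrite mul_scalar_mx scaler_nat mulr2n.
Qed.

(** [N1] and [N2] are kept apart because they will be (m * 4 + 1 * 4) and
    ((m + 1) * 4), which are equal but not convertible. *)
Lemma det_similar (F : comNzRingType) (N1 N2 : nat) (P : 'M[F]_(N1, N2)) (Q : 'M[F]_(N2, N1))
  (B : 'M[F]_N1) : N1 = N2 -> P *m Q = 1%:M -> \det (Q *m B *m P) = \det B.
Proof.
move=> e; case: _ / e P Q => P Q PQ.
by rewrite !det_mulmx mulrAC -det_mulmx mulmx1C// det1 mul1r.
Qed.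

(** The change of coordinates of R^(4(m+1)) that separates the real coordinates
    of the last quaternion from those of the first m. *)
Definition split4 m (u : 'rV[R]_((m + 1) * 4)) : 'rV[R]_(m * 4 + 1 * 4) :=
  row_mx (mxvec (usubmx (vec_mx u))) (mxvec (dsubmx (vec_mx u))).

Definition merge4 m (u : 'rV[R]_(m * 4 + 1 * 4)) : 'rV[R]_((m + 1) * 4) :=
  mxvec (col_mx (vec_mx (lsubmx u)) (vec_mx (rsubmx u))).

Lemma split4_is_linear m : linear (@split4 m).
Proof.
by move=> a u v; rewrite /split4 scale_row_mx add_row_mx !linearP.
Qed.

Lemma merge4_is_linear m : linear (@merge4 m).
Proof.
move=> a u v; rewrite /merge4 -linearP scale_col_mx add_col_mx.
by congr mxvec; rewrite !linearP.
Qed.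

HB.instance Definition _ m := GRing.isLinear.Build R _ _ _ (@split4 m)
  (@split4_is_linear m).
HB.instance Definition _ m := GRing.isLinear.Build R _ _ _ (@merge4 m)
  (@merge4_is_linear m).

(** In the coordinates of [split4] the real operator is block diagonal, with
    [d] times the identity of R^4 as second block. *)
Lemma rdetq_block m (A : 'M[H]_m) (d : R) :
  rdetq (block_mx A 0 0 ((@ofR R Quaternions d)%:M : 'M[H]_1)) = rdetq A * d ^+ 4.
Proof.
pose B := block_mx (lin_mx (real_operator A)) 0 0 (d%:M : 'M[R]_(1 * 4)).
have -> : rdetq A * d ^+ 4 = \det B by rewrite det_ublock det_scalar.
have e : (m * 4 + 1 * 4 = (m + 1) * 4)%N by rewrite mulnDl.
rewrite -(@det_similar _ _ _ (lin1_mx (@merge4 m)) (lin1_mx (@split4 m)) B e); last first.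
  apply/row_matrixP => i; rewrite !rowE mulmxA !mul_rV_lin1 mulmx1 /=.
  by rewrite /split4 /merge4 mxvecK col_mxKu col_mxKd !vec_mxK hsubmxK.
rewrite /rdetq; congr (\det _); apply/row_matrixP => i; rewrite !rowE.
set u := delta_mx 0 i; have uE : u = mxvec (vec_mx u : 'M[R]_(m + 1, 4)) by rewrite vec_mxK.
rewrite [in LHS]uE mul_vec_lin /= !mulmxA mul_rV_lin1 /= mul_rV_lin1 /=.
rewrite /split4 mul_row_block !mulmx0 addr0 add0r mul_vec_lin mul_mx_scalar.
rewrite /merge4 row_mxKl row_mxKr linearZ /= !mxvecK.
congr mxvec; apply: qcol_inj; rewrite real_operator_qcol.
set X := vec_mx u.
have qcol_col (X1 : 'M[R]_(m, 4)) (X2 : 'M[R]_(1, 4)) :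
    qcol (col_mx X1 X2) = col_mx (qcol X1) (qcol X2).
  apply/matrixP => k l; rewrite -(splitK k) [LHS]mxE.
  case: (fintype.split k) => k' /=; rewrite ?col_mxEu ?col_mxEd mxE;
    congr quat_of_coords; apply/funext => c; by rewrite ?col_mxEu ?col_mxEd.
have XE : X = col_mx (usubmx X) (dsubmx X) by rewrite vsubmxK.
rewrite [in LHS]XE !qcol_col mul_block_col !mul0mx addr0 add0r.
rewrite real_operator_qcol; congr col_mx.
have := qcol_linear d (dsubmx X) 0.
rewrite addr0 => ->; rewrite -[LHS]addr0; congr (_ + _).
by apply/matrixP => k l; rewrite !mxE /quat_of_coords !mxE.
Qed.

End QuaternionDeterminant.

Section GramDeterminant.
Variables (R : realType) (K : scalars).
Local Notation S := (carrier R K).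
Local Notation adj := (@adjointmx R K _ _).
Local Notation ofR := (@ofR R K).
Local Notation normsq := (@normsq R K).
Implicit Types (m n p q : nat).

(** Invariance under unipotent congruence (here and in [real_det_congr_upper])
    and multiplicativity for a real scalar block ([real_det_block]) are the
    properties of the determinant on which everything below rests. In this
    form they are common to the three scalar rings. *)
Lemma real_det_congr_lower m n (c : 'M[S]_(n, m)) (A : 'M[S]_(m + n)) :
  let L := block_mx 1%:M 0 c 1%:M in
  real_det (L *m A *m adj L) = real_det A.
Proof.
rewrite /= adj_block_mx !adj1 adj0; move: c A; rewrite /real_det.
case: K => /= c A.
- by rewrite !det_mulmx det_lblock det_ublock !det1 !mul1r !mulr1.
- by rewrite !det_mulmx det_lblock det_ublock !det1 !mul1r !mulr1.
- rewrite /det_quat -!/(rdetq _) !rdetqM rdetq_lower.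
  by rewrite (rdetq_upper (@adjointmx R Quaternions _ _ c)) mul1r mulr1.
Qed.

Lemma real_det_congr_upper m n (c : 'M[S]_(m, n)) (A : 'M[S]_(m + n)) :
  let L := block_mx 1%:M c 0 1%:M in
  real_det (L *m A *m adj L) = real_det A.
Proof.
rewrite /= adj_block_mx !adj1 adj0; move: c A; rewrite /real_det.
case: K => /= c A.
- by rewrite !det_mulmx det_lblock det_ublock !det1 !mul1r !mulr1.
- by rewrite !det_mulmx det_lblock det_ublock !det1 !mul1r !mulr1.
- rewrite /det_quat -!/(rdetq _) !rdetqM rdetq_upper.
  by rewrite (rdetq_lower (@adjointmx R Quaternions _ _ c)) mul1r mulr1.
Qed.

Lemma real_det_block m (A : 'M[S]_m) (d : R) : 0 <= d ->
  real_det (block_mx A 0 0 ((ofR d)%:M : 'M[S]_1)) = real_det A * d.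
Proof.
move=> d0; move: A; rewrite /real_det; case: K => /= A.
- by rewrite det_ublock det_scalar1.
- by rewrite det_ublock det_scalar1; case: (\det A) => a b /=; rewrite mulr0 subr0.
- rewrite /det_quat -!/(rdetq _) rdetq_block mulrC.
  rewrite (_ : d ^+ 4 = (d ^+ 2) ^+ 2); last by rewrite -exprM.
  by rewrite sqrtrM ?sqr_ge0// sqrtr_sqr (ger0_norm (sqr_ge0 d)) sqrtrM ?sqr_ge0//
    sqrtr_sqr ger0_norm// mulrC.
Qed.

Lemma real_det0 (A : 'M[S]_0) : real_det A = 1.
Proof.
move: A; rewrite /real_det; case: K => /= A; rewrite ?det_mx00//.
by rewrite /det_quat det_mx00 !sqrtr1.
Qed.

Definition gram m n (M : 'M[S]_(m, n)) : R := real_det (M *m adj M).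

(** Subtracting from [v] its projection is a unipotent congruence of the Gram
    matrix, and orthogonality makes the result block diagonal. *)
Lemma gram_col_residual p q (M : 'M[S]_(p, q)) (v : 'rV[S]_q) (c : 'rV[S]_p) :
  (v - c *m M) *m adj M = 0 ->
  gram (col_mx M v) = gram M * row_normsq (v - c *m M).
Proof.
move=> yM; set y := v - _ in yM *.
rewrite /gram -(real_det_congr_lower (- c)) /=.
set L := block_mx _ _ _ _.
have -> : L *m (col_mx M v *m adj (col_mx M v)) *m adj L =
    (L *m col_mx M v) *m adj (L *m col_mx M v) by rewrite adjM !mulmxA.
have -> : L *m col_mx M v = col_mx M y.
  by rewrite mul_block_col !mul1mx mul0mx addr0 mulNmx addrC.
rewrite adj_col_mx mul_col_row row_normsqE yM.
have -> : M *m adj y = 0 by rewrite -[LHS]adjK adjM adjK yM adj0.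
by rewrite real_det_block// sumr_ge0// => j _; exact: normsq_ge0.
Qed.

(** Subtracting multiples of the last row (0, 1) from the others clears [x]. *)
Lemma gram_block_unit p q (M : 'M[S]_(p, q)) (x : 'cV[S]_p) :
  gram (block_mx M x 0 1%:M) = gram M.
Proof.
rewrite /gram -(real_det_congr_upper (- x)) /=.
set L := block_mx 1%:M _ _ _; set B := block_mx M _ _ _.
have -> : L *m (B *m adj B) *m adj L = (L *m B) *m adj (L *m B) by rewrite adjM !mulmxA.
have -> : L *m B = block_mx M 0 0 1%:M.
  by rewrite mulmx_block !mul1mx !mul0mx !mulmx1 !mulmx0 subrr !addr0 add0r.
rewrite adj_block_mx !adj0 adj1 mulmx_block !mulmx0 !mul0mx mulmx1 !addr0 add0r.
by rewrite -(@ofR1 R K) real_det_block// mulr1.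
Qed.

(** Let [y] be the residual of [v] against the rows of [M], and [f] the residual
    of the last basis vector against the rows of [A = row_mx M x]. Then the
    residual of the row (v, z) against [A] is the orthogonal sum of (y, 0) and
    [xi *: f], where [xi] is [z] minus a quantity independent of it; and
    [gram A * row_normsq f = gram M] by [gram_block_unit]. It remains to
    expand the squared length of the sum. *)
Lemma gram_block p q (M : 'M[S]_(p, q)) (v : 'rV[S]_q) (x : 'cV[S]_p) :
  exists r : S, forall z : S,
    gram (block_mx M x v (z%:M : 'M[S]_1)) * gram M =
    gram (col_mx M v) * gram (row_mx M x) + normsq (ofR (gram M) * z + r).
Proof.
have [c yM] := row_projection M v; set y := v - _ in yM.
pose A := row_mx M x; pose e := row_mx (0 : 'rV[S]_q) (1%:M : 'M[S]_1).
have [b fA] := row_projection A e; set f := e - _ in fA.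
exists (- (ofR (gram M) * (c *m x) 0 0)) => z.
have AE : gram A * row_normsq f = gram M.
  by rewrite -(gram_col_residual fA) -(gram_block_unit M x) /A /e /block_mx.
pose xi : S := z - (c *m x) 0 0.
have -> : ofR (gram M) * z - ofR (gram M) * (c *m x) 0 0 = ofR (gram M) * xi.
  by rewrite -mulrBr.
pose y0 := row_mx y (0 : 'M[S]_1).
have y0A : y0 *m adj A = 0 by rewrite /y0 adj_row_mx mul_row_col yM mul0mx addr0.
have y0f : y0 *m adj f = 0.
  rewrite /f adjB mulmxBr adjM mulmxA y0A mul0mx subr0.
  by rewrite /y0 /e adj_row_mx mul_row_col adj0 mulmx0 mul0mx addr0.
have fy0 : f *m adj y0 = 0 by rewrite -[LHS]adjK adjM adjK y0f adj0.
have YE : row_mx v (z%:M : 'M[S]_1) - (c + xi%:M *m b) *m A = y0 + xi%:M *m f.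
  rewrite mulmxDl opprD addrA /f mulmxBr mulmxA addrA; congr (_ - _).
  rewrite /A /e /y0 mul_mx_row mul_mx_row mulmx0 mulmx1 opp_row_mx !add_row_mx.
  rewrite addr0 add0r; congr row_mx.
  by rewrite [c *m x]mx11_scalar -raddfB.
have YA : (row_mx v (z%:M : 'M[S]_1) - (c + xi%:M *m b) *m A) *m adj A = 0.
  by rewrite YE mulmxDl y0A -mulmxA fA mulmx0 addr0.
have := gram_col_residual YA; rewrite /A -/(block_mx M x v (z%:M : 'M[S]_1)) -/A => ->.
have nY : row_normsq (row_mx v (z%:M : 'M[S]_1) - (c + xi%:M *m b) *m A) =
  row_normsq y + normsq xi * row_normsq f.
  apply: (@ofR_inj R K).
  have E : (ofR (row_normsq (y0 + xi%:M *m f)))%:M =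
    (ofR (row_normsq y + normsq xi * row_normsq f))%:M :> 'M[S]_1.
    clear YE YA AE; clearbody f.
    have y0g : y0 *m adj (xi%:M *m f) = 0 by rewrite adjM mulmxA y0f mul0mx.
    have gy0 : (xi%:M *m f) *m adj y0 = 0 by rewrite -mulmxA fy0 mulmx0.
    rewrite -row_normsqE adjD mulmxDl !mulmxDr y0g gy0 addr0 add0r adjM mulmxA.
    have y0y : (ofR (row_normsq y0))%:M = (ofR (row_normsq y))%:M :> 'M[S]_1.
      by rewrite -!row_normsqE /y0 adj_row_mx mul_row_col mul0mx addr0.
    rewrite row_normsqE y0y -[_ *m f *m _]mulmxA row_normsqE.
    apply/matrixP => i j; rewrite !ord1 mul_scalar_mx !mxE eqxx !mulr1n big_ord1.
    rewrite !mxE eqxx !mulr1n -ofR_comm -mulrA mul_conjK -ofRM -ofRD.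
    by rewrite [X in _ + X]mulrC.
  by move/matrixP: E => /(_ 0 0); rewrite !mxE eqxx !mulr1n YE.
rewrite nY (gram_col_residual yM) mulrDr mulrDl normsqZ -/y; congr (_ + _); first by ring.
by rewrite -AE; ring.
Qed.

End GramDeterminant.

(** * Corners of unitriangular matrices *)

Section Corners.
Variables (R : realType) (K : scalars).
Local Notation S := (carrier R K).
Local Notation ofR := (@ofR R K).
Local Notation coordK := (@coordK R K).
Local Notation normsq := (@normsq R K).
Implicit Types (Z : nat -> nat -> S) (p q : nat).

(** The matrix is a function on pairs of natural numbers, so that corners of all
    sizes, the empty ones included, are compared without casts. *)
Definition cornergram Z p q : R := gram (\matrix_(i < p, j < q) Z i j).

Definition unitriangular Z := forall i j, (j <= i)%N -> Z i j = (i == j)%:R.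

Lemma eq_cornergram Z Z' p q :
  (forall i j, (i < p)%N -> (j < q)%N -> Z i j = Z' i j) ->
  cornergram Z p q = cornergram Z' p q.
Proof.
by move=> E; rewrite /cornergram; congr gram; apply/matrixP => i j; rewrite !mxE E.
Qed.

Lemma cornergram0 Z q : cornergram Z 0 q = 1.
Proof. exact: real_det0. Qed.

Lemma corner_block Z p q :
  cornergram Z p.+1 q.+1 =
  gram (block_mx (\matrix_(i < p, j < q) Z i j) (\col_(i < p) Z i q)
                 (\row_(j < q) Z p j) (Z p q)%:M).
Proof.
rewrite /cornergram -addn1 -[q.+1]addn1; congr gram; apply/matrixP => i j.
rewrite mxE -(splitK i) -(splitK j).
case: (fintype.split i) => i'; case: (fintype.split j) => j' /=;
  rewrite ?block_mxEul ?block_mxEur ?block_mxEdl ?block_mxEdr !mxE ?ord1 ?addn0//.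
Qed.

Lemma corner_col Z p q :
  cornergram Z p.+1 q =
  gram (col_mx (\matrix_(i < p, j < q) Z i j) (\row_(j < q) Z p j)).
Proof.
rewrite /cornergram -addn1; congr gram; apply/matrixP => i j.
rewrite mxE -(splitK i); case: (fintype.split i) => i' /=;
  by rewrite ?col_mxEu ?col_mxEd !mxE ?ord1 ?addn0.
Qed.

Lemma corner_row Z p q :
  cornergram Z p q.+1 =
  gram (row_mx (\matrix_(i < p, j < q) Z i j) (\col_(i < p) Z i q)).
Proof.
rewrite /cornergram -[q.+1]addn1; congr gram; apply/matrixP => i j.
rewrite mxE -(splitK j); case: (fintype.split j) => j' /=;
  by rewrite ?row_mxEl ?row_mxEr !mxE ?ord1 ?addn0.
Qed.

Definition set_entry Z p q (z : S) i j := if (i == p) && (j == q) then z else Z i j.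

Lemma cornergram_set_entry Z p q :
  exists r : S, forall z : S,
    cornergram (set_entry Z p q z) p.+1 q.+1 * cornergram Z p q =
    cornergram Z p.+1 q * cornergram Z p q.+1 + normsq (ofR (cornergram Z p q) * z + r).
Proof.
have [r rP] := gram_block (\matrix_(i < p, j < q) Z i j) (\row_(j < q) Z p j)
  (\col_(i < p) Z i q).
exists r => z; rewrite (corner_block (set_entry Z p q z)) (corner_col Z p q) (corner_row Z p q).
apply: etrans (rP z); congr (_ * _).
congr (gram (block_mx _ _ _ _)).
- by apply/matrixP => i j; rewrite !mxE /set_entry (ltn_eqF (ltn_ord i)).
- by apply/matrixP => i j; rewrite !mxE /set_entry (ltn_eqF (ltn_ord i)).
- by apply/matrixP => i j; rewrite !mxE /set_entry (ltn_eqF (ltn_ord j)) andbF.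
- by rewrite /set_entry !eqxx.
Qed.

Lemma cornergram_diag Z p : unitriangular Z -> cornergram Z p p = 1.
Proof.
move=> uZ; elim: p => [|p IH]; first exact: cornergram0.
rewrite corner_block (_ : \row_j _ = 0) ?(uZ p p)// ?eqxx ?gram_block_unit//.
by apply/rowP => j; rewrite !mxE uZ ?gtn_eqF// ltnW.
Qed.

(** By induction on [p + q]: [cornergram_set_entry] writes the product of this
    determinant with a positive one as a positive number plus a square. *)
Lemma cornergram_gt0 Z p q : unitriangular Z -> (p <= q)%N -> 0 < cornergram Z p q.
Proof.
move=> uZ; have [d] := ubnP (p + q); elim: d p q => // d IH p q pqd pq.
case: p pqd pq => [|p] pqd pq; first by rewrite cornergram0.
case: q pqd pq => // q pqd; rewrite ltnS leq_eqVlt => /predU1P[<-|pq].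
  by rewrite cornergram_diag.
have pq0 : 0 < cornergram Z p q.
  by apply: IH; [move: pqd; rewrite addSn addnS !ltnS; exact: leqW|exact: ltnW].
have pq1 : 0 < cornergram Z p.+1 q.
  by apply: IH => //; move: pqd; rewrite addnS ltnS.
have pq2 : 0 < cornergram Z p q.+1.
  by apply: IH; [move: pqd; rewrite addSn ltnS|exact: leq_trans (ltnW pq) _].
have [r rP] := cornergram_set_entry Z p q.
have ZE : cornergram Z p.+1 q.+1 = cornergram (set_entry Z p q (Z p q)) p.+1 q.+1.
  by apply: eq_cornergram => i j _ _; rewrite /set_entry; case: ifP => // /andP[/eqP -> /eqP ->].
have := rP (Z p q); rewrite -ZE => E.
by rewrite -(pmulr_lgt0 _ pq0) E ltr_wpDr ?mulr_gt0// normsq_ge0.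
Qed.

Definition axisvec (a : R) (c : 'I_(rdim K)) : S :=
  of_coords (fun c' => if c' == c then a else 0).

(** Polarization: coordinate [c] of the shift [r] of [cornergram_set_entry],
    recovered from the two values of the determinant at plus and minus a unit
    vector. This formula makes [r] measurable in [Z] and shows on which
    entries it depends. *)
Definition cross Z p q (c : 'I_(rdim K)) : R :=
  (cornergram (set_entry Z p q (axisvec 1 c)) p.+1 q.+1 -
   cornergram (set_entry Z p q (axisvec (-1) c)) p.+1 q.+1) / 4.

Lemma cornergram_cross Z p q : 0 < cornergram Z p q ->
  cornergram Z p.+1 q.+1 * cornergram Z p q =
  cornergram Z p.+1 q * cornergram Z p q.+1 +
  \sum_c (cornergram Z p q * coordK (Z p q) c + cross Z p q c) ^+ 2.
Proof.
move=> g0; have [r rP] := cornergram_set_entry Z p q.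
set g := cornergram Z p q in g0 rP *.
have crossE c : cross Z p q c = coordK r c.
  have h a : cornergram (set_entry Z p q (axisvec a c)) p.+1 q.+1 * g =
      cornergram Z p.+1 q * cornergram Z p q.+1 +
      (\sum_(i | i != c) coordK r i ^+ 2 + (g * a + coordK r c) ^+ 2).
    rewrite rP; congr (_ + _); rewrite /normsq (bigD1 c)//= addrC; congr (_ + _).
      apply: eq_bigr => i ic; rewrite coordKD coordKZ of_coordsK (negPf ic).
      by rewrite mulr0 add0r.
    by rewrite coordKD coordKZ of_coordsK eqxx.
  apply: (mulIf (lt0r_neq0 g0)); by rewrite /cross mulrAC mulrBl !h; field.
have ZE : cornergram Z p.+1 q.+1 = cornergram (set_entry Z p q (Z p q)) p.+1 q.+1.
  by apply: eq_cornergram => i j _ _; rewrite /set_entry; case: ifP => // /andP[/eqP -> /eqP ->].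
rewrite ZE rP; congr (_ + _); rewrite /normsq; apply: eq_bigr => c _.
by rewrite coordKD coordKZ crossE.
Qed.

Lemma eq_cross Z Z' p q c :
  (forall i j, (i <= p)%N -> (j <= q)%N -> (i, j) != (p, q) -> Z i j = Z' i j) ->
  cross Z p q c = cross Z' p q c.
Proof.
move=> E; rewrite /cross; congr ((_ - _) / _); apply: eq_cornergram => i j ip jq;
  rewrite /set_entry; case: ifP => // /negbT ij; apply: E => //.
Qed.

End Corners.

Section MeasurableScalars.
Context d (T : measurableType d) (R : realType) (K : scalars).
Local Notation S := (carrier R K).
Local Notation coordK := (@coordK R K).

Definition kmeasurable (f : T -> S) :=
  forall c, measurable_fun setT (fun x => coordK (f x) c).

Lemma kmeasurable_cst (z : S) : kmeasurable (fun=> z).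
Proof. by move=> c; exact: measurable_cst. Qed.

Lemma kmeasurableD f g : kmeasurable f -> kmeasurable g ->
  kmeasurable (fun x => f x + g x).
Proof.
move=> mf mg c; rewrite (_ : (fun x => _) = (fun x => coordK (f x) c + coordK (g x) c)).
  exact: measurable_funD.
by apply/funext => x; rewrite coordKD.
Qed.

Lemma kmeasurable_sum (I : Type) (r : seq I) (P : pred I) (F : I -> T -> S) :
  (forall i, kmeasurable (F i)) ->
  kmeasurable (fun x => \sum_(i <- r | P i) F i x).
Proof.
move=> mF; elim: r => [|i r IH].
  rewrite (_ : (fun x => _) = fun=> 0); first exact: kmeasurable_cst.
  by apply/funext => x; rewrite big_nil.
rewrite (_ : (fun x => _) = (fun x =>
    (if P i then F i x else 0) + \sum_(j <- r | P j) F j x)); last first.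
  by apply/funext => x; rewrite big_cons; case: ifP; rewrite ?add0r.
apply: kmeasurableD => //; case: (P i) => //; exact: kmeasurable_cst.
Qed.

End MeasurableScalars.

Section MeasurableDeterminants.
Context d (T : measurableType d) (R : realType).

Lemma kmeasurableM K (f g : T -> carrier R K) : kmeasurable f -> kmeasurable g ->
  kmeasurable (fun x => f x * g x).
Proof.
case: K f g => f g mf mg c.
- by apply: measurable_funM; [exact: (mf 0)|exact: (mg 0)].
- have mfR := mf 0; have mfI := mf 1; have mgR := mg 0; have mgI := mg 1.
  have [mr mi] := @cmeasurableM _ _ _ setT f g (conj mfR mfI) (conj mgR mgI).
  by rewrite /coordK; case: (val c == 0%N).
- have mf0 := mf 0; have mf1 := mf 1; have mf2 := mf 2%:R; have mf3 := mf 3%:R.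
  have mg0 := mg 0; have mg1 := mg 1; have mg2 := mg 2%:R; have mg3 := mg 3%:R.
  case: c => [[|[|[|[|]]]] ?] //.
  + rewrite (_ : (fun x => _) = (fun x => qre (f x) * qre (g x) - qi (f x) * qi (g x)
      - qj (f x) * qj (g x) - qk (f x) * qk (g x))).
      by repeat (apply: measurable_funB || apply: measurable_funM || apply: measurable_funD).
    by apply/funext => x /=; case: (f x) (g x) => ???? [].
  + rewrite (_ : (fun x => _) = (fun x => qre (f x) * qi (g x) + qi (f x) * qre (g x)
      + qj (f x) * qk (g x) - qk (f x) * qj (g x))).
      by repeat (apply: measurable_funB || apply: measurable_funM || apply: measurable_funD).
    by apply/funext => x /=; case: (f x) (g x) => ???? [].
  + rewrite (_ : (fun x => _) = (fun x => qre (f x) * qj (g x) - qi (f x) * qk (g x)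
      + qj (f x) * qre (g x) + qk (f x) * qi (g x))).
      by repeat (apply: measurable_funB || apply: measurable_funM || apply: measurable_funD).
    by apply/funext => x /=; case: (f x) (g x) => ???? [].
  + rewrite (_ : (fun x => _) = (fun x => qre (f x) * qk (g x) + qi (f x) * qj (g x)
      - qj (f x) * qi (g x) + qk (f x) * qre (g x))).
      by repeat (apply: measurable_funB || apply: measurable_funM || apply: measurable_funD).
    by apply/funext => x /=; case: (f x) (g x) => ???? [].
Qed.

Lemma kmeasurable_conj K (f : T -> carrier R K) : kmeasurable f ->
  kmeasurable (fun x => conjK (f x)).
Proof.
case: K f => f mf c //.
- rewrite /coordK /conjK; case: (val c == 0%N).
    by have := mf 0; apply: eq_measurable_fun => x _ /=; case: (f x).
  have := measurable_funN (mf 1); apply: eq_measurable_fun => x _ /=.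
  by case: (f x).
- rewrite /coordK /conjK; case: c => [[|[|[|[|]]]] ?] //.
  + exact: (mf 0).
  + exact: (measurable_funN (mf 1)).
  + exact: (measurable_funN (mf 2%:R)).
  + exact: (measurable_funN (mf 3%:R)).
Qed.

Lemma measurable_det n (A : T -> 'M[R]_n) :
  (forall i j, measurable_fun setT (fun x => A x i j)) ->
  measurable_fun setT (fun x => \det (A x)).
Proof.
move=> mA; rewrite /determinant; apply: measurable_sum => s.
apply: measurable_funM => //; apply: measurable_prod => i _; exact: mA.
Qed.

Lemma measurable_real_det K n (A : T -> 'M[carrier R K]_n) :
  (forall i j, kmeasurable (fun x => A x i j)) ->
  measurable_fun setT (fun x => real_det (A x)).
Proof.
case: K A => A mA.
- by apply: measurable_det => i j; exact: (mA i j 0).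
- have mA' i j : cmeasurable setT (fun x => A x i j).
    by split; [exact: (mA i j 0)|exact: (mA i j 1)].
  have [+ _] : cmeasurable setT (fun x => \det (A x)).
    rewrite /determinant; apply: cmeasurable_sum => s _.
    apply: cmeasurableM; first exact: cmeasurable_cst.
    by apply: cmeasurable_prod => i _; exact: mA'.
  by [].
- have ms : measurable_fun setT (@Num.sqrt R).
    by apply: continuous_measurable_fun; exact: sqrt_continuous.
  rewrite /real_det /det_quat.
  apply: (measurableT_comp ms); apply: (measurableT_comp ms).
  apply: measurable_det => i j.
  case: (mxvec_indexP i) => i1 i2; case: (mxvec_indexP j) => j1 j2.
  rewrite (_ : (fun x => _) = (fun x => coordK (\sum_k A x j1 k *
    quat_of_coords (vec_mx (delta_mx 0 (mxvec_index i1 i2)) k)) j2)); last first.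
    apply/funext => x; rewrite mxE mxvecE mxE mxE; congr coords_of_quat.
    by apply: eq_bigr => k _; rewrite mxE.
  apply: (kmeasurable_sum (K := Quaternions)) => k; apply: kmeasurableM => //.
Qed.

Lemma measurable_cornergram K (Z : T -> nat -> nat -> carrier R K) p q :
  (forall i j, kmeasurable (fun x => Z x i j)) ->
  measurable_fun setT (fun x => cornergram (Z x) p q).
Proof.
move=> mZ; apply: measurable_real_det => i j.
rewrite (_ : (fun x => _) = (fun x => \sum_(k < q) Z x i k * conjK (Z x j k))); last first.
  by apply/funext => x; rewrite mxE; apply: eq_bigr => k _; rewrite !mxE.
by apply: kmeasurable_sum => k; apply: kmeasurableM => //; exact: kmeasurable_conj.
Qed.

Lemma measurable_cross K (Z : T -> nat -> nat -> carrier R K) p q c :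
  (forall i j, kmeasurable (fun x => Z x i j)) ->
  measurable_fun setT (fun x => cross (Z x) p q c).
Proof.
move=> mZ; apply: measurable_funM => //; apply: measurable_funB;
  apply: measurable_cornergram => i j; rewrite /set_entry; case: ((i == p) && (j == q)) => //;
  exact: kmeasurable_cst.
Qed.

End MeasurableDeterminants.

(** * Enumeration order and telescoping sums *)

Section EnumerationOrder.

Definition lex (T1 T2 : eqType) (r1 : rel T1) (r2 : rel T2) : rel (T1 * T2) :=
  fun u v => r1 u.1 v.1 || ((u.1 == v.1) && r2 u.2 v.2).

Lemma pairwise_lex_allpairs (T1 T2 : eqType) (r1 : rel T1) (r2 : rel T2)
    (s1 : seq T1) (s2 : seq T2) :
  pairwise r1 s1 -> pairwise r2 s2 ->
  pairwise (lex r1 r2) [seq (x, y) | x <- s1, y <- s2].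
Proof.
move=> p1 p2; elim: s1 p1 => //= x s1 IH /andP[xs1 p1].
rewrite pairwise_cat IH// andbT; apply/andP; split.
  apply/allrelP => u v /mapP[y ys ->] /allpairsP[[x' y'] /= [xs' ys' ->]].
  by rewrite /lex /= (allP xs1).
rewrite pairwise_map; apply: sub_pairwise p2 => y y' yy'.
by rewrite /relpre /lex /= eqxx yy' orbT.
Qed.

Lemma pairwise_enum_prod (T1 T2 : finType) (r1 : rel T1) (r2 : rel T2) :
  pairwise r1 (enum T1) -> pairwise r2 (enum T2) ->
  pairwise (lex r1 r2) (enum {: T1 * T2}).
Proof.
by move=> p1 p2; rewrite enumT unlock; exact: pairwise_lex_allpairs.
Qed.

Lemma pairwise_enum_sig (T : finType) (P : pred T) (r : rel T) :
  pairwise r (enum T) -> pairwise (relpre val r) (enum {: {x | P x}}).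
Proof.
move=> p; rewrite -pairwise_map enumT unlock /=.
rewrite (pmap_filter (insubK _)); apply: pairwise_filter.
by rewrite -enumT.
Qed.

Lemma pairwise_enum_ord n : pairwise (relpre val ltn) (enum 'I_n).
Proof.
rewrite -pairwise_map val_enum_ord -sorted_pairwise; last exact: ltn_trans.
exact: iota_ltn_sorted.
Qed.

(** An enumeration sorted by [r] places [x] before [y] as soon as [r x y]. *)
Lemma enum_rank_lt (T : finType) (r : rel T) (x y : T) :
  (forall a b, r a b -> ~~ r b a) -> pairwise r (enum T) ->
  r x y -> (enum_rank x < enum_rank y)%N.
Proof.
move=> asym p rxy; rewrite ltnNge leq_eqVlt; apply/negP => /orP[/eqP/ord_inj/enum_rank_inj xy|yx].
  by have := asym _ _ rxy; rewrite -xy in rxy *; rewrite rxy.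
have := asym _ _ rxy; rewrite -(enum_rankK x) -(enum_rankK y).
rewrite !(enum_val_nth x) => /negP; apply.
apply: (pairwiseP x p) => //; rewrite inE -cardE; exact: ltn_ord.
Qed.

Lemma lex_asym (T1 T2 : eqType) (r1 : rel T1) (r2 : rel T2) :
  (forall a b, r1 a b -> ~~ r1 b a) -> (forall a b, r2 a b -> ~~ r2 b a) ->
  forall u v, lex r1 r2 u v -> ~~ lex r1 r2 v u.
Proof.
move=> a1 a2 [x y] [x' y']; rewrite /lex /= negb_or negb_and.
case/orP => [r|/andP[/eqP -> r]].
  rewrite a1//=; apply/orP; left; apply/eqP => xx.
  by have := a1 _ _ r; rewrite xx; move: r; rewrite xx => ->.
rewrite (a2 _ _ r) orbT andbT; apply/negP => h.
by have := a1 _ _ h; rewrite h.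
Qed.

(** Row first, then column, then real coordinate: this is the order in which
    the points of [uspace] list their coordinates, and the corner to the upper
    left of an entry precedes that entry. *)
Definition ulex n K : rel (ucoord K n) :=
  lex (relpre val (lex (relpre val ltn) (relpre val ltn))) (relpre val ltn).

Lemma ucoord_rank_lt n K (u v : ucoord K n) : ulex u v ->
  (enum_rank u < enum_rank v)%N.
Proof.
apply: enum_rank_lt.
  have ltn_asym n' (a b : 'I_n') : relpre val ltn a b -> ~~ relpre val ltn b a.
    by rewrite /= -leqNgt; exact: ltnW.
  apply: lex_asym; last exact: ltn_asym.
  move=> a b; apply: lex_asym; exact: ltn_asym.
apply: pairwise_enum_prod; last exact: pairwise_enum_ord.
apply: pairwise_enum_sig; apply: pairwise_enum_prod; exact: pairwise_enum_ord.
Qed.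

End EnumerationOrder.

Section LogarithmicSums.
Variable (R : comPzRingType) (L : nat -> nat -> R).
Hypotheses (L0 : forall m, L 0%N m = 0) (Ld : forall m, L m m = 0).

Let ell k m := L k.+1 m.+1 + L k m - L k.+1 m - L k m.+1.

(** [ell] is the mixed second difference of [L]; over the rectangle it telescopes
    in both directions, and [L] vanishes at the lower ends of both sums. *)
Lemma corner_log_sum p q : (p <= q)%N ->
  L p q = \sum_(p <= m < q) \sum_(0 <= k < p) ell k m.
Proof.
move=> pq; have E m : \sum_(0 <= k < p) ell k m = L p m.+1 - L p m.
  have -> : L p m.+1 - L p m = (L p m.+1 - L p m) - (L 0%N m.+1 - L 0%N m) by rewrite !L0; ring.
  rewrite -(telescope_sumr (fun k => L k m.+1 - L k m) (leq0n p)).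
  by apply: eq_bigr => k _; rewrite /ell; ring.
under eq_bigr do rewrite E.
by rewrite telescope_sumr// Ld subr0.
Qed.

(** The Jacobian of the triangular coordinates comes as the left-hand side;
    the weights [m - k - 1] on the right become the term -(q - p - 1) kappa / 2
    of [nu]. *)
Lemma jacobian_log_sum m :
  \sum_(0 <= k < m) (L k.+1 m + L k m.+1 - L k m *+ 2) =
  \sum_(0 <= k < m) ell k m *+ (m - k - 1).
Proof.
apply/eqP; rewrite -subr_eq0 -sumrB.
(* The difference of the two sides telescopes along A. *)
pose A k := L k m.+1 *+ (m - k) - L k m *+ (m - k).+1.
have -> : \sum_(0 <= k < m) (L k.+1 m + L k m.+1 - L k m *+ 2 - ell k m *+ (m - k - 1)) =
    - \sum_(0 <= k < m) (A k.+1 - A k).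
  rewrite -sumrN; apply: eq_big_nat => k /andP[_ km].
  have -> : (m - k - 1 = m - k.+1)%N by rewrite -subnDA addn1.
  have mk : (m - k = (m - k.+1).+1)%N by rewrite subnS prednK// subn_gt0.
  rewrite /A /ell mk; set d := (m - k.+1)%N.
  ring.
by rewrite telescope_sumr// /A subnn !L0 Ld !mul0rn !subr0 ?mulr0n ?subr0 ?oppr0 eqxx.
Qed.

End LogarithmicSums.

(** * Triangular coordinates on unitriangular matrices *)

Section Coordinates.
Variables (R : realType) (K : scalars) (n : nat).
Local Notation S := (carrier R K).
Local Notation mR := (measurableTypeR R).
Local Notation coords := (uspace R K n).
Local Notation UC := (ucoord K n).
Implicit Types (x : coords) (u : UC).

Definition zentry x (i j : nat) : S :=
  if (insub i : option 'I_n, insub j : option 'I_n) is (Some i', Some j')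
  then unitri x i' j' else (i == j)%:R.

Lemma zentry_ord x (i j : 'I_n) : zentry x i j = unitri x i j.
Proof. by rewrite /zentry !valK. Qed.

Lemma zentry_above x (km : above n) :
  zentry x (val km).1 (val km).2 =
  of_coords (fun c => tnth x (enum_rank ((km, c) : UC))).
Proof. by rewrite zentry_ord mxE -surjective_pairing valK. Qed.

Lemma unitriangular_zentry x : unitriangular (zentry x).
Proof.
move=> i j ji; rewrite /zentry; case: insubP => // i' _ iE; case: insubP => // j' _ jE.
by rewrite mxE insubF /=; [rewrite -val_eqE/= iE jE|rewrite iE jE ltnNge ji].
Qed.

Lemma sminor_zentry x (p q : 'I_n) :
  sminor (unitri x) p q = cornergram (zentry x) p.+1 q.+1.
Proof.
rewrite /sminor /cornergram /gram; congr (real_det (_ *m adjointmx _));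
  by apply/matrixP => i j; rewrite [LHS]mxE [RHS]mxE -zentry_ord.
Qed.

Lemma kmeasurable_zentry i j : kmeasurable (fun x => zentry x i j).
Proof.
rewrite /zentry; case: insubP => [i' _ _|_]; last exact: kmeasurable_cst.
case: insubP => [j' _ _|_]; last exact: kmeasurable_cst.
rewrite /unitri => c.
under eq_fun => x do rewrite mxE.
case: insubP => [km _ _|_]; last exact: measurable_cst.
under eq_fun => x do rewrite of_coordsK.
exact: measurable_tnth.
Qed.

Local Notation G x p q := (cornergram (zentry x) p q).

Definition urow u : nat := (val u.1).1.
Definition ucol u : nat := (val u.1).2.

Lemma urow_lt_ucol u : (urow u < ucol u)%N. Proof. exact: (valP u.1). Qed.

(** Coordinate [u.2] of the affine form S z + r whose squared norm appears in
    [cornergram_cross]. *)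
Definition tcoef x u : R :=
  G x (urow u) (ucol u) * tnth x (enum_rank u) + cross (zentry x) (urow u) (ucol u) u.2.

(** For [j = 0] this is the first summand of [cornergram_cross], and for
    [j = rdim K] the whole right-hand side: the successive quotients split
    rho into one factor for each real coordinate. *)
Definition qcoef x (km : above n) (j : nat) : R :=
  G x (val km).1.+1 (val km).2 * G x (val km).1 (val km).2.+1 +
  \sum_(c < rdim K | (c < j)%N) tcoef x (km, c) ^+ 2.

(** [acoef u] and [bcoef u] are the intercept and the slope of
    w = tcoef / sqrt qcoef as an affine function of coordinate [u]. *)
Definition acoef u x : R :=
  cross (zentry x) (urow u) (ucol u) u.2 * qcoef x u.1 u.2 `^ (- 2^-1).
Definition bcoef u x : R := G x (urow u) (ucol u) * qcoef x u.1 u.2 `^ (- 2^-1).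

Lemma G_gt0 x p q : (p <= q)%N -> 0 < G x p q.
Proof. exact/cornergram_gt0/unitriangular_zentry. Qed.

Lemma qcoef_gt0 x km j : 0 < qcoef x km j.
Proof.
have kml : ((val km).1 < (val km).2)%N by exact: (valP km).
rewrite ltr_wpDr ?sumr_ge0// => [c _|]; first exact: sqr_ge0.
by rewrite mulr_gt0 ?G_gt0// ltnW// ltnW.
Qed.

Lemma bcoef_gt0 u x : 0 < bcoef u x.
Proof. by rewrite mulr_gt0 ?powR_gt0 ?qcoef_gt0// G_gt0// ltnW// urow_lt_ucol. Qed.

Lemma measurable_G p q : measurable_fun setT (fun x => G x p q).
Proof. by apply: measurable_cornergram; exact: kmeasurable_zentry. Qed.

Lemma measurable_tcoef u : measurable_fun setT (fun x => tcoef x u).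
Proof.
apply: measurable_funD.
  by apply: measurable_funM; [exact: measurable_G|exact: measurable_tnth].
by apply: measurable_cross; exact: kmeasurable_zentry.
Qed.

Lemma measurable_qcoef km j : measurable_fun setT (fun x => qcoef x km j).
Proof.
apply: measurable_funD; first by apply: measurable_funM; exact: measurable_G.
rewrite (_ : (fun x => _) = (fun x => \sum_(c < rdim K) if (c < j)%N then tcoef x (km,
  c) ^+ 2 else 0)).
  apply: measurable_sum => c; case: (c < j)%N; last exact: measurable_cst.
  by apply: measurable_funX; exact: measurable_tcoef.
by apply/funext => x; rewrite big_mkcond.
Qed.

Lemma measurable_acoef u : measurable_fun setT (acoef u).
Proof.
apply: measurable_funM.
  by apply: measurable_cross; exact: kmeasurable_zentry.
exact: (measurableT_comp (@measurable_powR R _) (measurable_qcoef _ _)).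
Qed.

Lemma measurable_bcoef u : measurable_fun setT (bcoef u).
Proof.
apply: measurable_funM; first exact: measurable_G.
exact: (measurableT_comp (@measurable_powR R _) (measurable_qcoef _ _)).
Qed.

Section Dependency.
Variables (u : UC) (x y : coords).
Hypothesis xy : forall j : 'I_#|UC|, (j < enum_rank u)%N -> tnth x j = tnth y j.

(** Entries of the corner with lower right position [u], this position excepted,
    come earlier than [u] in the enumeration or are constant. *)
Lemma zentry_agree i j : (i <= urow u)%N -> (j <= ucol u)%N -> (i, j) != (urow u, ucol u) ->
  zentry x i j = zentry y i j.
Proof.
move=> ir jc ij; have [ji|ltij] := leqP j i.
  by rewrite !unitriangular_zentry.
have i_n : (i < n)%N by apply: leq_ltn_trans ir (ltn_ord _).
have j_n : (j < n)%N by apply: leq_ltn_trans jc (ltn_ord _).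
pose km : above n := Sub (Ordinal i_n, Ordinal j_n) ltij.
have E z : zentry z i j = zentry z (val km).1 (val km).2 by [].
rewrite !E !zentry_above.
congr of_coords; apply/funext => c; apply: xy; apply: ucoord_rank_lt.
rewrite /ulex /lex /=; apply/orP; left.
move: ij ir jc; rewrite xpair_eqE negb_and leq_eqVlt -val_eqE /= /urow /ucol.
case: (i == _) => //=; last by move=> _ ->.
by move=> jn _; rewrite leq_eqVlt (negPf jn) /= => ->; rewrite orbT.
Qed.

Lemma G_agree p q : (p <= (urow u).+1)%N -> (q <= (ucol u).+1)%N ->
  (p <= urow u)%N || (q <= ucol u)%N -> G x p q = G y p q.
Proof.
move=> pr qc pq; apply: eq_cornergram => i j ip jq; apply: zentry_agree.
- by rewrite -ltnS (leq_trans ip).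
- by rewrite -ltnS (leq_trans jq).
- apply/negP; rewrite xpair_eqE => /andP[/eqP ei /eqP ej].
  by move: pq; rewrite -ei -ej leqNgt ip leqNgt jq.
Qed.

Lemma G_corner_agree : G x (urow u) (ucol u) = G y (urow u) (ucol u).
Proof. by apply: G_agree; rewrite ?leqnSn ?leqnn. Qed.

Lemma cross_agree c : cross (zentry x) (urow u) (ucol u) c = cross (zentry y) (urow u) (ucol u) c.
Proof. by apply: eq_cross => i j; exact: zentry_agree. Qed.

Lemma qcoef_agree : qcoef x u.1 u.2 = qcoef y u.1 u.2.
Proof.
have G1 : G x (urow u).+1 (ucol u) = G y (urow u).+1 (ucol u).
  by apply: G_agree; rewrite ?leqnSn ?leqnn ?orbT.
have G2 : G x (urow u) (ucol u).+1 = G y (urow u) (ucol u).+1.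
  by apply: G_agree; rewrite ?leqnSn ?leqnn.
rewrite /qcoef -/(urow u) -/(ucol u) G1 G2; congr (_ + _).
apply: eq_bigr => c cu; rewrite /tcoef -/(urow u) -/(ucol u).
rewrite -[urow (u.1, c)]/(urow u) -[ucol (u.1, c)]/(ucol u) /= cross_agree.
rewrite G_corner_agree xy//; apply: ucoord_rank_lt.
by apply/orP; right; rewrite /= eqxx; exact: cu.
Qed.

Lemma acoef_agree : acoef u x = acoef u y.
Proof. by rewrite /acoef cross_agree qcoef_agree. Qed.

Lemma bcoef_agree : bcoef u x = bcoef u y.
Proof. by rewrite /bcoef G_corner_agree qcoef_agree. Qed.

End Dependency.

Definition wcoord x : coords :=
  affine_tuple (fun i => acoef (enum_val i)) (fun i => bcoef (enum_val i)) x.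

Definition jac x : R := \prod_(i < #|UC|) bcoef (enum_val i) x.

Lemma measurable_wcoord : measurable_fun setT wcoord.
Proof.
by apply: measurable_affine_tuple => i; [exact: measurable_acoef|exact: measurable_bcoef].
Qed.

Lemma measurable_jac : measurable_fun setT jac.
Proof. by apply: measurable_prod => i _; exact: measurable_bcoef. Qed.

Lemma jac_gt0 x : 0 < jac x.
Proof. by apply: prodr_gt0 => i _; exact: bcoef_gt0. Qed.

Lemma ge0_integral_wcoord (h : coords -> \bar R) :
  measurable_fun setT h -> (forall x, 0 <= h x)%E ->
  (\int[lebesgue_unitri R K n]_x h x =
   \int[lebesgue_unitri R K n]_x (h (wcoord x) * (jac x)%:E))%E.
Proof.
apply: ge0_integral_affine_tuple.
- by move=> i; exact: measurable_acoef.
- by move=> i; exact: measurable_bcoef.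
- by move=> i x; exact: bcoef_gt0.
- by move=> i x y xy; apply: acoef_agree => j; rewrite enum_valK; exact: xy.
- by move=> i x y xy; apply: bcoef_agree => j; rewrite enum_valK; exact: xy.
Qed.

Lemma tnth_wcoord x u :
  tnth (wcoord x) (enum_rank u) = tcoef x u * qcoef x u.1 u.2 `^ (- 2^-1).
Proof. by rewrite tnth_mktuple enum_rankK /acoef /bcoef /tcoef; ring. Qed.

Definition logw x u : R := ln (1 + tnth (wcoord x) (enum_rank u) ^+ 2).

(** Since w^2 = tcoef^2 / qcoef, the number 1 + w^2 is the quotient of the next
    [qcoef] by the current one. *)
Lemma logwE x u : logw x u = ln (qcoef x u.1 u.2.+1) - ln (qcoef x u.1 u.2).
Proof.
rewrite /logw tnth_wcoord; set q := qcoef x u.1 u.2.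
have q0 : 0 < q by exact: qcoef_gt0.
have qS : qcoef x u.1 u.2.+1 = q + tcoef x u ^+ 2.
  rewrite /q /qcoef -addrA; congr (_ + _).
  rewrite (bigD1 u.2) ?ltnSn//= addrC -surjective_pairing; congr (_ + _).
  apply: eq_bigl => c; rewrite ltnS leq_eqVlt -val_eqE /=.
  by case: ltngtP.
rewrite -ln_div ?posrE ?qcoef_gt0//; congr ln.
rewrite exprMn -(powR_mulrn 2 (powR_ge0 q _)) -powRrM mulNr mulVf// powR_inv1 ?ltW// qS.
by field; exact: lt0r_neq0.
Qed.

End Coordinates.

(** * Factorization of the integrand *)

Section Sums.

Lemma abel_sum (V : zmodType) k (f : nat -> V) :
  \sum_(c < k) f c = f 0%N *+ k + \sum_(c < k) (f c.+1 - f c) *+ (k - c.+1).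
Proof.
elim: k => [|k IH]; first by rewrite !big_ord0 addr0.
rewrite !big_ord_recr /= subnn mulr0n addr0 IH mulrSr -!addrA; congr (_ + _).
have -> : f k = f 0%N + \sum_(c < k) (f c.+1 - f c).
  by rewrite -(big_mkord xpredT (fun c => f c.+1 - f c)) telescope_sumr// addrC subrK.
rewrite addrCA; congr (_ + _); rewrite -big_split /=; apply: eq_bigr => c _.
by rewrite subSn// mulrSr.
Qed.

Lemma big_above (V : Type) (idx : V) (op : Monoid.com_law idx) n (F : 'I_n -> 'I_n -> V) :
  \big[op/idx]_(km : above n) F (val km).1 (val km).2 =
  \big[op/idx]_(k < n) \big[op/idx]_(m < n | (k < m)%N) F k m.
Proof.
rewrite pair_big_dep /= [RHS](reindex_omap (val : above n -> 'I_n * 'I_n) insub) /=.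
  by apply: eq_bigl => km; rewrite valK eqxx andbT (valP km).
by move=> [k m] /= km; rewrite insubT.
Qed.

Lemma sum_above_nat (V : nmodType) n (F : nat -> nat -> V) :
  \sum_(k < n) \sum_(m < n | (k < m)%N) F k m =
  \sum_(m < n) \sum_(0 <= k < m) F k m.
Proof.
rewrite (exchange_big_dep xpredT)//=; apply: eq_bigr => m _.
by rewrite big_mkord (big_ord_widen n (fun k => F k m))// ltnW.
Qed.

Lemma card_above n : #|{: above n}| = 'C(n, 2).
Proof.
rewrite -sum1_card (big_above _ (fun _ _ => 1%N)).
rewrite (exchange_big_dep xpredT)//= -triangular_sum big_mkord.
apply: eq_bigr => m _.
by rewrite -(big_ord_widen n (fun=> 1%N))// ?sum1_card ?card_ord// ltnW.
Qed.

(** Both sides sum [lambda p q * e k m] over k <= p < m <= q. On the right the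
    weight of [e k m] is the sum of lambdas that occurs in [nu]. *)
Lemma exchange_corner_sum (C : comPzRingType) n (lambda : 'I_n -> 'I_n -> C)
    (e : nat -> nat -> C) :
  \sum_(p < n) \sum_(q < n | (p < q)%N)
    lambda p q * (\sum_(p.+1 <= m < q.+1) \sum_(0 <= k < p.+1) e k m) =
  \sum_(k < n) \sum_(m < n | (k < m)%N)
    (\sum_(p < n | (k <= p < m)%N) \sum_(q < n | (m <= q)%N) lambda p q) * e k m.
Proof.
pose T (p q k m : 'I_n) : C :=
  if [&& (k <= p)%N, (p < m)%N & (m <= q)%N] then lambda p q * e k m else 0.
transitivity (\sum_p \sum_q \sum_k \sum_m T p q k m).
  apply: eq_bigr => p _; rewrite big_mkcond; apply: eq_bigr => q _.
  rewrite [RHS]exchange_big /=; case: ifPn => pq; last first.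
    rewrite big1// => m _; rewrite big1// => k _; rewrite /T ifF//.
    apply/negP => /and3P[_ pm mq]; move/negP: pq; apply; exact: leq_trans mq.
  rewrite big_geq_mkord (big_ord_widen_cond n (fun m => true && (p < m)%N) (fun m =>
    \sum_(0 <= k < p.+1) e k m))//.
  rewrite mulr_sumr big_mkcond; apply: eq_bigr => m _.
  rewrite big_mkord (big_ord_widen n (fun k => e k m))// mulr_sumr.
  case: ifPn => pmq.
    rewrite big_mkcond; apply: eq_bigr => k _; rewrite /T ltnS.
    by move: pmq; rewrite ltnS => ->; rewrite andbT.
  rewrite big1// => k _; rewrite /T ifF//.
  by move: pmq; rewrite ltnS => /negPf ->; rewrite andbF.
transitivity (\sum_k \sum_m \sum_p \sum_q T p q k m).
  rewrite pair_bigA /=; under eq_bigr do rewrite pair_bigA /=.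
  by rewrite exchange_big /= -(pair_bigA _ (fun k m => \sum_pq T pq.1 pq.2 k m)) /=;
    under eq_bigr do under eq_bigr do rewrite -(pair_bigA _ (fun p q => T p q _ _)).
apply: eq_bigr => k _; rewrite [RHS]big_mkcond; apply: eq_bigr => m _.
case: ifPn => km; last first.
  rewrite big1// => p _; rewrite big1// => q _; rewrite /T ifF//.
  apply/negP => /and3P[kp pm _]; move/negP: km; apply; exact: leq_ltn_trans pm.
rewrite mulr_suml [RHS]big_mkcond; apply: eq_bigr => p _.
rewrite mulr_suml; case: ifPn => kpm; last first.
  by rewrite big1// => q _; rewrite /T andbA (negPf kpm).
by rewrite [RHS]big_mkcond; apply: eq_bigr => q _; rewrite /T andbA kpm.
Qed.

End Sums.

Section Factorization.
Variables (R : realType) (K : scalars) (n : nat) (lambda : 'I_n -> 'I_n -> R[i]).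
Local Notation S := (carrier R K).
Local Notation coords := (uspace R K n).
Local Notation UC := (ucoord K n).
Local Notation nuK := (nu K lambda).
Implicit Types (x : coords) (u : UC).
Local Notation G x p q := (cornergram (zentry x) p q).

(** The exponent of 1 + w^2 for coordinate [u]. This factor also divides [qcoef]
    at each of the [rdim K - u.2.+1] later coordinates of the same entry, and
    each of them contributes half a power of it to the Jacobian. *)
Definition mu u : R[i] :=
  nuK (val u.1).1 (val u.1).2 - ((rdim K - u.2.+1)%N%:R / 2).

Let L x p q : R := ln (G x p q).
Let ell x k m : R := L x k.+1 m.+1 + L x k m - L x k.+1 m - L x k m.+1.

Let L0 x m : L x 0%N m = 0. Proof. by rewrite /L cornergram0 ln1. Qed.
Let Ld x m : L x m m = 0.
Proof. by rewrite /L cornergram_diag ?ln1//; exact: unitriangular_zentry. Qed.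

Lemma qcoef0 x km :
  ln (qcoef x km 0) = L x (val km).1.+1 (val km).2 + L x (val km).1 (val km).2.+1.
Proof.
have kml : ((val km).1 < (val km).2)%N by exact: (valP km).
rewrite /qcoef big_pred0// addr0 lnM// posrE G_gt0//; exact/ltnW/ltnW.
Qed.

Lemma qcoef_rdim x km :
  ln (qcoef x km (rdim K)) = L x (val km).1.+1 (val km).2.+1 + L x (val km).1 (val km).2.
Proof.
have kml : ((val km).1 < (val km).2)%N by exact: (valP km).
rewrite -lnM ?posrE ?G_gt0//; try exact: ltnW.
rewrite cornergram_cross ?G_gt0//; last exact: ltnW.
congr (ln (_ + _)); apply: eq_big => [c|c _]; first by rewrite ltn_ord.
by rewrite zentry_above of_coordsK.
Qed.

Lemma sum_logw x km : \sum_c logw x (km, c) = ell x (val km).1 (val km).2.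
Proof.
under eq_bigr do rewrite logwE /=.
rewrite -(big_mkord xpredT (fun c => ln (qcoef x km c.+1) - ln (qcoef x km c))).
by rewrite telescope_sumr// qcoef0 qcoef_rdim /ell; ring.
Qed.

Lemma sum_ln_bcoef x km :
  \sum_c ln (bcoef (km, c) x) =
  - (rdim K)%:R / 2 * (L x (val km).1.+1 (val km).2 + L x (val km).1 (val km).2.+1 -
      L x (val km).1 (val km).2 *+ 2) -
  \sum_(c < rdim K) (rdim K - c.+1)%:R / 2 * logw x (km, c).
Proof.
have kml : ((val km).1 < (val km).2)%N by exact: (valP km).
have E c : ln (bcoef (km, c) x) = L x (val km).1 (val km).2 - 2^-1 * ln (qcoef x km c).
  rewrite /bcoef lnM ?posrE ?powR_gt0 ?qcoef_gt0// ?G_gt0//; last exact: ltnW.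
  by rewrite ln_powR mulNr.
under eq_bigr do rewrite E.
rewrite sumrB -mulr_sumr (abel_sum _ (fun c => ln (qcoef x km c))) qcoef0.
rewrite sumr_const card_ord mulrDr opprD addrA; congr (_ - _).
  by field.
rewrite mulr_sumr; apply: eq_bigr => c _.
by rewrite logwE /= -mulr_natl; ring.
Qed.

Lemma sum_jacobian x :
  \sum_(km : above n) (L x (val km).1.+1 (val km).2 + L x (val km).1 (val km).2.+1 -
      L x (val km).1 (val km).2 *+ 2) =
  \sum_(km : above n) ((val km).2 - (val km).1 - 1)%N%:R * ell x (val km).1 (val km).2.
Proof.
rewrite (big_above _ (fun k m => L x k.+1 m + L x k m.+1 - L x k m *+ 2)).
rewrite (big_above _ (fun k m => (m - k - 1)%N%:R * ell x k m)).
rewrite !(sum_above_nat n (fun k m => L x k.+1 m + L x k m.+1 - L x k m *+ 2)).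
rewrite !(sum_above_nat n (fun k m => (m - k - 1)%N%:R * ell x k m)).
apply: eq_bigr => m _; rewrite (jacobian_log_sum (L0 x) (Ld x)).
by apply: eq_bigr => k _; rewrite mulr_natl.
Qed.

(** The logarithm of the factorization. The lambdas are collected by
    [exchange_corner_sum]; the remaining terms of [mu] are exactly those of the
    logarithm of the Jacobian, by [sum_ln_bcoef] and [sum_jacobian]. *)
Lemma integrand_log x :
  \sum_(p < n) \sum_(q < n | (p < q)%N) - lambda p q * (L x p.+1 q.+1)%:C =
  \sum_u - mu u * (logw x u)%:C + (\sum_u ln (bcoef u x))%:C.
Proof.
have SB (V : nmodType) (F : UC -> V) : \sum_u F u = \sum_km \sum_c F (km, c).
  by rewrite pair_bigA; apply: eq_bigr => -[km c].
transitivity (\sum_(km : above n) - (\sum_(p < n | ((val km).1 <= p < (val km).2)%N)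
    \sum_(q < n | ((val km).2 <= q)%N) lambda p q) * (ell x (val km).1 (val km).2)%:C).
  rewrite (big_above _ (fun k m => - (\sum_(p < n | (k <= p < m)%N)
    \sum_(q < n | (m <= q)%N) lambda p q) * (ell x k m)%:C)).
  under [RHS]eq_bigr do under eq_bigr do rewrite mulNr.
  under [RHS]eq_bigr do rewrite sumrN.
  rewrite sumrN -(exchange_corner_sum lambda (fun k m => (ell x k m)%:C)) -sumrN.
  apply: eq_bigr => p _; rewrite -sumrN; apply: eq_bigr => q pq.
  rewrite mulNr (corner_log_sum (L0 x) (Ld x)) ?ltnS ?(ltnW pq)//.
  congr (- (_ * _)); rewrite rmorph_sum; apply: eq_bigr => m _.
  by rewrite rmorph_sum.
rewrite !SB; under [X in _ + X%:C]eq_bigr do rewrite sum_ln_bcoef.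
have halfC (N : nat) : (N%:R / 2 : R)%:C = N%:R / 2 :> R[i].
  by rewrite rmorphM fmorphV !rmorph_nat.
have E km : \sum_(c < rdim K) - mu (km, c) * (logw x (km, c))%:C =
    - nuK (val km).1 (val km).2 * (ell x (val km).1 (val km).2)%:C +
    (\sum_(c < rdim K) (rdim K - c.+1)%:R / 2 * logw x (km, c))%:C.
  rewrite -sum_logw !rmorph_sum mulr_sumr -big_split /=; apply: eq_bigr => c _.
  by rewrite rmorphM /= halfC /mu /=; ring.
under [X in _ = X + _]eq_bigr do rewrite E.
rewrite rmorph_sum -big_split /=.
transitivity (\sum_(km : above n) (- nuK (val km).1 (val km).2 * (ell x (val km).1 (val
  km).2)%:C) +
   (- (rdim K)%:R / 2 * \sum_(km : above n) (L x (val km).1.+1 (val km).2 + L x (val km).1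
     (val km).2.+1 -
      L x (val km).1 (val km).2 *+ 2))%:C).
  rewrite sum_jacobian mulr_sumr rmorph_sum -big_split /=; apply: eq_bigr => km _.
  rewrite /nu; set Lam := (\sum_(p < n | _) _); set d := (_ - _ - 1)%N.
  rewrite !rmorphM rmorphN fmorphV !rmorph_nat; by field.
rewrite mulr_sumr rmorph_sum -big_split /=; apply: eq_bigr => km _.
by rewrite rmorphB; ring.
Qed.

Lemma integrand_wcoord x : integrand lambda x =
  \prod_(i < #|UC|) cpow (1 + tnth (wcoord x) i ^+ 2) (- mu (enum_val i)) * (jac x)%:C.
Proof.
have logE : \sum_(p < n) \sum_(q < n | (p < q)%N) - lambda p q * (L x p.+1 q.+1)%:C =
  \sum_u - mu u * (logw x u)%:C + (\sum_u ln (bcoef u x))%:C by exact: integrand_log.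
have -> : integrand lambda x =
    cexp (\sum_(p < n) \sum_(q < n | (p < q)%N) - lambda p q * (L x p.+1 q.+1)%:C).
  rewrite cexp_sum; apply: eq_bigr => p _; rewrite cexp_sum; apply: eq_bigr => q _.
  by rewrite sminor_zentry.
have rank_bij : {on [pred i | true], bijective (@enum_rank UC)}.
  by apply: onW_bij; exact: enum_rank_bij.
rewrite logE cexpD cexp_sum cexp_real; congr (_ * _%:C).
  rewrite [RHS](reindex _ rank_bij); apply: eq_bigr => u _.
  by rewrite enum_rankK.
rewrite /jac [RHS](reindex _ rank_bij) expR_sum; apply: eq_bigr => u _.
by rewrite enum_rankK lnK// posrE bcoef_gt0.
Qed.

End Factorization.

(** * The product of Beta integrals *)

Section BetaProduct.
Variable R : realType.
Local Notation mR := (measurableTypeR R).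
Local Notation leb := (@lebesgue_measure R).
Local Notation Re := (@complex.Re R).
Implicit Types z : R[i].

Lemma normc_prod (I : Type) (r : seq I) (P : pred I) (F : I -> R[i]) :
  Normc.normc (\prod_(i <- r | P i) F i) = \prod_(i <- r | P i) Normc.normc (F i).
Proof. exact: (big_morph _ (@Normc.normcM R) (@Normc.normc1 R)). Qed.

Lemma normc_beta z (x : R) :
  Normc.normc (cpow (1 + x ^+ 2) (- z)) = (1 + x ^+ 2) `^ (- Re z).
Proof. by rewrite normc_cpow ?gt0_1Dsqr// complex_ReN. Qed.

Lemma cmeasurable_beta z :
  cmeasurable setT (fun x : mR => cpow (1 + x ^+ 2) (- z)).
Proof. by apply: measurable_cpow; exact: measurable_1Dsqr. Qed.

Lemma abs_integrable_beta z : 2^-1 < Re z ->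
  abs_integrable leb setT (fun x : mR => cpow (1 + x ^+ 2) (- z)).
Proof.
move=> z2; have [mr mi] := cmeasurable_beta z; split => //.
under eq_integral do rewrite normc_beta.
exact: betaE_lty.
Qed.

Lemma cintegral_beta z : 2^-1 < Re z ->
  cintegral leb setT (fun x : mR => cpow (1 + x ^+ 2) (- z)) =
  (Num.sqrt pi)%:C * (cGamma (z - (2^-1)%:C) / cGamma z).
Proof.
move=> z2; have Gz : cGamma z != 0 by apply: cGamma_neq0; lra.
by apply: (mulIf Gz); rewrite cbeta// -mulrA divfK.
Qed.

(** Only a factor 0 could compensate a factor +oo. *)
Lemma prode_lty (I : finType) (F : I -> \bar R) : (forall i, 0 < F i)%E ->
  (\prod_i F i < +oo)%E -> forall i, (F i < +oo)%E.
Proof.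
move=> F0 + i; rewrite !ltey; apply: contra_neq => Fi.
rewrite (bigD1 i)//= Fi gt0_mulye//.
by elim/big_ind : _ => // a b; exact: mule_gt0.
Qed.

(** The integral of the modulus is the product of the positive numbers
    [betaE (Re (z i))], each of which is infinite when [Re (z i) <= 2^-1]. *)
Lemma abs_integrable_beta_prod d (z : 'I_d -> R[i]) :
  abs_integrable (lebesgue_tuple R d) setT
    (fun t => \prod_(i < d) cpow (1 + tnth t i ^+ 2) (- z i)) <->
  forall i, 2^-1 < Re (z i).
Proof.
split => [[_ _ foo] i|zi]; last first.
  by apply: (cintegral_tuple_prod (g := fun i x => cpow (1 + x ^+ 2) (- z i)) _).1 => i;
    exact: abs_integrable_beta.
have : (\prod_(i < d) betaE (Re (z i)) < +oo)%E.
  rewrite -(ge0_integral_tuple_prod (g := fun i x => (1 + x ^+ 2) `^ (- Re (z i)))).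
  - apply: le_lt_trans foo; rewrite le_eqVlt; apply/orP; left; apply/eqP.
    apply: eq_integral => t _; rewrite normc_prod; congr EFin.
    by apply: eq_bigr => j _; rewrite normc_beta.
  - move=> j; exact: (measurableT_comp (@measurable_powR R _) (@measurable_1Dsqr R)).
  - by move=> j x; exact: powR_ge0.
move=> /prode_lty => /(_ (fun j => betaE_gt0 _)) /(_ i).
by have [//|zi] := ltP 2^-1 (Re (z i)); rewrite betaE_eqy ?ltxx.
Qed.

(** For [k = 0] the quotient would be [f 0 / f 0], which need not be 1. *)
Lemma prod_ratio k (f : nat -> R[i]) : (forall j, (j < k)%N -> f j != 0) ->
  \prod_(j < k) (f j.+1 / f j) = f k / f 0%N \/ k = 0%N.
Proof.
elim: k => [|k IH] f0; first by right.
left; rewrite big_ord_recr /=; case: IH => [j jk|->|k0]; first exact/f0/ltnW.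
  by rewrite mulrC mulrA divfK// f0.
by rewrite k0 big_ord0 mul1r.
Qed.

End BetaProduct.

Section UnitriangularIntegral.
Variables (R : realType) (K : scalars) (n : nat) (lambda : 'I_n -> 'I_n -> R[i]).
Local Notation UC := (ucoord K n).
Local Notation Re := (@complex.Re R).
Local Notation LU := (lebesgue_unitri R K n).
Local Notation nuK := (nu K lambda).
Local Notation muK := (@mu R K n lambda).

Let f (t : uspace R K n) : R[i] :=
  \prod_(i < #|UC|) cpow (1 + tnth t i ^+ 2) (- muK (enum_val i)).

Let mf : cmeasurable setT f.
Proof.
apply: cmeasurable_prod => i _; have [mr mi] := cmeasurable_beta (muK (enum_val i)).
by split; [exact: (measurableT_comp mr (@measurable_tnth _ _ _ i))|
  exact: (measurableT_comp mi (@measurable_tnth _ _ _ i))].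
Qed.

Let fE : (fun x => f (wcoord x) * (jac x)%:C) = integrand lambda.
Proof. by apply/funext => x; rewrite integrand_wcoord. Qed.

Lemma rdim_gt0 : (0 < rdim K)%N. Proof. by case: K. Qed.

Lemma Re_mu u : Re (muK u) =
  Re (nuK (val u.1).1 (val u.1).2) - (rdim K - u.2.+1)%:R / 2.
Proof.
rewrite /mu; set N := (_ - _)%N.
have -> : N%:R / 2 = (N%:R / 2 : R)%:C by rewrite rmorphM fmorphV !rmorph_nat.
by case: (nuK _ _).
Qed.

(** The strictest condition is that of the first real coordinate, where [mu] is
    [nu] minus [(rdim K - 1) / 2]. *)
Lemma mu_gt_nu_gt : (forall u : UC, 2^-1 < Re (muK u)) <->
  (forall p q : 'I_n, (p < q)%N -> (rdim K)%:R / 2 < Re (nuK p q)).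
Proof.
split => [h p q pq|h [km c]].
  pose km : above n := Sub (p, q) pq.
  have := h (km, Ordinal rdim_gt0); rewrite Re_mu /= -/km.
  by rewrite natrB ?rdim_gt0//; lra.
have := h (val km).1 (val km).2 (valP km); rewrite Re_mu /=.
rewrite natrB// -(natr1 c); have : (0 <= c%:R :> R) by [].
lra.
Qed.

Lemma abs_integrable_integrand :
  abs_integrable LU setT (integrand lambda) <->
  (forall p q : 'I_n, (p < q)%N -> (rdim K)%:R / 2 < Re (nuK p q)).
Proof.
have T := abs_integrable_transfer (fun x => ltW (jac_gt0 x))
  (@measurable_wcoord R K n) (@measurable_jac R K n)
  (fun h => @ge0_integral_wcoord R K n h) mf.
rewrite fE in T; rewrite -T -mu_gt_nu_gt abs_integrable_beta_prod.
split => h u; last exact: h.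
by have := h (enum_rank u); rewrite enum_rankK.
Qed.

(** The Beta integrals of the coordinates of one entry have arguments that
    differ by 1/2, so their product telescopes to a single quotient of Gamma
    values. *)
Lemma cintegral_integrand :
  (forall p q : 'I_n, (p < q)%N -> (rdim K)%:R / 2 < Re (nuK p q)) ->
  cintegral LU setT (integrand lambda) =
  (pi `^ ((rdim K * (n * (n - 1)))%N%:R / 4))%:C *
  \prod_(p < n) \prod_(q < n | (p < q)%N)
     (cGamma (nuK p q - (rdim K)%:R / 2) / cGamma (nuK p q)).
Proof.
move=> hnu; have hmu := mu_gt_nu_gt.2 hnu.
have := cintegral_transfer (fun x => ltW (jac_gt0 x))
  (fun h => @ge0_integral_wcoord R K n h) mf.
rewrite fE => <-.
have [_ ->] := cintegral_tuple_prod (fun i : 'I_#|UC| => abs_integrable_beta (hmu (enum_val i))).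
have rank_bij : {on [pred i | true], bijective (@enum_rank UC)}.
  by apply: onW_bij; exact: enum_rank_bij.
under eq_bigr do rewrite cintegral_beta//.
rewrite big_split /=; congr (_ * _).
  rewrite prodr_const card_ord card_prod card_above card_ord -rmorphXn /=.
  congr (_%:C); rewrite -powR12_sqrt ?pi_ge0// -powR_mulrn ?powR_ge0// -powRrM.
  congr (_ `^ _).
  have : ('C(n, 2) * 2 = n * (n - 1))%N.
    by rewrite -[2%N in LHS]/(2`!) bin_ffact ffactnS ffactn1 subn1.
  by move=> E; rewrite [in RHS]mulnC -E !natrM; field.
rewrite (reindex _ rank_bij) /=; under eq_bigr do rewrite enum_rankK.
rewrite -(big_above _ (fun p q => cGamma (nuK p q - (rdim K)%:R / 2) / cGamma (nuK p q))).
rewrite (_ : \prod_(j : UC) _ = \prod_(km : above n) \prod_(c < rdim K)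
   (cGamma (muK (km, c) - (2^-1)%:C) / cGamma (muK (km, c)))); last first.
  by rewrite pair_bigA; apply: eq_bigr => -[km c].
apply: eq_bigr => km _.
pose g j : R[i] := cGamma (nuK (val km).1 (val km).2 - j%:R / 2).
transitivity (\prod_(j < rdim K) (g j.+1 / g j)).
  (* Reversing the order of c, the exponent [mu] becomes nu - c / 2. *)
  rewrite [RHS](reindex_inj rev_ord_inj) /=; apply: eq_bigr => c _.
  congr (cGamma _ / cGamma _).
  rewrite /mu /= -addrA -opprD; congr (_ - _).
  by rewrite fmorphV rmorph_nat -(natr1 (rdim K - c.+1)); ring.
have g0 j : (j < rdim K)%N -> g j != 0.
  move=> jK; apply: cGamma_neq0.
  have -> : j%:R / 2 = (j%:R / 2 : R)%:C by rewrite rmorphM fmorphV !rmorph_nat.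
  have -> : Re (nuK (val km).1 (val km).2 - (j%:R / 2)%:C) =
    Re (nuK (val km).1 (val km).2) - j%:R / 2 by case: (nuK _ _).
  have := hnu _ _ (valP km); have : (j%:R < (rdim K)%:R :> R) by rewrite ltr_nat.
  lra.
case: (prod_ratio g0) => [->|K0]; last by have := rdim_gt0; rewrite K0.
by rewrite /g mul0r subr0.
Qed.

End UnitriangularIntegral.

Theorem theorem1p1 (R : realType) (K : scalars) (n : nat) (hn : (2 <= n)%N)
    (lambda : 'I_n -> 'I_n -> R[i]) :
  (abs_integrable (lebesgue_unitri R K n) [set: uspace R K n]
     (integrand lambda) <->
   (forall p q : 'I_n, (p < q)%N ->
      (rdim K)%:R / 2 < complex.Re (nu K lambda p q)))
  /\
  ((forall p q : 'I_n, (p < q)%N ->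
      (rdim K)%:R / 2 < complex.Re (nu K lambda p q)) ->
   cintegral (lebesgue_unitri R K n) [set: uspace R K n] (integrand lambda) =
   (pi `^ ((rdim K * (n * (n - 1)))%N%:R / 4))%:C *
   \prod_(p < n) \prod_(q < n | (p < q)%N)
     (cGamma (nu K lambda p q - (rdim K)%:R / 2) / cGamma (nu K lambda p q))).
Proof. by split; [exact: abs_integrable_integrand|exact: cintegral_integrand]. Qed.
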